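(* Let $p\in[1,\infty)\setminus\{2\}$. Let $\mathcal G$ and $\mathcal H$ be topologically principal, locally compact, Hausdorff, étale groupoids with compact unit spaces, let $\mathcal E$ be a twist over $\mathcal G$ and let $\mathcal F$ be a twist over $\mathcal H$. Then there is an isometric isomorphism $F^p_\lambda(\mathcal G;\mathcal E)\cong F^p_\lambda(\mathcal H;\mathcal F)$ if and only if there is an isomorphism of (topological) groupoids $\mathcal G\cong\mathcal H$ such that, viewing $\mathcal F$ as a twist over $\mathcal G$ through this isomorphism, $[\mathcal E]=[\mathcal F]$ in $\mathrm{Tw}(\mathcal G)$.
   Context: A groupoid $\mathcal G$ has unit space $\mathcal G^{(0)}$, range $r(\gamma)=\gamma\gamma^{-1}$ and source $s(\gamma)=\gamma^{-1}\gamma$; $\mathcal G_x=s^{-1}(x)$, $\mathcal G^x=r^{-1}(x)$. A locally compact groupoid is étale if $r\colon\mathcal G\to\mathcal G^{(0)}$ is a local homeomorphism. It is topologically principal if the set of $x\in\mathcal G^{(0)}$ with $\mathcal G_x\cap\mathcal G^x=\{x\}$ is dense in $\mathcal G^{(0)}$. A twist over an étale groupoid $\mathcal G$ is a sequence $\mathcal G^{(0)}\times\mathbb T\xrightarrow{i}\mathcal E\xrightarrow{\pi}\mathcal G$, where $\mathcal G^{(0)}\times\mathbb T$ is the trivial group bundle with fibres $\mathbb T$, $\mathcal E$ is a locally compact Hausdorff groupoid, $i,\pi$ are continuous groupoid homomorphisms restricting to homeomorphisms of unit spaces, and: (1) $i$ is injective; (2) every $\gamma\in\mathcal G$ has a bisection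 neighbourhood $U$ with a continuous section $S\colon U\to\mathcal E$, $\pi\circ S=\mathrm{id}_U$, such that $(\gamma,z)\mapsto i(r(\gamma),z)S(\gamma)$ is a homeomorphism $U\times\mathbb T\to\pi^{-1}(U)$; (3) $i(r(\varepsilon),z)\varepsilon=\varepsilon i(s(\varepsilon),z)$ for all $\varepsilon\in\mathcal E,z\in\mathbb T$; (4) $\pi^{-1}(\mathcal G^{(0)})=i(\mathcal G^{(0)}\times\mathbb T)$. Write $z\cdot\varepsilon=i(r(\varepsilon),z)\varepsilon$; $\mathcal E^{(0)}$ is identified with $\mathcal G^{(0)}$ via $x\mapsto i(x,1)$. $\Sigma_c(\mathcal G;\mathcal E)=\{f\in C_c(\mathcal E):f(z\cdot\varepsilon)=zf(\varepsilon)\ \forall\varepsilon\in\mathcal{E},z\in\mathbb{T}\}$. For $x\in\mathcal G^{(0)}$, $\mathcal E_x=s^{-1}(x)$ carries the measure $\nu_x$ which on each $\pi^{-1}(\gamma)$, $\gamma\in\mathcal G_x$, is the copy of normalized Haar measure of $\mathbb T$ under $z\mapsto z\cdot\delta$ (any $\delta\in\pi^{-1}(\gamma)$). The product on $\Sigma_c(\mathcal G;\mathcal E)$ is $(f\ast g)(\varepsilon)=\int_{\mathcal E_{s(\varepsilon)}}f(\varepsilon\gamma^{-1})g(\gamma)\,d\nu_{s(\varepsilon)}(\gamma)$. $L^p(\mathcal G_x;\mathcal E_x)$ is the space of $p$-integrable $\mathbb T$-equivariant functions on $\mathcal E_x$; $\lambda_x(f)\xi(\varepsilon)=\int_{\mathcal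 E_x}f(\varepsilon\gamma^{-1})\xi(\gamma)\,d\nu_x(\gamma)$ defines $\lambda_x\colon\Sigma_c(\mathcal G;\mathcal E)\to\mathcal B(L^p(\mathcal G_x;\mathcal E_x))$. $F^p_\lambda(\mathcal G;\mathcal E)$ is the completion of $\Sigma_c(\mathcal G;\mathcal E)$ in $\|f\|_\lambda=\sup_{x\in\mathcal G^{(0)}}\|\lambda_x(f)\|$. An isometric isomorphism means an isometric algebra isomorphism. Two twists $\mathcal G^{(0)}\times\mathbb T\xrightarrow{i}\mathcal E\xrightarrow{\pi}\mathcal G$ and $\mathcal G^{(0)}\times\mathbb T\xrightarrow{i'}\mathcal E'\xrightarrow{\pi'}\mathcal G$ over $\mathcal G$ are properly isomorphic if there is an isomorphism of (topological) groupoids $\phi\colon\mathcal E\to\mathcal E'$ with $\phi\circ i=i'$ and $\pi'\circ\phi=\pi$. $[\mathcal E]$ denotes the proper isomorphism class of $\mathcal E$, and $\mathrm{Tw}(\mathcal G)$ the collection of such classes. Given an isomorphism $\theta\colon\mathcal G\to\mathcal H$ and a twist $\mathcal H^{(0)}\times\mathbb T\xrightarrow{i_{\mathcal F}}\mathcal F\xrightarrow{\pi_{\mathcal F}}\mathcal H$, $\mathcal F$ is viewed as a twist over $\mathcal G$ via the maps $(x,z)\mapsto i_{\mathcal F}(\theta(x),z)$ and $\theta^{-1}\circ\pi_{\mathcal F}$. *)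

(* Defs.v *)
From HB Require Import structures.
From mathcomp Require Import all_boot all_order all_algebra.
From mathcomp Require Import all_classical all_reals all_analysis.
From mathcomp Require Import complex.

Set Implicit Arguments.
Unset Strict Implicit.
Unset Printing Implicit Defensive.

Import Order.TTheory GRing.Theory Num.Theory.
Import numFieldNormedType.Exports.

Local Open Scope classical_set_scope.
Local Open Scope complex_scope.
Local Open Scope ring_scope.

(* The modulus topology on the complex numbers [R[i]]. *)
HB.instance Definition _ (R : realType) :=
  NormedModule.copy R[i] (R[i] : numFieldType)^o.

Definition circle (R : realType) : set R[i] := [set z | `|z| = 1].

Definition homeo_on (X Y : topologicalType) (A : set X) (B : set Y)
    (f : X -> Y) : Prop :=
  exists g : Y -> X,
    [/\ forall x, A x -> B (f x) /\ g (f x) = x,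
        forall y, B y -> A (g y) /\ f (g y) = y,
        {within A, continuous f} & {within B, continuous g}].

Lemma within_comp (X Y Z : topologicalType) (A : set X) (B : set Y)
    (f : X -> Y) (g : Y -> Z) :
  {within A, continuous f} -> (forall x, A x -> B (f x)) ->
  {within B, continuous g} -> {within A, continuous (g \o f)}.
Proof.
move=> /subspace_continuousP cf AB /subspace_continuousP cg.
apply/subspace_continuousP => x Ax W /= /(cg _ (AB _ Ax)) /= gW.
have := cf _ Ax _ gW; rewrite /= !nbhs_simpl /within /= => H.
by near=> y => Ay; apply: (near H y) => //; exact: AB.
Unshelve. all: by end_near. Qed.

Lemma homeo_on_comp (X Y Z : topologicalType) (A : set X) (B : set Y)
    (C : set Z) (f : X -> Y) (g : Y -> Z) :
  homeo_on A B f -> homeo_on B C g -> homeo_on A C (g \o f).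
Proof.
move=> [f' [f1 f2 cf cf']] [g' [g1 g2 cg cg']]; exists (f' \o g'); split.
- move=> x Ax /=; have [Bf ff] := f1 _ Ax; have [Cg gg] := g1 _ Bf.
  by split => //; rewrite gg.
- move=> y Cy /=; have [Bf ff] := g2 _ Cy; have [Cg gg] := f2 _ Bf.
  by split => //; rewrite gg.
- by apply: within_comp cf _ cg => x /f1[].
- by apply: within_comp cg' _ cf' => x /g2[].
Qed.

(* The partial product is a total function whose value is only meaningful on
   composable pairs, those with [s(a) = r(b)]. *)
Section RawGroupoid.
Variables (T : Type) (mul : T -> T -> T) (inv : T -> T).
Definition raw_src (a : T) : T := mul (inv a) a.
Definition raw_rng (a : T) : T := mul a (inv a).
Definition raw_comp (a b : T) : Prop := raw_src a = raw_rng b.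
End RawGroupoid.

Record topGroupoid := TopGroupoid {
  gcarrier :> topologicalType;
  gmul : gcarrier -> gcarrier -> gcarrier;
  ginv : gcarrier -> gcarrier;
  ginvK : forall a, ginv (ginv a) = a;
  gmul_src : forall a b, raw_comp gmul ginv a b ->
    raw_src gmul ginv (gmul a b) = raw_src gmul ginv b;
  gmul_rng : forall a b, raw_comp gmul ginv a b ->
    raw_rng gmul ginv (gmul a b) = raw_rng gmul ginv a;
  gmulA : forall a b c, raw_comp gmul ginv a b -> raw_comp gmul ginv b c ->
    gmul (gmul a b) c = gmul a (gmul b c);
  gmulKl : forall a b, raw_comp gmul ginv a b -> gmul (ginv a) (gmul a b) = b;
  gmulKr : forall a b, raw_comp gmul ginv a b -> gmul (gmul a b) (ginv b) = a;
  ginv_continuous : continuous ginv;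
  gmul_continuous :
    {within [set ab : gcarrier * gcarrier | raw_comp gmul ginv ab.1 ab.2],
      continuous (fun ab : gcarrier * gcarrier => gmul ab.1 ab.2)} }.

Definition src (G : topGroupoid) (a : G) : G := raw_src (@gmul G) (@ginv G) a.
Definition rng (G : topGroupoid) (a : G) : G := raw_rng (@gmul G) (@ginv G) a.
Definition composable (G : topGroupoid) (a b : G) : Prop := src a = rng b.
Definition units (G : topGroupoid) : set G := range (@rng G).
Arguments units G : clear implicits.

Definition groupoid_hom (G H : topGroupoid) (f : G -> H) : Prop :=
  forall a b, composable a b ->
    composable (f a) (f b) /\ f (gmul a b) = gmul (f a) (f b).

Record groupoid_iso (G H : topGroupoid) := GroupoidIso {
  iso_fun :> G -> H;
  iso_inv : H -> G;
  iso_funK : cancel iso_fun iso_inv;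
  iso_invK : cancel iso_inv iso_fun;
  iso_fun_continuous : continuous iso_fun;
  iso_inv_continuous : continuous iso_inv;
  iso_fun_hom : groupoid_hom iso_fun }.

(* [r : G -> G^(0)] is a local homeomorphism, [G^(0)] carrying the subspace
   topology. *)
Definition etale (G : topGroupoid) : Prop :=
  forall g : G, exists U V : set G,
    [/\ open U, U g, open V, @rng G @` U = V `&` units G
      & homeo_on U (@rng G @` U) (@rng G)].

Definition topologically_principal (G : topGroupoid) : Prop :=
  units G `<=` closure [set x : G | units G x /\
    [set g : G | src g = x] `&` [set g : G | rng g = x] = [set x]].

Definition open_bisection (G : topGroupoid) (U : set G) : Prop :=
  [/\ open U, {in U &, injective (@src G)} & {in U &, injective (@rng G)}].

Section GroupoidTheory.
Variable K : topGroupoid.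
Implicit Types a b : K.

Lemma rngV a : rng (ginv a) = src a.
Proof. by rewrite /rng /src /raw_rng /raw_src ginvK. Qed.

Lemma srcV a : src (ginv a) = rng a.
Proof. by rewrite /rng /src /raw_rng /raw_src ginvK. Qed.

Lemma composableV a : composable a (ginv a).
Proof. by rewrite /composable rngV. Qed.

Lemma composableVl a : composable (ginv a) a.
Proof. by rewrite /composable srcV. Qed.

Lemma gmulr_src a : gmul a (src a) = a.
Proof. by have := gmulKl (composableVl a); rewrite ginvK. Qed.

Lemma gmull_rng a : gmul (rng a) a = a.
Proof. by have := gmulKr (composableV a); rewrite ginvK. Qed.

Lemma rng_rng a : rng (rng a) = rng a.
Proof. exact: (gmul_rng (composableV a)). Qed.

Lemma src_rng a : src (rng a) = rng a.
Proof. by rewrite -[RHS]srcV; exact: (gmul_src (composableV a)). Qed.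

Lemma unitsP a : units K a -> rng a = a /\ src a = a.
Proof. by move=> [b _ <-]; rewrite rng_rng src_rng. Qed.

Lemma units_rng a : units K (rng a). Proof. by exists a. Qed.

Lemma units_src a : units K (src a). Proof. by rewrite -rngV; exact: units_rng. Qed.

End GroupoidTheory.

Section HomTheory.
Variables (K L : topGroupoid) (f : K -> L).
Hypothesis hf : groupoid_hom f.

Lemma homV a : f (ginv a) = ginv (f a).
Proof.
have [c1 e1] := hf (composableV a).
have cu : composable (rng a) (rng a) by rewrite /composable src_rng rng_rng.
have [c2 e2] := hf cu.
have uu : gmul (rng a) (rng a) = rng a by have := gmull_rng (rng a); rewrite rng_rng.
rewrite uu in e2.
have fu : src (f (rng a)) = f (rng a).
  by have := gmulKl c2; rewrite -e2.
have ru : rng (f (rng a)) = rng (f a).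
  rewrite {1}/rng -/(rng a) [in LHS](_ : f (rng a) = gmul (f a) (f (ginv a))) //.
  exact: (gmul_rng c1).
have := gmulKl c1; rewrite -e1 -/(rng a) => <-.
have -> : gmul a (ginv a) = rng a by [].
by rewrite -fu c2 ru -srcV gmulr_src.
Qed.

Lemma hom_rng a : f (rng a) = rng (f a).
Proof. by rewrite /rng /raw_rng -homV; exact: (hf (composableV a)).2. Qed.

Lemma hom_src a : f (src a) = src (f a).
Proof. by rewrite /src /raw_src -homV; exact: (hf (composableVl a)).2. Qed.

Lemma hom_units a : units K a -> units L (f a).
Proof. by move=> [b _ <-]; rewrite hom_rng; exact: units_rng. Qed.

End HomTheory.

(* [E^(0)] is identified with [G^(0)] by [x |-> i(x,1)]; the field [tw_pi_i]
   records that [pi] implements the inverse identification.  Accordingly a unit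
   of [E] is turned into a unit of [G] by [pi].  The map [tw_i] is only
   meaningful on [G^(0) x T]. *)
Record twist (R : realType) (G : topGroupoid) := Twist {
  tw_groupoid :> topGroupoid;
  tw_locally_compact : locally_compact [set: tw_groupoid];
  tw_hausdorff : hausdorff_space tw_groupoid;
  tw_i : G -> R[i] -> tw_groupoid;
  tw_pi : tw_groupoid -> G;
  tw_i_continuous : {within units G `*` @circle R,
    continuous (fun xz : G * R[i] => tw_i xz.1 xz.2)};
  tw_i_hom : forall x z w, units G x -> circle z -> circle w ->
    composable (tw_i x z) (tw_i x w) /\
    tw_i x (z * w) = gmul (tw_i x z) (tw_i x w);
  tw_i_units : homeo_on (units G) (units tw_groupoid) (fun x => tw_i x 1);
  tw_pi_continuous : continuous tw_pi;
  tw_pi_hom : groupoid_hom tw_pi;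
  tw_pi_units : homeo_on (units tw_groupoid) (units G) tw_pi;
  tw_pi_i : forall x, units G x -> tw_pi (tw_i x 1) = x;
  tw_i_inj : forall x y z w, units G x -> units G y -> circle z -> circle w ->
    tw_i x z = tw_i y w -> x = y /\ z = w;
  tw_section : forall g : G, exists (U : set G) (S : G -> tw_groupoid),
    [/\ open_bisection U, U g, {within U, continuous S},
        (forall h, U h -> tw_pi (S h) = h)
      & homeo_on (U `*` @circle R) (tw_pi @^-1` U)
          (fun hz : G * R[i] => gmul (tw_i (rng hz.1) hz.2) (S hz.1))];
  tw_central : forall (e : tw_groupoid) z, circle z ->
    gmul (tw_i (tw_pi (rng e)) z) e = gmul e (tw_i (tw_pi (src e)) z);
  tw_exact : tw_pi @^-1` units G =
    [set tw_i x z | x in units G & z in @circle R] }.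

Definition tw_act (R : realType) (G : topGroupoid) (E : twist R G) (z : R[i])
    (e : E) : E := gmul (tw_i E (tw_pi (rng e)) z) e.

Section PullbackTwist.
Variables (R : realType) (G H : topGroupoid) (theta : groupoid_iso G H).

Lemma iso_inv_hom : groupoid_hom (iso_inv theta).
Proof.
have ht := @iso_fun_hom _ _ theta.
have inj := can_inj (iso_funK theta).
move=> a b cab.
have c : composable (iso_inv theta a) (iso_inv theta b).
  by apply: inj; rewrite (hom_src ht) (hom_rng ht) !iso_invK.
split=> //; apply: inj.
by rewrite (ht _ _ c).2 !iso_invK.
Qed.

Lemma iso_homeo_units : homeo_on (units G) (units H) theta.
Proof.
exists (iso_inv theta); split.
- by move=> x ux; split; [exact: (hom_units (@iso_fun_hom _ _ theta) ux)|exact: iso_funK].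
- by move=> x ux; split; [exact: (hom_units iso_inv_hom ux)|exact: iso_invK].
- by apply: continuous_subspaceT => ?; exact: iso_fun_continuous.
- by apply: continuous_subspaceT => ?; exact: iso_inv_continuous.
Qed.

Lemma iso_inv_homeo_units : homeo_on (units H) (units G) (iso_inv theta).
Proof.
exists theta; split.
- by move=> x ux; split; [exact: (hom_units iso_inv_hom ux)|exact: iso_invK].
- by move=> x ux; split; [exact: (hom_units (@iso_fun_hom _ _ theta) ux)|exact: iso_funK].
- by apply: continuous_subspaceT => ?; exact: iso_inv_continuous.
- by apply: continuous_subspaceT => ?; exact: iso_fun_continuous.
Qed.

Lemma pair_map_continuous (X Y Z : topologicalType) (f : X -> Y) :
  continuous f -> continuous (fun xz : X * Z => (f xz.1, xz.2)).
Proof.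
move=> cf [x z].
apply: (@cvg_pair _ _ _ (nbhs (x, z)) (nbhs (f x)) (nbhs z)) => /=.
  by apply: (@cvg_comp _ _ _ fst f _ (nbhs x)); [exact: cvg_fst|exact: cf].
exact: cvg_snd.
Qed.

Lemma iso_homeo_circle (A : set H) :
  homeo_on ((theta @^-1` A) `*` @circle R) (A `*` @circle R)
    (fun xz : G * R[i] => (theta xz.1, xz.2)).
Proof.
exists (fun xz : H * R[i] => (iso_inv theta xz.1, xz.2)); split.
- by move=> [x z] [/= Ax cz]; rewrite iso_funK.
- by move=> [x z] [/= Ax cz]; rewrite iso_invK.
- by apply: continuous_subspaceT => ?; apply: pair_map_continuous; exact: iso_fun_continuous.
- by apply: continuous_subspaceT => ?; apply: pair_map_continuous; exact: iso_inv_continuous.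
Qed.

Variable F : twist R H.

Definition pullback_i (x : G) (z : R[i]) : F := tw_i F (theta x) z.
Definition pullback_pi (e : F) : G := iso_inv theta (tw_pi e).

Let hth : groupoid_hom theta := @iso_fun_hom _ _ theta.
Let uth x : units G x -> units H (theta x). Proof. exact: hom_units. Qed.

Lemma pullback_i_continuous : {within units G `*` @circle R,
  continuous (fun xz : G * R[i] => pullback_i xz.1 xz.2)}.
Proof.
apply: (@within_comp _ _ _ _ (units H `*` @circle R)
  (fun xz : G * R[i] => (theta xz.1, xz.2))
  (fun xz : H * R[i] => tw_i F xz.1 xz.2)).
- apply: continuous_subspaceT => ?; apply: pair_map_continuous.
  exact: iso_fun_continuous.
- by move=> [x z] [/= ux cz]; split => //; exact: uth.
- exact: tw_i_continuous.
Qed.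

Lemma pullback_i_hom x z w : units G x -> circle z -> circle w ->
  composable (pullback_i x z) (pullback_i x w) /\
  pullback_i x (z * w) = gmul (pullback_i x z) (pullback_i x w).
Proof. by move=> ux; exact: tw_i_hom (uth ux). Qed.

Lemma pullback_pi_continuous : continuous pullback_pi.
Proof.
move=> e; apply: cvg_comp; first exact: tw_pi_continuous.
exact: iso_inv_continuous.
Qed.

Lemma pullback_pi_hom : groupoid_hom pullback_pi.
Proof.
move=> a b /(@tw_pi_hom _ _ F)[c e]; have [c' e'] := iso_inv_hom c.
by split => //; rewrite /pullback_pi e.
Qed.

Lemma pullback_pi_i x : units G x -> pullback_pi (pullback_i x 1) = x.
Proof. by move=> ux; rewrite /pullback_pi tw_pi_i ?iso_funK//; exact: uth. Qed.

Lemma pullback_i_inj x y z w : units G x -> units G y -> circle z -> circle w ->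
  pullback_i x z = pullback_i y w -> x = y /\ z = w.
Proof.
move=> ux uy cz cw /(tw_i_inj (uth ux) (uth uy) cz cw)[+ ->].
by move=> /(can_inj (iso_funK theta)) ->.
Qed.

Lemma pullback_section (g : G) : exists (U : set G) (S : G -> F),
    [/\ open_bisection U, U g, {within U, continuous S},
        (forall h, U h -> pullback_pi (S h) = h)
      & homeo_on (U `*` @circle R) (pullback_pi @^-1` U)
          (fun hz : G * R[i] => gmul (pullback_i (rng hz.1) hz.2) (S hz.1))].
Proof.
have [U [S [[oU sU rU] Ug cS sS hS]]] := tw_section F (theta g).
exists (theta @^-1` U), (S \o theta); split => //.
- split.
  + by have /continuousP ct := @iso_fun_continuous _ _ theta; exact: ct.
  + move=> a b /set_mem Ua /set_mem Ub /(congr1 theta).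
    rewrite !(hom_src hth) => /sU; rewrite !inE => /(_ Ua Ub).
    exact: (can_inj (iso_funK theta)).
  + move=> a b /set_mem Ua /set_mem Ub /(congr1 theta).
    rewrite !(hom_rng hth) => /rU; rewrite !inE => /(_ Ua Ub).
    exact: (can_inj (iso_funK theta)).
- apply: (within_comp (B := U)) cS => //.
  by apply: continuous_subspaceT => ?; exact: iso_fun_continuous.
- by move=> h Uh; rewrite /pullback_pi /= sS// iso_funK.
- have := homeo_on_comp (iso_homeo_circle U) hS.
  rewrite (_ : pullback_pi @^-1` _ = @tw_pi _ _ F @^-1` U); last first.
    by apply/seteqP; split=> e; rewrite /pullback_pi /= iso_invK.
  rewrite (_ : (fun hz : G * R[i] => _) =
     (fun hz : H * R[i] => gmul (tw_i F (rng hz.1) hz.2) (S hz.1)) \o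
     (fun xz : G * R[i] => (theta xz.1, xz.2))) //.
  by apply/funext => -[h z] /=; rewrite /pullback_i (hom_rng hth).
Qed.

Lemma pullback_central (e : F) z : circle z ->
  gmul (pullback_i (pullback_pi (rng e)) z) e =
  gmul e (pullback_i (pullback_pi (src e)) z).
Proof. by move=> cz; rewrite /pullback_i /pullback_pi !iso_invK; exact: tw_central. Qed.

Lemma pullback_exact : pullback_pi @^-1` units G =
  [set pullback_i x z | x in units G & z in @circle R].
Proof.
have ei := tw_exact F; apply/seteqP; split.
- move=> e /= /uth; rewrite /pullback_pi iso_invK => ue.
  have : (@tw_pi _ _ F @^-1` units H) e by [].
  rewrite ei => -[x ux [z cz <-]].
  exists (iso_inv theta x); first exact: (hom_units iso_inv_hom ux).
  by exists z => //; rewrite /pullback_i iso_invK.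
- move=> e [x ux [z cz <-]] /=; apply: (hom_units iso_inv_hom).
  have : [set tw_i F x z | x in units H & z in @circle R] (pullback_i x z).
    by exists (theta x); [exact: uth|exists z].
  by rewrite -ei.
Qed.

(* [F] viewed as a twist over [G] through [theta]. *)
Definition pullback_twist : twist R G :=
  @Twist R G F (@tw_locally_compact _ _ F) (@tw_hausdorff _ _ F)
    pullback_i pullback_pi pullback_i_continuous pullback_i_hom
    (homeo_on_comp iso_homeo_units (tw_i_units F))
    pullback_pi_continuous pullback_pi_hom
    (homeo_on_comp (tw_pi_units F) iso_inv_homeo_units)
    pullback_pi_i pullback_i_inj pullback_section pullback_central
    pullback_exact.

End PullbackTwist.

Definition properly_isomorphic (R : realType) (G : topGroupoid)
    (E E' : twist R G) : Prop :=
  exists phi : groupoid_iso E E',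
    (forall x z, units G x -> circle z -> phi (tw_i E x z) = tw_i E' x z) /\
    (forall e : E, tw_pi (phi e) = tw_pi e).

(* The class [E] in Tw(G), as a predicate on twists over G. *)
Definition twist_class (R : realType) (G : topGroupoid) (E : twist R G) :
  twist R G -> Prop := properly_isomorphic E.

Section Haar.
Variable R : realType.

Definition borelC := g_sigma_algebraType (@open R[i]).

Definition expi2pi (t : R) : R[i] := cos (2 * pi * t) +i* sin (2 * pi * t).

Lemma expi2pi_continuous : continuous expi2pi.
Proof.
have cC : continuous (fun x : R => x%:C : R[i]).
  move=> x; apply/cvgrPdist_lt => e e0.
  have er : e = (complex.Re e)%:C by rewrite RRe_real// gtr0_real.
  have re0 : 0 < complex.Re e by move: e0; rewrite {1}er ltcR.
  near=> y; rewrite -raddfB /= normc_def /= expr0n addr0 sqrtr_sqr er ltcR.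
  by near: y; apply: (@cvgr_dist_lt _ _ _ (nbhs x)) => //; exact: cvg_id.
have -> : expi2pi = (fun t => (cos (2 * pi * t))%:C + 'i * (sin (2 * pi * t))%:C).
  by apply/funext => t; rewrite /expi2pi; simpc.
have c2 : continuous (fun t : R => 2 * pi * t).
  by move=> t; apply: cvgM; [exact: cvg_cst|exact: cvg_id].
move=> t; apply: cvgD; last apply: cvgM; try exact: cvg_cst.
- apply: (@cvg_comp _ _ _ (fun t => cos (2 * pi * t)) (fun x : R => x%:C)) (cC _).
  by apply: cvg_comp (c2 t) _; exact: continuous_cos.
- apply: (@cvg_comp _ _ _ (fun t => sin (2 * pi * t)) (fun x : R => x%:C)) (cC _).
  by apply: cvg_comp (c2 t) _; exact: continuous_sin.
Unshelve. all: by end_near. Qed.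

Lemma measurable_expi2pi : measurable_fun [set: R] (expi2pi : R -> borelC).
Proof.
apply: (@measurability _ _ _ borelC setT expi2pi (@open R[i]) erefl) => // _ [W oW <-].
rewrite setTI; apply: measurable_realfun.open_measurable.
by have /continuousP := expi2pi_continuous; exact.
Qed.

(* Normalized Haar measure of the circle, as a Borel measure on the complex
   plane: the law of [exp(2 i pi t)] for [t] uniform on [0,1]. *)
Definition haar : set borelC -> \bar R :=
  pushforward (mrestr lebesgue_measure (measurable_itv `[0%R, 1%R]))
    (expi2pi : R -> borelC).

Let haar0 : haar set0 = 0%E.
Proof. by rewrite /haar /pushforward preimage_set0 measure0. Qed.

Let haar_ge0 (A : set borelC) : (0 <= haar A)%E.
Proof. by rewrite /haar /pushforward; exact: measure_ge0. Qed.

Let haar_sigma_additive : semi_sigma_additive haar.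
Proof.
have mp (A : set borelC) : measurable A ->
    measurable ((expi2pi : R -> borelC) @^-1` A).
  by move=> mA; rewrite -[X in measurable X]setTI; exact: measurable_expi2pi.
move=> F mF tF mUF; rewrite /haar /pushforward preimage_bigcup.
apply: measure_semi_sigma_additive.
- by move=> n; exact: mp.
- apply/trivIsetP => /= i j _ _ ij; rewrite -preimage_setI.
  by move/trivIsetP : tF => /(_ _ _ _ _ ij) ->//; rewrite preimage_set0.
- by rewrite -preimage_bigcup; exact: mp.
Qed.

HB.instance Definition _ :=
  isMeasure.Build _ _ _ haar haar0 haar_ge0 haar_sigma_additive.

End Haar.

(* Measurable types are pointed: [borel t0] is the Borel space of [T], with
   [t0] as the (irrelevant) distinguished point. *)
Definition pointed_at (T : topologicalType) (t0 : T) : Type := T.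
HB.instance Definition _ (T : topologicalType) (t0 : T) :=
  Choice.copy (pointed_at t0) T.
HB.instance Definition _ (T : topologicalType) (t0 : T) :=
  isPointed.Build (pointed_at t0) t0.
Definition borel (T : topologicalType) (t0 : T) :=
  @g_sigma_algebraType (pointed_at t0) (@open T).

Lemma exchange_esum (R : realType) (T U : choiceType) (I : set T) (J : set U)
    (a : T -> U -> \bar R) : (forall i j, (0 <= a i j)%E) ->
  (\esum_(i in I) \esum_(j in J) a i j =
   \esum_(j in J) \esum_(i in I) a i j)%E.
Proof.
move=> a0.
rewrite (@esum_esum _ _ _ I (fun=> J))// (@esum_esum _ _ _ J (fun=> I) (fun j i => a i j))//.
rewrite (@reindex_esum _ _ _ (J `*`` (fun=> I)) (I `*`` (fun=> J))
  (fun k => (k.2, k.1)))//.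
split.
- by move=> [j i] [].
- by move=> [j i] [j' i'] _ _ [-> ->].
- by move=> [i j] [/= Ii Jj]; exists (j, i).
Qed.

Section Fibres.
Variables (R : realType) (G : topGroupoid) (E : twist R G).

Lemma tw_pi_surj (g : G) : exists e : E, tw_pi e = g.
Proof. by have [U [S [_ Ug _ sS _]]] := tw_section E g; exists (S g); exact: sS. Qed.

Definition tw_lift (g : G) : E := sval (cid (tw_pi_surj g)).

(* [E_x], the arrows of [E] with source [x], for [x] in [G^(0)] *)
Definition src_fibre (x : G) : set E := [set e : E | tw_pi (src e) = x].

Definition fibre_space (x : G) := borel (tw_i E x 1).

(* The fibre of [E] over [g] is the set of the [z . tw_lift g], [z] in [T]. *)
Definition nu (x : G) : set (fibre_space x) -> \bar R := fun A =>
  (\esum_(g in [set g : G | src g = x])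
    haar (@circle R `&` [set z : R[i] | A (tw_act z (tw_lift g))]))%E.

Lemma tw_i_pi (u : E) : units E u -> tw_i E (tw_pi u) 1 = u.
Proof.
move=> uu; have [h [h1 h2 _ _]] := tw_pi_units E.
have [k [k1 _ _ _]] := tw_i_units E.
have [upi hu] := h1 _ uu; have [ui _] := k1 _ upi.
by rewrite -[LHS](h1 _ ui).2 tw_pi_i.
Qed.

Lemma circle1 : @circle R 1. Proof. by rewrite /circle /= normr1. Qed.

Lemma src_tw_i (x : G) (z : R[i]) : units G x -> circle z ->
  src (tw_i E x z) = tw_i E x 1.
Proof.
move=> ux cz; have [-> _] := tw_i_hom E ux cz circle1.
have [k [k1 _ _ _]] := tw_i_units E.
by have [/unitsP[-> _] _] := k1 _ ux.
Qed.

Lemma tw_act_continuous (e : E) :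
  {within @circle R, continuous (fun z => tw_act z e)}.
Proof.
have ur : units G (tw_pi (rng e)).
  by rewrite (hom_rng (@tw_pi_hom _ _ E)); exact: units_rng.
apply: (@within_comp _ _ _ _
   [set ab : E * E | composable ab.1 ab.2]
   (fun z => (tw_i E (tw_pi (rng e)) z, e)) (fun ab : E * E => gmul ab.1 ab.2)).
- have ci : {within @circle R, continuous (fun z => tw_i E (tw_pi (rng e)) z)}.
    apply: (@within_comp _ _ _ _ (units G `*` @circle R)
      (fun z => (tw_pi (rng e), z)) (fun xz : G * R[i] => tw_i E xz.1 xz.2)).
    + apply: continuous_subspaceT => z.
      apply: (@cvg_pair _ _ _ (nbhs z) (nbhs (tw_pi (rng e))) (nbhs z)).
        exact: cvg_cst.
      exact: cvg_id.
    + by move=> z cz.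
    + exact: tw_i_continuous.
  move/subspace_continuousP : ci => ci; apply/subspace_continuousP => z cz.
  apply: (@cvg_pair _ _ _ (within (@circle R) (nbhs z))
    (nbhs (tw_i E (tw_pi (rng e)) z)) (nbhs e)); first exact: ci.
  exact: cvg_cst.
- move=> z cz; rewrite /composable /= src_tw_i// tw_i_pi//.
  exact: units_rng.
- exact: gmul_continuous.
Qed.

Lemma circle_closed : closed (@circle R).
Proof.
rewrite (_ : @circle R = (fun z : R[i] => `|z|) @^-1` [set 1]) //.
apply: closed_comp; first by move=> z _; exact: norm_continuous.
apply: accessible_closed_set1; apply: hausdorff_accessible.
exact: norm_hausdorff.
Qed.

Lemma measurable_circle : measurable (@circle R : set (borelC R)).
Proof.
rewrite -[X in measurable X]setCK; apply: measurableC.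
by apply: sub_sigma_algebra; exact: closed_openC circle_closed.
Qed.

Lemma measurable_tw_act (x : G) (e : E) : measurable_fun
  (@circle R : set (borelC R)) (fun z => tw_act z e : fibre_space x).
Proof.
apply: (@measurability _ _ (borelC R) (fibre_space x) (@circle R)
  (fun z => tw_act z e) (@open E) erefl) => // _ [W oW <-].
have /continuousP/(_ _ oW)/open_subspaceP[V oV VW] := tw_act_continuous (e := e).
rewrite setIC -VW; apply: measurableI; last exact: measurable_circle.
exact: sub_sigma_algebra.
Qed.

Let nu0 x : @nu x set0 = 0%E.
Proof.
rewrite /nu; apply: esum1 => g _.
by rewrite (_ : _ `&` _ = set0) ?measure0// -subset0 => z [].
Qed.

Let nu_ge0 x A : (0 <= @nu x A)%E.
Proof. by apply: esum_ge0 => g _; exact: measure_ge0. Qed.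

Let nu_sigma_additive x : semi_sigma_additive (@nu x).
Proof.
move=> A mA tA mUA.
pose B g n := @circle R `&` [set z : R[i] | A n (tw_act z (tw_lift g))].
have mB g n : measurable (B g n : set (borelC R)).
  by rewrite /B; exact: (measurable_tw_act _ measurable_circle).
have tB g : trivIset setT (B g).
  apply/trivIsetP => i j _ _ ij; rewrite -subset0 => z [[_ Ai] [_ Aj]].
  by move/trivIsetP : tA => /(_ _ _ Logic.I Logic.I ij); rewrite -subset0; apply; split; [exact: Ai|exact: Aj].
have UB g : @circle R `&`
    [set z : R[i] | (\bigcup_n A n) (tw_act z (tw_lift g))] = \bigcup_n B g n.
  apply/seteqP; split => z; first by move=> [cz [n _ An]]; exists n.
  by move=> [n _ [cz An]]; split => //; exists n.
have nuE : nu (\bigcup_n A n) = (\sum_(n <oo) nu (A n))%E.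
  rewrite nneseries_esumT// /nu exchange_esum//.
  apply: eq_esum => g _; rewrite UB measure_semi_bigcup ?nneseries_esumT//.
  by rewrite -UB; exact: (measurable_tw_act _ measurable_circle).
by rewrite nuE; apply: is_cvg_nneseries => n _ _.
Qed.

HB.instance Definition _ (x : G) :=
  isMeasure.Build _ _ _ (@nu x) (@nu0 x) (@nu_ge0 x) (@nu_sigma_additive x).

End Fibres.
Arguments src_fibre {R G} E x _.
Arguments fibre_space {R G} E x.
Arguments nu {R G} E x _.

Definition cintegral d (T : measurableType d) (R : realType)
    (mu : {measure set T -> \bar R}) (D : set T) (h : T -> R[i]) : R[i] :=
  Rintegral mu D (fun t => complex.Re (h t)) +i*
  Rintegral mu D (fun t => complex.Im (h t)).

Section ReducedNorm.
Variables (R : realType) (p : R) (G : topGroupoid) (E : twist R G).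
Implicit Types f g xi : E -> R[i].

Definition equivariant f : Prop :=
  forall z (e : E), circle z -> f (tw_act z e) = z * f e.

Definition Sigma_c : set (E -> R[i]) := [set f |
  [/\ continuous f, compact (closure [set e | f e != 0]) & equivariant f]].

Definition conv f g : E -> R[i] := fun e =>
  let x := tw_pi (src e) in
  cintegral (nu E x) (src_fibre E x) (fun c => f (gmul e (ginv c)) * g c).

Definition Lp_norm (x : G) xi : \bar R :=
  Lnorm (nu E x) p%:E (fun e : fibre_space E x => (Normc.normc (xi e))%:E).

(* Functions on [E_x] are represented by their extension by zero to [E].
   An equivariant function that vanishes almost everywhere on [E_x] vanishes on
   [E_x], so no quotient is needed. *)
Definition Lp (x : G) : set (E -> R[i]) := [set xi |
  [/\ forall e, ~ src_fibre E x e -> xi e = 0, equivariant xi,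
      measurable_fun setT (fun e : fibre_space E x => complex.Re (xi e)),
      measurable_fun setT (fun e : fibre_space E x => complex.Im (xi e))
    & (Lp_norm x xi < +oo)%E]].

Definition lambda (x : G) f xi : E -> R[i] := fun e =>
  if e \in src_fibre E x then
    cintegral (nu E x) (src_fibre E x) (fun c => f (gmul e (ginv c)) * xi c)
  else 0.

Definition lambda_norm (x : G) f : \bar R :=
  ereal_sup [set Lp_norm x (lambda x f xi) |
    xi in Lp x `&` [set xi | (Lp_norm x xi <= 1)%E]].

(* The supremum is taken in [0, +oo]: it is [0] if [G] is empty. *)
Definition reduced_norm f : \bar R :=
  maxe 0%E (ereal_sup [set lambda_norm x f | x in units G]).

End ReducedNorm.

(* The completion of a normed algebra, given as a subset [S] of a vector space
   [V] with product [mul] and norm [N]: Cauchy sequences in [S] up to null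
   sequences, with termwise operations. *)
Section Completion.
Variables (R : realType) (V : lmodType R[i]).
Variables (S : set V) (mul : V -> V -> V) (N : V -> \bar R).
Local Open Scope ereal_scope.

Definition cauchy_in (u : nat -> V) : Prop :=
  (forall n, S (u n)) /\
  forall eps : R, (0 < eps)%R -> exists n0, forall m n,
    (n0 <= m)%N -> (n0 <= n)%N -> N (u m - u n)%R < eps%:E.

Definition cauchy_class (u : nat -> V) : set (nat -> V) :=
  [set v | cauchy_in v /\ N (u n - v n)%R @[n --> \oo] --> 0].

Record completion := Completion {
  completion_set : set (nat -> V);
  completionP : exists2 u, cauchy_in u & completion_set = cauchy_class u }.

Definition repr (a : completion) : nat -> V := s2val (cid2 (completionP a)).

(* The class of a Cauchy sequence [u]; the default [a] is never used below,
   since sums, multiples and products of Cauchy sequences are Cauchy. *)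
Definition class_of (a : completion) (u : nat -> V) : completion :=
  if pselect (cauchy_in u) is left cu
  then Completion (ex_intro2 _ _ u cu erefl) else a.

Definition cadd (a b : completion) : completion :=
  class_of a (fun n => repr a n + repr b n)%R.
Definition cscale (k : R[i]) (a : completion) : completion :=
  class_of a (fun n => k *: repr a n)%R.
Definition cmul (a b : completion) : completion :=
  class_of a (fun n => mul (repr a n) (repr b n)).
Definition cnorm (a : completion) : \bar R := lim (N (repr a n) @[n --> \oo]).

End Completion.

Section ReducedAlgebra.
Variables (R : realType) (p : R) (G : topGroupoid) (E : twist R G).

Definition Fplambda : Type :=
  completion (Sigma_c (E := E)) (reduced_norm p (E := E)).
Definition Fadd : Fplambda -> Fplambda -> Fplambda := @cadd _ _ _ _.
Definition Fscale : R[i] -> Fplambda -> Fplambda := @cscale _ _ _ _.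
Definition Fmul : Fplambda -> Fplambda -> Fplambda :=
  @cmul _ _ _ (@conv R G E) _.
Definition Fnorm : Fplambda -> \bar R := @cnorm _ _ _ _.

End ReducedAlgebra.

Definition isometric_isomorphism (R : realType) (p : R) (G H : topGroupoid)
    (E : twist R G) (F : twist R H) (Phi : Fplambda p E -> Fplambda p F) :
    Prop :=
  bijective Phi /\
  [/\ forall a b, Phi (Fadd a b) = Fadd (Phi a) (Phi b),
      forall k a, Phi (Fscale k a) = Fscale k (Phi a),
      forall a b, Phi (Fmul a b) = Fmul (Phi a) (Phi b)
    & forall a, Fnorm (Phi a) = Fnorm a].

(* Main.v *)
Require Import Defs.
From HB Require Import structures.
From mathcomp Require Import all_boot all_order all_algebra.
From mathcomp Require Import all_classical all_reals all_analysis.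
From mathcomp Require Import complex.
From mathcomp Require Import ring lra.
From mathcomp Require Import measurable_realfun.
(* once more, so that [conv] denotes the convolution product *)
Require Import Defs.
Import Order.TTheory GRing.Theory Num.Theory.
Import numFieldNormedType.Exports.
Local Open Scope classical_set_scope.
Local Open Scope ring_scope.
Set Implicit Arguments.
Unset Strict Implicit.
Unset Printing Implicit Defensive.

(** The algebra [Fplambda p E] remembers the twist because, for [p] different from
    [2], isometries of [l^p] are rigid.

    An element [a] of the completion is determined by the equivariant function
    [jmap a] on [E] (Renault's map, [j_inj]), the pointwise limit of its
    approximants.  The value of a product at an arrow is a single term when one
    factor meets the relevant row or column in a single class ([j_mul_col],
    [j_mul_row]), and products of this kind suffice.  If the support of [jmap a] lies over a set on
    which range and source are injective ([bisupported]), then [a] acts as a weighted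
    partial permutation, and its norm is the supremum of [jmap a]
    ([bisupported_norm]).  All integrals over source fibres reduce to sums over
    classes of the circle action, and elements of [Sigma_c] are finite sums of
    functions supported over bisections ([fragmentation]).

    Suppose that an isometric isomorphism [Phi] is given.  The defect of the
    parallelogram law in exponent [p] has a constant sign and vanishes only if one
    of the two numbers is zero ([defect_sign]); hence an invertible isometry of the
    algebra has at most one nonzero entry in each row ([isometry_row]), and one
    close to the unit is supported over the units ([isometry_diagonal]).  A real
    function on the unit space is a combination of two diagonal isometries close to
    the unit, so [Phi] maps the diagonal onto the diagonal ([diagonal_iso]), and by
    compactness it induces a bijection of the unit spaces ([character_point]).

    Multiplying a bisupported element by cut-off functions on both sides localises
    it near a pair of units: [Phi a] can be nonzero at [e'] only if [a] is at least
    as large at some [e] between the corresponding units ([transfer]).  Topological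
    principality then shows that [Phi] preserves bisupported elements
    ([bisupported_iso]).  Consequently each [e] has exactly one arrow [e'] such that
    [Phi a] takes at [e'] the value of [a] at [e], for all bisupported [a]
    ([matched_ex], [matched_inj_r]); bump functions show that [e |-> e'] is an
    equivariant isomorphism of topological groupoids, and it descends to [G] and [H]
    ([equivariant_iso_ex], [base_isomorphism]).

    Conversely, composition with an isomorphism of twists preserves [Sigma_c], the
    products and the reduced norms, and so it extends to the completions
    ([transport_isometric]). *)

(** * Complex numbers *)

Notation nc := Normc.normc.

Section ComplexFacts.
Variable R : realType.
Implicit Types (z w : R[i]) (x y e : R).

Lemma normCE z : `|z| = (nc z)%:C%C.
Proof. by case: z. Qed.

Lemma nc_ge0 z : 0 <= nc z.
Proof. by case: z => a b; exact: sqrtr_ge0. Qed.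

Lemma ncM z w : nc (z * w) = nc z * nc w.
Proof. exact: Normc.normcM. Qed.

Lemma ncN z : nc (- z) = nc z.
Proof. by have /(congr1 (@complex.Re R)) := normrN z; rewrite !normCE. Qed.

Lemma nc0 : nc 0 = 0 :> R.
Proof. exact: (Normc.normc0 R). Qed.

Lemma nc1 : nc 1 = 1 :> R.
Proof. exact: (Normc.normc1 R). Qed.

Lemma ncD z w : nc (z + w) <= nc z + nc w.
Proof. by rewrite -lecR rmorphD/= -!normCE ler_normD. Qed.

Lemma ncB z w : nc (z - w) <= nc z + nc w.
Proof. by rewrite -(ncN w) ncD. Qed.

Lemma nc_distC z w : nc (z - w) = nc (w - z).
Proof. by rewrite -ncN opprB. Qed.

Lemma nc_dist z w : `|nc z - nc w| <= nc (z - w).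
Proof.
have h1 := ncD (z - w) w; have h2 := ncD (w - z) z.
rewrite !subrK in h1 h2; rewrite (nc_distC w) in h2.
by rewrite ler_norml; apply/andP; split; lra.
Qed.

Lemma nc_eq0 z : (nc z == 0) = (z == 0).
Proof.
apply/eqP/eqP => [|->]; last exact: nc0.
exact: Normc.eq0_normc.
Qed.

Lemma nc_gt0 z : (0 < nc z) = (z != 0).
Proof. by rewrite lt_neqAle nc_ge0 andbT eq_sym nc_eq0. Qed.

Lemma ncV z : nc z^-1 = (nc z)^-1.
Proof. exact: Normc.normcV. Qed.

Lemma nc_real x : nc (x%:C%C) = `|x|.
Proof. by rewrite /Normc.normc /= expr0n /= addr0 sqrtr_sqr. Qed.

Lemma nc_small_eq0 z : (forall e, 0 < e -> nc z < e) -> z = 0.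
Proof.
move=> h; apply/eqP; rewrite -nc_eq0; apply: contraT => n0.
have p : 0 < nc z by rewrite lt_neqAle eq_sym n0 nc_ge0.
by have := h _ p; rewrite ltxx.
Qed.

Lemma Re_le_nc z : `|complex.Re z| <= nc z.
Proof. by rewrite -lecR -normCE; exact: normc_ge_Re. Qed.

Lemma Im_le_nc z : `|complex.Im z| <= nc z.
Proof.
case: z => a b /=; rewrite -sqrtr_sqr ler_wsqrtr//.
by rewrite lerDr sqr_ge0.
Qed.

Lemma nc_le_ReIm z : nc z <= `|complex.Re z| + `|complex.Im z|.
Proof.
case: z => a b /=; rewrite -[X in _ <= X]ger0_norm ?addr_ge0//.
rewrite -sqrtr_sqr ler_wsqrtr// sqrrD !real_normK ?num_real//.
by rewrite -addrA lerD2l lerDr mulrn_wge0// mulr_ge0.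
Qed.

Lemma circle_nc z : circle z <-> nc z = 1.
Proof.
rewrite /circle /= normCE; split => [[->]//|->//].
Qed.

Lemma nc_circleM z w : circle z -> nc (z * w) = nc w.
Proof. by move=> /circle_nc cz; rewrite ncM cz mul1r. Qed.

Lemma nc_eqcircle z w : nc z = nc w -> z != 0 -> exists2 u, circle u & w = u * z.
Proof.
move=> h z0; exists (w / z); last by rewrite divfK.
by apply/circle_nc; rewrite ncM ncV -h divff// nc_eq0.
Qed.

Lemma cvgC_dist (T : Type) (F : set_system T) {FF : Filter F} (f : T -> R[i]) (l : R[i]) :
  f @ F --> l <-> forall e, 0 < e -> \forall t \near F, nc (l - f t) < e.
Proof.
split=> [/cvgrPdist_lt h e e0|h].
  have /h : (0 : R[i]) < e%:C%C by rewrite ltcR.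
  by apply: filterS => t; rewrite normCE ltcR.
apply/cvgrPdist_lt => e e0.
have er : e = (complex.Re e)%:C%C by rewrite RRe_real// gtr0_real.
have re0 : 0 < complex.Re e by move: e0; rewrite {1}er ltcR.
by apply: filterS (h _ re0) => t; rewrite normCE {2}er ltcR.
Qed.

Lemma continuousR_near (T : topologicalType) (f : T -> R) :
  (forall t e, 0 < e -> \forall s \near t, `|f t - f s| < e) -> continuous f.
Proof. by move=> h t; apply/cvgrPdist_lt => e; exact: h. Qed.

Lemma continuousC_near (T : topologicalType) (f : T -> R[i]) :
  continuous f <-> forall t e, 0 < e -> \forall s \near t, nc (f t - f s) < e.
Proof.
split=> [h t e e0|h t]; last by apply/cvgC_dist => e; exact: h.
by have /cvgC_dist := h t; exact.
Qed.

Lemma near_sub (T : topologicalType) (t : T) (P Q : T -> Prop) :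
  (forall s, P s -> Q s) -> (\forall s \near t, P s) -> \forall s \near t, Q s.
Proof. by move=> h; apply: filterS. Qed.

Lemma near_nc z e : 0 < e -> \forall w \near z, nc (z - w) < e.
Proof.
by apply: (continuousC_near (fun w : R[i] => w)).1 => w; exact: cvg_id.
Qed.

Lemma nc_continuous : continuous (fun z : R[i] => nc z).
Proof.
apply: continuousR_near => z e /(near_nc z); apply: near_sub => w.
by apply: le_lt_trans; exact: nc_dist.
Qed.

Lemma realC_continuous : continuous (fun x : R => x%:C%C : R[i]).
Proof.
apply/continuousC_near => x e e0.
have /cvgrPdist_lt/(_ e e0) : (fun w : R => w) @ x --> x by exact: cvg_id.
by apply: near_sub => w; rewrite -nc_real rmorphB.
Qed.

Lemma Re_continuous : continuous (fun z : R[i] => complex.Re z).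
Proof.
apply: continuousR_near => z e /(near_nc z); apply: near_sub => w.
by apply: le_lt_trans; rewrite -raddfB; exact: Re_le_nc.
Qed.

Lemma Im_continuous : continuous (fun z : R[i] => complex.Im z).
Proof.
apply: continuousR_near => z e /(near_nc z); apply: near_sub => w.
by apply: le_lt_trans; rewrite -raddfB; exact: Im_le_nc.
Qed.

End ComplexFacts.

(** * Arrows of a topological groupoid *)

Lemma eq_closed (X Y : topologicalType) (f g : X -> Y) : hausdorff_space Y ->
  continuous f -> continuous g -> closed [set x | f x = g x].
Proof.
rewrite open_hausdorff => hY cf cg x clx; apply: contrapT => /eqP/hY[[A B] /=].
move=> [xA xB] [oA oB AB0].
have nA : nbhs x (f @^-1` A) by apply: cf; apply: open_nbhs_nbhs; split => //; exact: set_mem.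
have nB : nbhs x (g @^-1` B) by apply: cg; apply: open_nbhs_nbhs; split => //; exact: set_mem.
have [y [/= fgy [Ay By]]] := clx _ (filterI nA nB).
by have : (A `&` B) (f y); [split => //; rewrite fgy|rewrite (eqP AB0)].
Qed.

Section GroupoidAlgebra.
Variable K : topGroupoid.
Implicit Types a b c u : K.

Lemma src_mul a b : composable a b -> src (gmul a b) = src b.
Proof. exact: gmul_src. Qed.

Lemma rng_mul a b : composable a b -> rng (gmul a b) = rng a.
Proof. exact: gmul_rng. Qed.

Lemma gpdA a b c : composable a b -> composable b c ->
  gmul (gmul a b) c = gmul a (gmul b c).
Proof. exact: gmulA. Qed.

Lemma gpdKl a b : composable a b -> gmul (ginv a) (gmul a b) = b.
Proof. exact: gmulKl. Qed.

Lemma gpdKr a b : composable a b -> gmul (gmul a b) (ginv b) = a.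
Proof. exact: gmulKr. Qed.

Lemma composable_div a b : src a = src b -> composable a (ginv b).
Proof. by rewrite /composable rngV. Qed.

Lemma rng_div a b : src a = src b -> rng (gmul a (ginv b)) = rng a.
Proof. by move=> h; rewrite rng_mul//; exact: composable_div. Qed.

Lemma src_div a b : src a = src b -> src (gmul a (ginv b)) = rng b.
Proof. by move=> h; rewrite src_mul ?srcV//; exact: composable_div. Qed.

Lemma gpd_divK a b : src a = src b -> gmul (gmul a (ginv b)) b = a.
Proof. by move=> h; rewrite -[X in gmul _ X]ginvK gpdKr//; exact: composable_div. Qed.

Lemma gpdVKl a b : rng a = rng b -> gmul a (gmul (ginv a) b) = b.
Proof. by move=> h; rewrite -{1}[a]ginvK gpdKl// /composable srcV. Qed.

Lemma gpdIr a b c : src a = rng c -> src b = rng c -> gmul a c = gmul b c -> a = b.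
Proof. by move=> h h' e; rewrite -(gpdKr h) e gpdKr. Qed.

Lemma gpd_invM a b : composable a b -> ginv (gmul a b) = gmul (ginv b) (ginv a).
Proof.
move=> h; apply: (@gpdIr _ _ (gmul a b)).
- by rewrite srcV.
- by rewrite src_mul ?srcV ?rng_mul// /composable srcV rngV h.
- transitivity (src (gmul a b)) => //.
  rewrite gpdA ?gpdKl ?src_mul//; rewrite /composable ?srcV ?rngV ?rng_mul//.
Qed.

Lemma gpd_invD a b : src a = src b -> ginv (gmul a (ginv b)) = gmul b (ginv a).
Proof. by move=> h; rewrite gpd_invM ?ginvK//; exact: composable_div. Qed.

Lemma inv_unit u : units K u -> ginv u = u.
Proof.
move=> /unitsP[ru su]; transitivity (gmul (rng u) (ginv u)); last first.
  by rewrite ru.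
by rewrite ru -{2}su -rngV gmull_rng.
Qed.

Lemma div_div a b c : src a = src c -> src b = src c ->
  gmul (gmul a (ginv c)) (ginv (gmul b (ginv c))) = gmul a (ginv b).
Proof.
move=> ac bc; rewrite gpd_invD// gpdA ?gpdKl//; last first.
- by rewrite /composable rng_div// srcV.
- exact: composable_div.
- by rewrite /composable rngV.
Qed.

Lemma div_mul a b c : src a = src c -> composable b c ->
  gmul (gmul a (ginv c)) (ginv b) = gmul a (ginv (gmul b c)).
Proof.
move=> ac bc; rewrite gpd_invM// gpdA//; first exact: composable_div.
by rewrite /composable srcV rngV.
Qed.

Lemma src_continuous : continuous (@src K).
Proof.
move=> a.
apply: (@cvg_comp _ _ _ (fun a => (ginv a, a)) (fun ab : K * K => gmul ab.1 ab.2)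
  _ (within [set ab : K * K | composable ab.1 ab.2] (nbhs (ginv a, a)))).
  move=> W /= [[A B] /= [nA nB] ABW].
  near=> b; apply: (ABW (ginv b, b)); last exact: composableVl.
  split => /=; last by near: b.
  by near: b; exact: (ginv_continuous nA).
have := @gmul_continuous K => /subspace_continuousP/(_ (ginv a, a)); apply.
exact: composableVl.
Unshelve. all: by end_near. Qed.

Lemma rng_continuous : continuous (@rng K).
Proof.
move=> a; have -> : @rng K = @src K \o @ginv K.
  by apply/funext => b /=; rewrite srcV.
by apply: continuous_comp; [exact: ginv_continuous|exact: src_continuous].
Qed.

Lemma div_near a b (W : set K) : src a = src b -> nbhs (gmul a (ginv b)) W ->
  exists A B : set K, [/\ nbhs a A, nbhs b B & forall a' b', A a' -> B b' ->
    src a' = src b' -> W (gmul a' (ginv b'))].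
Proof.
move=> ab nW; have := @gmul_continuous K.
move=> /subspace_continuousP/(_ (a, ginv b) (composable_div ab) _ nW).
rewrite /= => -[[A B] /= [nA nB] ABW].
exists A, (@ginv K @^-1` B); split => //.
  by apply: ginv_continuous; rewrite /= in nB *.
move=> a' b' Aa Bb s; apply: (ABW (a', ginv b')) => //.
exact: composable_div.
Qed.

Lemma composable_closed : hausdorff_space K ->
  closed [set ab : K * K | composable ab.1 ab.2].
Proof.
move=> hK; apply: (@eq_closed _ _ (fun ab : K * K => src ab.1)
  (fun ab : K * K => rng ab.2)) => // -[a b].
  by apply: (@cvg_comp _ _ _ fst (@src K)); [exact: cvg_fst|exact: src_continuous].
by apply: (@cvg_comp _ _ _ snd (@rng K)); [exact: cvg_snd|exact: rng_continuous].
Qed.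

End GroupoidAlgebra.

Section EtaleTopology.
Variable G : topGroupoid.
Hypothesis Get : etale G.

(** An arrow [y] near a unit lies in a set on which the range map is injective,
    together with [rng y]; both have range [rng y], so [y = rng y]. *)
Lemma units_open : open (units G).
Proof.
rewrite openE => x ux; have [ru _] := unitsP ux.
have [U [V [oU Ux _ _ [k [k1 _ _ _]]]]] := Get x.
have nU : nbhs x U by apply: open_nbhs_nbhs.
have nrU : nbhs x (@rng G @^-1` U).
  by apply: rng_continuous; rewrite ru.
apply: filterS (filterI nU nrU) => y [/k1[_ ky] /= /k1[_]].
by rewrite rng_rng ky => ->; exact: units_rng.
Qed.

Lemma rng_open (O : set G) : open O -> open (@rng G @` O).
Proof.
move=> oO; rewrite openE => _ [g Og <-].
have [U [V [oU Ug oV BE [k [k1 k2 _ ck]]]]] := Get g.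
have oB : open (@rng G @` U) by rewrite BE; apply: openI => //; exact: units_open.
have By : (@rng G @` U) (rng g) by exists g.
have nB : nbhs (rng g) (@rng G @` U) by apply: open_nbhs_nbhs.
have : nbhs (k (rng g)) O.
  by rewrite (k1 _ Ug).2; apply: open_nbhs_nbhs.
move=> /((subspace_continuousP _ _).1 ck _ By) /= nk.
rewrite /within /= in nk.
by apply: filterS (filterI nB nk) => y [By' /(_ By') Oky]; exists (k y) => //; exact: (k2 _ By').2.
Qed.

Lemma src_open (O : set G) : open O -> open (@src G @` O).
Proof.
move=> oO; have -> : @src G @` O = @rng G @` (@ginv G @^-1` O).
  apply/seteqP; split => [_ [g Og <-]|_ [g Og <-]].
    by exists (ginv g); rewrite ?rngV//= ginvK.
  by exists (ginv g) => //; rewrite srcV.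
by apply: rng_open; apply: open_comp => // g _; exact: ginv_continuous.
Qed.

End EtaleTopology.

(** * Arrows of a twist *)

Section CircleAlgebra.
Variable R : realType.
Implicit Types z w : R[i].

Lemma circleM z w : circle z -> circle w -> circle (z * w).
Proof. by rewrite /circle /= normrM => -> ->; rewrite mulr1. Qed.

Lemma circleV z : circle z -> circle z^-1.
Proof. by rewrite /circle /= normfV => ->; rewrite invr1. Qed.

Lemma circle_neq0 z : circle z -> z != 0.
Proof. by rewrite /circle /= -normr_gt0 => ->; exact: ltr01. Qed.

End CircleAlgebra.

Section TwistAlgebra.
Variables (R : realType) (G : topGroupoid) (E : twist R G).
Implicit Types (e a b c : E) (z w : R[i]) (x : G).

Lemma pi_rng e : tw_pi (rng e) = rng (tw_pi e).
Proof. exact: (hom_rng (@tw_pi_hom _ _ E)). Qed.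

Lemma pi_src e : tw_pi (src e) = src (tw_pi e).
Proof. exact: (hom_src (@tw_pi_hom _ _ E)). Qed.

Lemma pi_mul a b : composable a b -> tw_pi (gmul a b) = gmul (tw_pi a) (tw_pi b).
Proof. by move=> /(@tw_pi_hom _ _ E)[]. Qed.

Lemma pi_inv e : tw_pi (ginv e) = ginv (tw_pi e).
Proof. exact: (homV (@tw_pi_hom _ _ E)). Qed.

Lemma units_pi_rng e : units G (tw_pi (rng e)).
Proof. by rewrite pi_rng; exact: units_rng. Qed.

Lemma units_pi_src e : units G (tw_pi (src e)).
Proof. by rewrite pi_src; exact: units_src. Qed.

Lemma units_tw_i x : units G x -> units E (tw_i E x 1).
Proof. by have [k [k1 _ _ _]] := tw_i_units E; move=> /k1[]. Qed.

Lemma src_pi_eq a b : src (tw_pi a) = src (tw_pi b) <-> src a = src b.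
Proof.
split => [|h]; last by rewrite -!pi_src h.
rewrite -!pi_src => h; rewrite -(tw_i_pi (units_src a)) h tw_i_pi//.
exact: units_src.
Qed.

Lemma rng_pi_eq a b : rng (tw_pi a) = rng (tw_pi b) <-> rng a = rng b.
Proof. by rewrite -!srcV -!pi_inv; exact: src_pi_eq. Qed.

Lemma pi_eq_src a b : tw_pi a = tw_pi b -> src a = src b.
Proof. by move=> h; apply/src_pi_eq; rewrite h. Qed.

Lemma pi_eq_rng a b : tw_pi a = tw_pi b -> rng a = rng b.
Proof. by move=> h; apply/rng_pi_eq; rewrite h. Qed.

Lemma rng_tw_i x z : units G x -> circle z -> rng (tw_i E x z) = tw_i E x 1.
Proof.
move=> ux cz; have [c e] := tw_i_hom E ux (circle1 R) cz.
by rewrite mul1r in e; rewrite e rng_mul//; have [] := unitsP (units_tw_i ux).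
Qed.

Lemma pi_tw_i x z : units G x -> circle z -> tw_pi (tw_i E x z) = x.
Proof.
move=> ux cz.
have : (@tw_pi _ _ E @^-1` units G) (tw_i E x z).
  by rewrite tw_exact; exists x => //; exists z.
move=> /= /unitsP[_ <-]; rewrite -pi_src src_tw_i//.
by rewrite tw_pi_i.
Qed.

Lemma composable_act z e : circle z -> composable (tw_i E (tw_pi (rng e)) z) e.
Proof.
move=> cz; rewrite /composable src_tw_i//; last exact: units_pi_rng.
by rewrite tw_i_pi//; exact: units_rng.
Qed.

Lemma rng_act z e : circle z -> rng (tw_act z e) = rng e.
Proof.
move=> cz; rewrite /tw_act rng_mul; last exact: composable_act.
rewrite rng_tw_i//; last exact: units_pi_rng.
by rewrite tw_i_pi//; exact: units_rng.
Qed.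

Lemma src_act z e : circle z -> src (tw_act z e) = src e.
Proof. by move=> cz; rewrite /tw_act src_mul//; exact: composable_act. Qed.

Lemma pi_act z e : circle z -> tw_pi (tw_act z e) = tw_pi e.
Proof.
move=> cz; rewrite /tw_act pi_mul; last exact: composable_act.
by rewrite pi_tw_i// ?pi_rng ?gmull_rng//; exact: units_rng.
Qed.

Lemma act1 e : tw_act 1 e = e.
Proof. by rewrite /tw_act tw_i_pi ?gmull_rng//; exact: units_rng. Qed.

Lemma actM z w e : circle z -> circle w ->
  tw_act z (tw_act w e) = tw_act (z * w) e.
Proof.
move=> cz cw; rewrite {1}/tw_act rng_act// /tw_act.
have [c ->] := tw_i_hom E (units_pi_rng e) cz cw.
by rewrite gpdA//; exact: composable_act.
Qed.

Lemma act_mull z a b : circle z -> composable a b ->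
  gmul (tw_act z a) b = tw_act z (gmul a b).
Proof.
by move=> cz ab; rewrite /tw_act rng_mul// gpdA//; exact: composable_act.
Qed.

Lemma act_mulr z a b : circle z -> composable a b ->
  gmul a (tw_act z b) = tw_act z (gmul a b).
Proof.
move=> cz ab; rewrite -act_mull// /tw_act -ab tw_central//.
have ca : composable a (tw_i E (tw_pi (src a)) z).
  rewrite /composable rng_tw_i//; last exact: units_pi_src.
  by rewrite tw_i_pi//; exact: units_src.
rewrite gpdA//.
rewrite /composable src_tw_i//; last exact: units_pi_src.
by rewrite tw_i_pi//; exact: units_src.
Qed.

Lemma inv_act z e : circle z -> ginv (tw_act z e) = tw_act z^-1 (ginv e).
Proof.
move=> cz; have cz' := circleV cz.
have cvl : composable (ginv e) e by exact: composableVl.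
have cv : composable (tw_act z^-1 (ginv e)) (tw_act z e).
  by rewrite /composable src_act// srcV rng_act.
have h : gmul (tw_act z^-1 (ginv e)) (tw_act z e) = src (tw_act z e).
  rewrite act_mulr//; last by rewrite /composable src_act// srcV.
  rewrite act_mull// actM// mulfV ?circle_neq0// act1.
  by rewrite src_act.
by rewrite -[RHS](gpdKr cv) h -rngV gmull_rng.
Qed.

Lemma act_inj z w e : circle z -> circle w -> tw_act z e = tw_act w e -> z = w.
Proof.
move=> cz cw /(gpdIr (composable_act e cz) (composable_act e cw)).
by move=> /(tw_i_inj (units_pi_rng e) (units_pi_rng e) cz cw)[].
Qed.

Lemma pi_fibre a b : tw_pi a = tw_pi b -> exists2 z, circle z & b = tw_act z a.
Proof.
move=> ab; have sab := esym (pi_eq_src ab).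
have : (@tw_pi _ _ E @^-1` units G) (gmul b (ginv a)).
  rewrite /= pi_mul; last exact: composable_div.
  by rewrite pi_inv ab; exact: units_rng.
rewrite tw_exact => -[x ux [z cz zE]]; exists z => //.
rewrite -[LHS](gpd_divK sab) -zE /tw_act; congr (gmul (tw_i _ _ _) _).
rewrite (pi_eq_rng ab) -(rng_div sab) -zE rng_tw_i//.
by rewrite tw_pi_i.
Qed.

Lemma pi_units_act e : units G (tw_pi e) ->
  exists2 z, circle z & e = tw_act z (src e).
Proof. by move=> u; apply: pi_fibre; rewrite pi_src; have [] := unitsP u. Qed.

Lemma pi_lift (g : G) : tw_pi (tw_lift E g) = g.
Proof. by rewrite /tw_lift; case: cid. Qed.

Lemma lift_fibre e : exists2 z, circle z & e = tw_act z (tw_lift E (tw_pi e)).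
Proof. by apply: pi_fibre; rewrite pi_lift. Qed.

Lemma pi_open (O : set E) : open O -> open (@tw_pi _ _ E @` O).
Proof.
move=> oO; rewrite openE => _ [e Oe <-].
have [U [S [[oU _ _] Ue cS Sp [k [k1 k2 ck _]]]]] := tw_section E (tw_pi e).
have Upe : (@tw_pi _ _ E @^-1` U) e by [].
have [[/= Uke ckz] eE] := k2 _ Upe.
set g := (k e).1 in Uke eE; set z := (k e).2 in ckz eE.
have nO : nbhs (gmul (tw_i E (rng g) z) (S g)) O.
  by rewrite eE; apply: open_nbhs_nbhs.
have /= := (subspace_continuousP _ _).1 ck (g, z) (conj Uke ckz) _ nO.
rewrite /within /= => -[[A B] /= [nA nB] ABO].
have ge : g = tw_pi e.
  rewrite -eE pi_mul ?pi_tw_i ?Sp ?gmull_rng//; last 2 first.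
  - exact: units_rng.
  - by rewrite -[X in rng X]Sp// -pi_rng; exact: composable_act.
have nU : nbhs (tw_pi e) U by apply: open_nbhs_nbhs.
rewrite ge in nA; apply: filterS (filterI nA nU) => h [Ah Uh].
have := ABO (h, z) (conj Ah (nbhs_singleton nB)) (conj Uh ckz).
move=> /= Oh; eexists; first exact: Oh.
rewrite pi_mul ?pi_tw_i ?Sp ?gmull_rng//; first exact: units_rng.
by rewrite -[X in rng X]Sp// -pi_rng; exact: composable_act.
Qed.

End TwistAlgebra.

(** * Functions with compact support *)

Section ContinuousAlgebra.
Variables (R : realType) (X : topologicalType).
Implicit Types f g : X -> R[i].

Lemma contC_add f g : continuous f -> continuous g -> continuous (fun t => f t + g t).
Proof. by move=> cf cg t; apply: cvgD; [exact: cf|exact: cg]. Qed.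

Lemma contC_mul f g : continuous f -> continuous g -> continuous (fun t => f t * g t).
Proof. by move=> cf cg t; apply: cvgM; [exact: cf|exact: cg]. Qed.

Lemma contC_scale k f : continuous f -> continuous (fun t => k * f t).
Proof. by move=> cf t; apply: cvgM; [exact: cvg_cst|exact: cf]. Qed.

Lemma contC_real (h : X -> R) : continuous h -> continuous (fun t => (h t)%:C%C : R[i]).
Proof. by move=> ch t; apply: continuous_comp; [exact: ch|exact: realC_continuous]. Qed.

Lemma nc_cont f : continuous f -> continuous (fun t => nc (f t)).
Proof. by move=> cf t; apply: continuous_comp; [exact: cf|exact: nc_continuous]. Qed.

Lemma open_nc_lt f (e : R) : continuous f -> open [set t | nc (f t) < e].
Proof.
move=> /nc_cont cf; rewrite (_ : [set _ | _] = (fun t => nc (f t)) @^-1` [set x | x < e]) //.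
by apply: open_comp; [move=> ? _; exact: cf|exact: open_lt].
Qed.

Lemma open_nc_gt f (e : R) : continuous f -> open [set t | e < nc (f t)].
Proof.
move=> /nc_cont cf; rewrite (_ : [set _ | _] = (fun t => nc (f t)) @^-1` [set x | x > e]) //.
by apply: open_comp; [move=> ? _; exact: cf|exact: open_gt].
Qed.

Lemma open_neq0 f : continuous f -> open [set t | f t != 0].
Proof.
move=> cf; rewrite (_ : [set _ | _] = [set t | 0 < nc (f t)]); first exact: open_nc_gt.
by apply/seteqP; split => t /=; rewrite nc_gt0.
Qed.

Lemma closed_nc_ge f (e : R) : continuous f -> closed [set t | e <= nc (f t)].
Proof.
move=> /nc_cont cf; rewrite (_ : [set _ | _] = (fun t => nc (f t)) @^-1` [set x | e <= x]) //.
by apply: closed_comp; [move=> ? _; exact: cf|exact: closed_ge].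
Qed.

Lemma contR_pos (h : X -> R) : continuous h -> continuous (fun t => (`|h t| + h t) / 2).
Proof.
move=> ch t; apply: cvgM; last exact: cvg_cst.
apply: cvgD; last exact: ch.
by apply: cvg_norm; exact: ch.
Qed.

End ContinuousAlgebra.

Section Bump.
Variables (R : realType) (X : topologicalType).
Hypothesis (lcX : locally_compact [set: X]) (hX : hausdorff_space X).

Lemma lc_bump (x : X) (O : set X) : nbhs x O -> exists (psi : X -> R) (K : set X),
  [/\ continuous psi, (forall t, 0 <= psi t <= 1), psi x = 1 &
   [/\ compact K, closed K, K `<=` O & forall t, psi t != 0 -> K t]].
Proof.
move=> nO; have [K nK [cK clK]] := lcX (x := x) Logic.I.
have {}nK : nbhs x K by move: nK; rewrite withinET.
pose B := ~` interior (O `&` K).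
have clB : closed B by apply: open_closedC; exact: open_interior.
have Bx : ~ B x by apply; exact: filterI.
have us : uniform_separator [set x] B.
  exact: (@locally_compact_completely_regular X R lcX hX x B clB Bx).
have [f [cf f01 f0 f1]] := (@uniform_separatorP X R [set x] B).1 us.
have h01 t : 0 <= f t <= 1.
  by have := f01 (f t); rewrite /= in_itv/=; apply; exists t.
exists (fun t => (`|1 - 2 * f t| + (1 - 2 * f t)) / 2), [set t | f t <= 2^-1]; split.
- apply: (contR_pos (h := fun t => 1 - 2 * f t)) => t.
  apply: cvgB; first exact: cvg_cst.
  by apply: cvgM; [exact: cvg_cst|exact: cf].
- move=> t; have /andP[a b] := h01 t.
  have [c|c] := lerP 0 (1 - 2 * f t); [rewrite ger0_norm|rewrite ltr0_norm] => //; apply/andP; split; lra.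
- have -> : f x = 0 by apply: f0; exists x.
  by rewrite mulr0 subr0 normr1; lra.
- have clK' : closed [set t | f t <= 2^-1].
    rewrite (_ : [set _ | _] = f @^-1` [set y | y <= 2^-1])//.
    by apply: closed_comp; [move=> ? _; exact: cf|exact: closed_le].
  have KOK : [set t | f t <= 2^-1] `<=` O `&` K.
    move=> t /= ft; apply: contrapT => nOK.
    have Bt : B t by move=> /interior_subset.
    have ft1 : f t = 1 by apply: f1; exists t.
    by rewrite ft1 in ft; lra.
  split=> //.
  + by apply: (subclosed_compact clK' cK) => t /KOK[].
  + by move=> t /KOK[].
  + move=> t; apply: contra_neqT; rewrite -ltNge => ft.
    by rewrite ltr0_norm; lra.
Qed.

End Bump.

Lemma circle_compact (R : realType) : compact (@circle R).
Proof.
pose f (ab : R * R) : R[i] := (ab.1 +i* ab.2)%C.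
have cf : continuous f.
  have -> : f = (fun ab => ab.1%:C%C + 'i%C * ab.2%:C%C).
    by apply/funext => -[a b]; rewrite /f /=; simpc.
  apply: contC_add; first by apply: contC_real => -[a b]; exact: cvg_fst.
  by apply: contC_scale; apply: contC_real => -[a b]; exact: cvg_snd.
have h : compact (`[-1, 1]%classic `*` `[-1, 1]%classic : set (R * R)).
  by apply: compact_setX; exact: segment_compact.
have cl : closed (f @^-1` @circle R).
  by apply: closed_comp; [move=> ? _; exact: cf|exact: circle_closed].
have sub : f @^-1` @circle R `<=` `[-1, 1]%classic `*` `[-1, 1]%classic.
  move=> [a b] /circle_nc fab; split; rewrite /= in_itv/= -ler_norml.
    by rewrite -[X in _ <= X]fab; exact: (Re_le_nc (f (a, b))).
  by rewrite -[X in _ <= X]fab; exact: (Im_le_nc (f (a, b))).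
have -> : @circle R = f @` (f @^-1` @circle R).
  apply/seteqP; split => [z cz|_ [ab + <-]//].
  by exists (complex.Re z, complex.Im z); rewrite /f /=; case: z cz.
apply: continuous_compact; first exact: continuous_subspaceT.
exact: subclosed_compact h sub.
Qed.

Section CompactTwist.
Variables (R : realType) (G : topGroupoid) (E : twist R G).

(** The part of a twist over a compact subset of a trivialised neighbourhood
    is a continuous image of that set times the circle. *)
Lemma section_compact (U K : set G) (S : G -> E) :
  {within U, continuous S} ->
  homeo_on (U `*` @circle R) (@tw_pi _ _ E @^-1` U)
    (fun hz : G * R[i] => gmul (tw_i E (rng hz.1) hz.2) (S hz.1)) ->
  (forall h, U h -> tw_pi (S h) = h) ->
  compact K -> K `<=` U -> compact (@tw_pi _ _ E @^-1` K).
Proof.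
move=> cS [k [k1 k2 ck ck']] Sp cK KU.
pose m := fun hz : G * R[i] => gmul (tw_i E (rng hz.1) hz.2) (S hz.1).
have pm h z : U h -> circle z -> tw_pi (m (h, z)) = h.
  move=> Uh cz; rewrite /m /=.
  have -> : rng h = tw_pi (rng (S h)) by rewrite pi_rng Sp.
  by rewrite -/(tw_act z (S h)) pi_act// Sp.
have -> : @tw_pi _ _ E @^-1` K = m @` (K `*` @circle R).
  apply/seteqP; split => [e /= Ke|_ [[h z] [/= Kh cz] <-]]; last first.
    by rewrite /= pm//; exact: KU.
  have [[/= Uk ckz] eE] := k2 e (KU _ Ke).
  exists (k e) => //; split => //=; rewrite -(pm _ _ Uk ckz).
  by move: eE; rewrite /m /= => ->.
apply: continuous_compact.
  apply: continuous_subspaceW ck => -[h z] [/= Kh cz]; split => //.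
  exact: KU.
by apply: compact_setX => //; exact: circle_compact.
Qed.

End CompactTwist.

(** * Equivariant functions of compact support *)

Lemma within_open_cvg (X Y : topologicalType) (A : set X) (f : X -> Y) x :
  {within A, continuous f} -> open A -> A x -> f @ x --> f x.
Proof.
move=> /(subspace_continuousP A f).1 h oA Ax; have := h _ Ax.
by rewrite within_interior//; move/(interior_id A).1 : oA => ->.
Qed.

Lemma cvg_near_eq (X Y : topologicalType) (f g : X -> Y) x :
  (\forall t \near x, f t = g t) -> g @ x --> g x -> f @ x --> f x.
Proof.
move=> fg cg; have fgx : f x = g x by exact: (nbhs_singleton fg).
rewrite fgx; apply: cvg_trans cg; apply: near_eq_cvg.
by apply: filterS fg => t ->.
Qed.

Section SigmaC.
Variables (R : realType) (G : topGroupoid) (E : twist R G).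
Implicit Types (f g : E -> R[i]) (e c : E).
Local Notation pi := (@tw_pi _ _ E).

Definition supported_in f (K : set G) := forall e, f e != 0 -> K (pi e).

Lemma Sigma_cP f : Sigma_c f <->
  [/\ continuous f, equivariant f &
    exists2 K : set E, compact K & forall e, f e != 0 -> K e].
Proof.
split=> [[cf cK ef]|[cf ef [K cK fK]]].
  by split => //; exists (closure [set e | f e != 0]) => // e fe; apply: subset_closure.
split => //; apply: (subclosed_compact _ cK); first exact: closed_closure.
have clK := compact_closed (@tw_hausdorff _ _ E) cK.
by rewrite [X in _ `<=` X]((closure_id K).1 clK); exact: closure_subset.
Qed.

Lemma Sigma_c0 : Sigma_c (fun _ : E => 0).
Proof.
apply/Sigma_cP; split => [e|z e _|]; [exact: cvg_cst|by rewrite mulr0|].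
by exists set0; [exact: compact0|move=> e; rewrite eqxx].
Qed.

Lemma addCE f g e : (f + g) e = f e + g e.
Proof. by []. Qed.

Lemma Sigma_cD f g : Sigma_c f -> Sigma_c g -> Sigma_c (f + g).
Proof.
move=> /Sigma_cP[cf ef [K cK fK]] /Sigma_cP[cg eg [L cL gL]]; apply/Sigma_cP; split.
- exact: (contC_add cf cg).
- by move=> z e cz; rewrite fctE ef// eg// mulrDr.
- exists (K `|` L); first exact: compactU.
  move=> e; rewrite fctE; have [->|/fK] := eqVneq (f e) 0; last by left.
  by rewrite add0r => /gL; right.
Qed.

Lemma scaleCE k f e : (k *: f) e = k * f e.
Proof. by []. Qed.

Lemma Sigma_cZ k f : Sigma_c f -> Sigma_c (k *: f).
Proof.
move=> /Sigma_cP[cf ef [K cK fK]]; apply/Sigma_cP; split.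
- rewrite (_ : k *: f = fun e => k * f e); first exact: contC_scale.
  by apply/funext => e; rewrite scaleCE.
- by move=> z e cz; rewrite !scaleCE ef// mulrCA.
- exists K => // e; rewrite scaleCE; have [->|/fK//] := eqVneq (f e) 0.
  by rewrite mulr0 eqxx.
Qed.

Lemma Sigma_cN f : Sigma_c f -> Sigma_c (- f).
Proof. by rewrite -scaleN1r; exact: Sigma_cZ. Qed.

Lemma Sigma_cB f g : Sigma_c f -> Sigma_c g -> Sigma_c (f - g).
Proof. by move=> hf hg; apply: Sigma_cD => //; exact: Sigma_cN. Qed.

Lemma Sigma_c_mul (h f : E -> R[i]) : continuous h ->
  (forall z e, circle z -> h (tw_act z e) = h e) -> Sigma_c f ->
  Sigma_c (fun e => h e * f e).
Proof.
move=> ch eh /Sigma_cP[cf ef [K cK fK]]; apply/Sigma_cP; split.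
- exact: (contC_mul ch cf).
- by move=> z e cz; rewrite ef// eh// mulrCA.
- exists K => // e; have [->|/fK//] := eqVneq (f e) 0.
  by rewrite mulr0 eqxx.
Qed.

Hypotheses (Glc : locally_compact [set: G]) (Ghaus : hausdorff_space G).

(** In a trivialised neighbourhood of [pi e0] the bump is the circle coordinate
    relative to [e0], cut off near [pi e0]; it is close to [1] only at points
    whose base and circle coordinates are both close to those of [e0]. *)
Lemma Sigma_bump (e0 : E) (O : set E) : nbhs e0 O ->
  exists (a : E -> R[i]) (U K : set G),
  [/\ Sigma_c a, open_bisection U, compact K, K `<=` U & supported_in a K] /\
  [/\ a e0 = 1, (forall e, nc (a e) <= 1) &
    exists2 d, 0 < d & forall e, nc (1 - a e) < d -> O e].
Proof.
move=> nO; have [U [S [bU Ue0 cS Sp hU]]] := tw_section E (pi e0).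
have [k [k1 k2 ck ck']] := hU.
have [oU _ _] := bU.
have opU : open (pi @^-1` U).
  by apply: open_comp => // e _; exact: tw_pi_continuous.
pose m := fun hz : G * R[i] => gmul (tw_i E (rng hz.1) hz.2) (S hz.1).
have mE h z : U h -> m (h, z) = tw_act z (S h).
  by move=> Uh; rewrite /m /tw_act /= pi_rng Sp.
have kE e : U (pi e) -> [/\ (k e).1 = pi e, circle (k e).2 &
    e = tw_act (k e).2 (S (pi e))].
  move=> Ue; have [[/= Uk ckz] eE] := k2 e Ue.
  have eE' : e = tw_act (k e).2 (S (k e).1) by rewrite -mE//.
  have e1 : (k e).1 = pi e by rewrite [in RHS]eE' pi_act// Sp.
  by split=> //; rewrite -e1.
have kact z e : circle z -> U (pi e) -> (k (tw_act z e)).2 = z * (k e).2.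
  move=> cz Ue; have [e1 e2 e3] := kE _ Ue.
  have Uze : U (pi (tw_act z e)) by rewrite pi_act.
  have [f1 f2 f3] := kE _ Uze; rewrite pi_act// in f3.
  move: f3; rewrite [in LHS]e3 actM// => /act_inj h.
  by rewrite -h//; exact: circleM.
have [z0E cz0 e0E] := kE _ Ue0; set z0 := (k e0).2 in z0E cz0 e0E.
have nO' : nbhs (m (pi e0, z0)) O by rewrite mE// -e0E.
have := (subspace_continuousP _ _).1 ck (pi e0, z0) (conj Ue0 cz0) _ nO'.
rewrite /within /= => -[[A B] /= [nA nB] ABO].
have [r r0 rB] : exists2 r : R, 0 < r & forall z, nc (z0 - z) < r -> B z.
  move: nB => /(@nbhs_normP _ _ z0 B)[r /= r0 rB].
  have rr : r = (complex.Re r)%:C%C by rewrite RRe_real// gtr0_real.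
  exists (complex.Re r); first by move: r0; rewrite {1}rr ltcR.
  by move=> z zr; apply: rB; rewrite /= normCE rr ltcR.
have nAU : nbhs (pi e0) (A `&` U) by apply: filterI => //; exact: open_nbhs_nbhs.
have [psi [K [cpsi psi01 psi1 [cK clK KAU psiK]]]] := lc_bump R Glc Ghaus nAU.
have z0n := circle_neq0 cz0.
pose a e := if `[< U (pi e) >] then (psi (pi e))%:C%C * ((k e).2 / z0) else 0.
have KU : K `<=` U by move=> g /KAU[].
have aK : supported_in a K.
  move=> e; rewrite /a; case: asboolP => [_|]; last by rewrite eqxx.
  move=> h; apply: psiK; apply: contra_neq h => ->.
  by rewrite mul0r.
have na e : nc (a e) <= 1.
  rewrite /a; case: asboolP => [Ue|_]; last by rewrite nc0 ler01.
  have [_ /circle_nc c1 _] := kE _ Ue.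
  rewrite !ncM ncV c1 (circle_nc z0).1// invr1 !mulr1 nc_real.
  by have /andP[p0 p1] := psi01 (pi e); rewrite ger0_norm.
exists a, U, K; split; last split => //.
- split => //; apply/Sigma_cP; split.
  + move=> e; have [Ue|nUe] := pselect (U (pi e)).
      apply: (@cvg_near_eq _ _ _ (fun e => (psi (pi e))%:C%C * ((k e).2 / z0))).
        apply: filterS (open_nbhs_nbhs (conj opU Ue)) => t Ut.
        by rewrite /a; case: asboolP.
      apply: cvgM.
        apply: (contC_real (h := psi \o pi)) => t.
        by apply: continuous_comp; [exact: tw_pi_continuous|exact: cpsi].
      apply: cvgM; last exact: cvg_cst.
      apply: (@cvg_comp _ _ _ k snd _ (nbhs (k e))); last exact: cvg_snd.
      exact: (within_open_cvg ck' opU).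
    apply: (@cvg_near_eq _ _ _ (fun=> 0)); last exact: cvg_cst.
    have opK : open (~` (pi @^-1` K)).
      apply: closed_openC; apply: closed_comp => // t _.
      exact: tw_pi_continuous.
    apply: filterS (open_nbhs_nbhs (conj opK _)) => /= [t nKt|Ke].
      by apply/eqP; apply: contra_notT nKt => /aK.
    by apply: nUe; exact: KU.
  + move=> z e cz; rewrite /a pi_act//; case: asboolP => [Ue|_].
      by rewrite kact//; ring.
    by rewrite mulr0.
  + exists (pi @^-1` K); last exact: aK.
    exact: section_compact cS hU Sp cK KU.
- rewrite /a; case: asboolP => // _.
  by rewrite psi1 divff// mulr1.
- exists (Num.min 1 (r / 2)); first by rewrite lt_min ltr01 divr_gt0.
  move=> e; rewrite lt_min => /andP[d1 d2].
  have ae0 : a e != 0.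
    by apply/eqP => ae0; rewrite ae0 subr0 nc1 ltxx in d1.
  have Ke := aK _ ae0; have [Ae Ue] := KAU _ Ke.
  have [_ ke2 eE] := kE _ Ue.
  rewrite eE -mE//; apply: (ABO (pi e, (k e).2)) => //; split => //=.
  apply: rB.
  move: d2; rewrite /a; case: asboolP => // _ d2.
  set t := psi (pi e) in d2; set w := (k e).2 in ke2 eE d2 *.
  have cw : circle (w / z0) by apply: circleM => //; exact: circleV.
  have -> : z0 - w = z0 * (1 - w / z0).
    by rewrite mulrBr mulr1 mulrCA divff// mulr1.
  rewrite nc_circleM//.
  have t1 : nc (w / z0 * (1 - t%:C%C)) < r / 2.
    rewrite nc_circleM//; apply: le_lt_trans d2.
    have := nc_dist 1 (t%:C%C * (w / z0)).
    rewrite ncM (circle_nc (w / z0)).1// mulr1 nc1; apply: le_trans.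
    have -> : 1 - t%:C%C = (1 - t)%:C%C :> R[i] by rewrite rmorphB.
    have /andP[p0 p1] := psi01 (pi e).
    by rewrite !nc_real (ger0_norm p0).
  have -> : 1 - w / z0 = (1 - t%:C%C * (w / z0)) - (w / z0 * (1 - t%:C%C)) by ring.
  apply: le_lt_trans (ncB _ _) _; lra.
Qed.

End SigmaC.

Section UnitCoordinate.
Variables (R : realType) (G : topGroupoid) (E : twist R G).
Implicit Types (e : E) (z : R[i]).
Local Notation pi := (@tw_pi _ _ E).

(** The unit of the convolution algebra: [i(x,z) |-> z], extended by zero. *)
Definition unit_coord e : R[i] :=
  if pselect (exists z, circle z /\ e = tw_act z (src e)) is left h
  then sval (cid h) else 0.

Lemma unit_coord_act z u : units E u -> circle z -> unit_coord (tw_act z u) = z.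
Proof.
move=> uu cz; have [_ su] := unitsP uu.
rewrite /unit_coord; case: pselect => [h|]; last first.
  by case; exists z; split => //; rewrite src_act// su.
case: cid => w /= [cw]; rewrite src_act// su => h'.
by rewrite (act_inj cz cw h').
Qed.

Lemma unit_coord_unit u : units E u -> unit_coord u = 1.
Proof.
by move=> uu; rewrite -[X in unit_coord X]act1 unit_coord_act//; exact: circle1.
Qed.

Lemma units_pi_units u : units E u -> units G (pi u).
Proof. by move=> /unitsP[_ <-]; exact: units_pi_src. Qed.

Lemma unit_coord_neq0 e : unit_coord e != 0 -> units G (pi e).
Proof.
rewrite /unit_coord; case: pselect => [[z [cz eE]] _|_]; last by rewrite eqxx.
by rewrite eE pi_act//; exact: units_pi_src.
Qed.

Lemma unit_coord_equivariant : equivariant unit_coord.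
Proof.
move=> z e cz; have [ue|nue] := pselect (units G (pi e)).
  have [w cw ->] := pi_units_act ue.
  by rewrite actM// !unit_coord_act//; try exact: units_src; exact: circleM.
have h0 : unit_coord e = 0.
  by apply/eqP; apply: contra_notT nue; exact: unit_coord_neq0.
rewrite h0 mulr0; apply/eqP; apply: contra_notT nue => /unit_coord_neq0.
by rewrite pi_act.
Qed.

Lemma unit_coord_circle e : units G (pi e) -> circle (unit_coord e).
Proof.
by move=> /pi_units_act[w cw ->]; rewrite unit_coord_act//; exact: units_src.
Qed.

Hypotheses (Get : etale G) (Gcpt : compact (units G)) (Ghaus : hausdorff_space G).

Lemma tw_i_compact (C : set R[i]) : closed C ->
  compact [set tw_i E x z | x in units G & z in @circle R `&` C].
Proof.
move=> clC.
have -> : [set tw_i E x z | x in units G & z in @circle R `&` C] =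
    (fun xz : G * R[i] => tw_i E xz.1 xz.2) @` (units G `*` (@circle R `&` C)).
  apply/seteqP; split => [_ [x ux [z [cz Cz] <-]]|_ [[x z] [/= ux [cz Cz]] <-]].
    by exists (x, z).
  by exists x => //; exists z.
apply: continuous_compact.
  by apply: continuous_subspaceW (@tw_i_continuous _ _ E) => -[x z] [ux []].
apply: compact_setX => //.
apply: (subclosed_compact _ (@circle_compact R)); last by move=> z [].
by apply: closedI => //; exact: circle_closed.
Qed.

(** The coordinate is continuous because [i] is a continuous bijection from a
    compact space onto the clopen set [pi^-1 (units G)]. *)
Lemma unit_coord_continuous : continuous unit_coord.
Proof.
apply/continuous_closedP => C clC.
pose I := [set tw_i E x z | x in units G & z in @circle R `&` C].
have clI : closed I.
  by apply: compact_closed; [exact: tw_hausdorff|exact: tw_i_compact].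
have IP e : I e <-> units G (pi e) /\ C (unit_coord e).
  split=> [[x ux [z [cz Cz] <-]]|[ue Ce]].
    rewrite pi_tw_i//; split => //.
    have -> : tw_i E x z = tw_act z (tw_i E x 1).
      have r1 : rng (tw_i E x 1) = tw_i E x 1 by have [] := unitsP (units_tw_i E ux).
      rewrite /tw_act r1 tw_pi_i//.
      by have [_] := tw_i_hom E ux cz (circle1 R); rewrite mulr1.
    by rewrite unit_coord_act//; exact: units_tw_i.
  have [w cw eE] := pi_units_act ue; exists (pi (src e)); first exact: units_pi_src.
  have uE : unit_coord e = w by rewrite eE unit_coord_act//; exact: units_src.
  exists w; first by split => //; rewrite -uE.
  rewrite [RHS]eE /tw_act.
  have [rs _] := unitsP (units_src e).
  rewrite rs -[X in gmul _ X](tw_i_pi (units_src e)).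
  by have [_ <-] := tw_i_hom E (units_pi_src e) cw (circle1 R); rewrite mulr1.
have opU : open (pi @^-1` units G).
  apply: open_comp; last exact: units_open.
  by move=> e _; exact: tw_pi_continuous.
have [C0|nC0] := pselect (C 0).
  rewrite (_ : unit_coord @^-1` C = I `|` ~` (pi @^-1` units G)); last first.
    apply/seteqP; split => e /=.
      by move=> Ce; have [ue|nue] := pselect (units G (pi e)); [left; apply/IP|right].
    case=> [/IP[]//|nue].
    suff -> : unit_coord e = 0 by [].
    by apply/eqP; apply: contra_notT nue; exact: unit_coord_neq0.
  by apply: closedU => //; exact: open_closedC.
rewrite (_ : unit_coord @^-1` C = I)//.
apply/seteqP; split => e /=; last by move=> /IP[].
move=> Ce; apply/IP; split => //; apply: unit_coord_neq0.
by apply/eqP => h; rewrite h in Ce.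
Qed.

Lemma unit_coord_Sigma : Sigma_c unit_coord.
Proof.
apply/Sigma_cP; split.
- exact: unit_coord_continuous.
- exact: unit_coord_equivariant.
- exists (pi @^-1` units G); last exact: unit_coord_neq0.
  rewrite tw_exact (_ : [set _ | _ in _ & _ in _] =
    [set tw_i E x z | x in units G & z in @circle R `&` setT]); last by rewrite setIT.
  by apply: tw_i_compact; exact: closedT.
Qed.

(** A function on the base as an equivariant function supported over the units;
    only its values at units matter. *)
Definition diag (d : G -> R[i]) : E -> R[i] :=
  fun e => d (pi (rng e)) * unit_coord e.

Lemma diag_Sigma d : continuous d -> Sigma_c (diag d).
Proof.
move=> cd; apply: (Sigma_c_mul (h := fun e => d (pi (rng e)))).
- move=> e; apply: continuous_comp; last exact: cd.
  by apply: continuous_comp; [exact: rng_continuous|exact: tw_pi_continuous].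
- by move=> z e cz; rewrite rng_act.
- exact: unit_coord_Sigma.
Qed.

End UnitCoordinate.

Lemma compact_subcover (X : topologicalType) (K : set X) (O : X -> set X) :
  compact K -> (forall x, K x -> nbhs x (O x)) ->
  exists s : seq X, (forall x, x \in s -> K x) /\
    forall t, K t -> exists2 x, x \in s & O x t.
Proof.
move=> /compact_near_coveringP cK hO.
pose Fs : set_system (seq X) := [set A | exists2 s0 : seq X,
  (forall x, x \in s0 -> K x) &
  forall s : seq X, (forall x, x \in s -> K x) -> {subset s0 <= s} -> A s].
have FF : Filter Fs.
  split.
  - by exists [::].
  - move=> A B [s1 s1K hA] [s2 s2K hB]; exists (s1 ++ s2).
      by move=> x; rewrite mem_cat => /orP[/s1K|/s2K].
    move=> s sK sub; split; [apply: hA => // x xs|apply: hB => // x xs];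
      by apply: sub; rewrite mem_cat xs ?orbT.
  - by move=> A B AB [s0 s0K hA]; exists s0 => // s sK sub; apply: AB; exact: hA.
have := cK _ Fs (fun s t => exists2 x, x \in s & O x t) FF.
case.
- move=> x Kx; exists (O x, [set s : seq X | x \in s]) => /=.
    split; first exact: hO.
    exists [:: x]; first by move=> y; rewrite inE => /eqP ->.
    by move=> s _; apply; rewrite mem_head.
  by move=> [t s] [/= Ot xs]; exists x.
- by move=> s0 s0K h; exists s0; split => //; exact: (h s0).
Qed.

Section Fragmentation.
Variables (R : realType) (G : topGroupoid) (E : twist R G).
Hypotheses (Glc : locally_compact [set: G]) (Ghaus : hausdorff_space G).
Implicit Types (f g : E -> R[i]) (e c : E).
Local Notation pi := (@tw_pi _ _ E).

Definition elementary f := Sigma_c f /\ exists (U K : set G),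
  [/\ open_bisection U, compact K, K `<=` U & supported_in f K].

(** Partition of unity: cut-off functions equal to [1] at the points of the
    support are larger than [1/2] on a finite cover of it; dividing them by
    their sum, floored at [1/2], makes them add up to [1] on the support. *)
Lemma fragmentation f : Sigma_c f -> exists fs : seq (E -> R[i]),
  (forall g, g \in fs -> elementary g) /\ f = \sum_(g <- fs) g.
Proof.
move=> Sf; have /Sigma_cP[cf ef [K cK fK]] := Sf.
have ex (e : E) : exists Y : (G -> R) * (set G * set G),
  [/\ continuous Y.1, (forall t, 0 <= Y.1 t <= 1), Y.1 (pi e) = 1 &
   [/\ open_bisection Y.2.1, compact Y.2.2, Y.2.2 `<=` Y.2.1 & forall t, Y.1 t != 0 -> Y.2.2 t]].
  have [U [S [bU Ue _ _ _]]] := tw_section E (pi e).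
  have [oU _ _] := bU.
  have [psi [L [cpsi h01 h1 [cL clL LU psiL]]]] :=
    lc_bump R Glc Ghaus (open_nbhs_nbhs (conj oU Ue)).
  by exists (psi, (U, L)).
pose Y e := sval (cid (ex e)).
have YP e := svalP (cid (ex e)).
pose chi e : E -> R := (Y e).1 \o pi.
have cchi e : continuous (chi e).
  move=> t; have [cY _ _ _] := YP e.
  by apply: continuous_comp; [exact: tw_pi_continuous|exact: cY].
have [|D [DK cov]] := @compact_subcover _ K (fun e => [set t | 2^-1 < chi e t]) cK.
  move=> e Ke; apply: open_nbhs_nbhs; split.
    rewrite (_ : [set _ | _] = chi e @^-1` [set x | x > 2^-1])//.
    by apply: open_comp; [move=> ? _; exact: cchi|exact: open_gt].
  rewrite /= /chi /=.
  by have [_ _ -> _] := YP e; rewrite invf_lt1// ltr1n.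
pose s t := \sum_(e <- D) chi e t.
pose m t := (`|s t - 2^-1| + (s t - 2^-1)) / 2 + 2^-1.
have chi_ge0 e t : 0 <= chi e t.
  by have [_ /(_ (pi t))/andP[]] := YP e.
have cs : continuous s.
  rewrite /s; elim: (D) => [|e r IH] t.
    by under eq_fun do rewrite big_nil; exact: cvg_cst.
  by under eq_fun do rewrite big_cons; apply: cvgD; [exact: cchi|exact: IH].
have m_gt0 t : 0 < m t.
  rewrite /m; have := ler_norm (- (s t - 2^-1)); rewrite normrN => h; lra.
have cm : continuous m.
  move=> t; apply: cvgD; last exact: cvg_cst.
  apply: (contR_pos (h := fun t => s t - 2^-1)) => u.
  by apply: cvgB; [exact: cs|exact: cvg_cst].
have mE t : K t -> m t = s t.
  move=> /cov[e De chi_t]; have st : 2^-1 < s t.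
    apply: lt_le_trans chi_t _; rewrite /s (big_rem e)//= lerDl.
    by apply: sumr_ge0 => i _.
  by rewrite /m ger0_norm; lra.
pose F e : E -> R[i] := fun t => (chi e t / m t)%:C%C * f t.
exists [seq F e | e <- D]; split.
  move=> _ /mapP[e _ ->]; split.
    apply: (Sigma_c_mul (h := fun t => (chi e t / m t)%:C%C)); last exact: Sf.
      apply: contC_real => t; apply: cvgM; first exact: cchi.
      by apply: cvgV; [rewrite gt_eqF|exact: cm].
    by move=> z t cz; rewrite /m /s /chi /= pi_act.
  have [_ _ _ [bU cL LU YL]] := YP e.
  exists (Y e).2.1, (Y e).2.2; split => // t; rewrite /F => Ft.
  by apply: YL; apply: contra_neq Ft => h; rewrite /chi /= h mul0r mul0r.
apply/funext => t; rewrite big_map fct_sumE /F.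
have [->|/fK Kt] := eqVneq (f t) 0.
  by rewrite big1// => e _; rewrite mulr0.
rewrite -mulr_suml -rmorph_sum/= -mulr_suml -/(s t) mE// divff ?mul1r//.
by rewrite -mE// gt_eqF.
Qed.

Lemma elementary_col f : elementary f -> forall e c,
  src e = src c -> f e != 0 -> f c != 0 -> pi e = pi c.
Proof.
move=> [_ [U [K [[_ sU _] _ KU fK]]]] e c ec fe fc.
by apply: sU; rewrite ?inE; [exact: KU (fK _ _)|exact: KU (fK _ _)|exact/src_pi_eq].
Qed.

Lemma elementary_row f : elementary f -> forall e c,
  rng e = rng c -> f e != 0 -> f c != 0 -> pi e = pi c.
Proof.
move=> [_ [U [K [[_ _ rU] _ KU fK]]]] e c ec fe fc.
by apply: rU; rewrite ?inE; [exact: KU (fK _ _)|exact: KU (fK _ _)|exact/rng_pi_eq].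
Qed.

Lemma sum_neq0 (I : eqType) (r : seq I) (F : I -> R[i]) :
  \sum_(i <- r) F i != 0 -> exists2 i, i \in r & F i != 0.
Proof.
move=> h; apply: contrapT => hn; move/eqP: h; apply.
apply: big1_seq => i /andP[_ ir]; apply/eqP; apply: contra_notT hn => Fi.
by exists i.
Qed.

Lemma finite_pi (P : E -> (E -> R[i]) -> Prop) (fs : seq (E -> R[i])) :
  (forall g, g \in fs -> forall c c', P c g -> P c' g -> pi c = pi c') ->
  exists K : seq G, forall c g, g \in fs -> P c g -> pi c \in K.
Proof.
elim: fs => [|g fs IH] h; first by exists [::].
have [|K hK] := IH; first by move=> g' g'fs; apply: h; rewrite inE g'fs orbT.
have [[c Pc]|nP] := pselect (exists c, P c g).
  exists (pi c :: K) => c' g'; rewrite !inE => /predU1P[->|g'fs] Pc'.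
    by rewrite (h g _ c' c)// ?eqxx// mem_head.
  by rewrite (hK c' g')// orbT.
exists K => c' g'; rewrite inE => /predU1P[->|]; last exact: hK.
by move=> Pc'; case: nP; exists c'.
Qed.

Lemma finite_row f : Sigma_c f -> forall e, exists K : seq G,
  forall c, src c = src e -> f (gmul e (ginv c)) != 0 -> pi c \in K.
Proof.
move=> /fragmentation[fs [hfs ->]] e.
have [|K hK] := @finite_pi (fun c g => src c = src e /\ g (gmul e (ginv c)) != 0) fs.
  move=> g /hfs eg c c' [sc gc] [sc' gc'].
  have := elementary_row eg _ gc gc'; rewrite !rng_div// => /(_ erefl) h.
  have := congr1 (fun x => gmul (ginv x) (pi e)) h.
  rewrite !pi_mul; try exact: composable_div.
  rewrite !pi_inv !gpd_invD ?gpd_divK//; try exact/src_pi_eq.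
exists K => c sc; rewrite fct_sumE => /sum_neq0[g gfs gc].
exact: hK gfs _.
Qed.

Lemma finite_col f : Sigma_c f -> forall x : E, exists K : seq G,
  forall c, src c = x -> f c != 0 -> pi c \in K.
Proof.
move=> /fragmentation[fs [hfs ->]] x.
have [|K hK] := @finite_pi (fun c g => src c = x /\ g c != 0) fs.
  move=> g /hfs eg c c' [sc gc] [sc' gc'].
  by apply: (elementary_col eg) => //; rewrite sc sc'.
exists K => c sc; rewrite fct_sumE => /sum_neq0[g gfs gc].
exact: hK gfs _.
Qed.

End Fragmentation.

(** * Integration over the fibres *)

Lemma finite_enum (T : eqType) (P : T -> Prop) (N : nat) :
  (forall s : seq T, uniq s -> (forall t, t \in s -> P t) -> (size s <= N)%N) ->
  exists s : seq T, [/\ uniq s, (forall t, t \in s -> P t) & forall t, P t -> t \in s].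
Proof.
move=> hN.
pose Q n := `[< exists s : seq T, [/\ uniq s, (forall t, t \in s -> P t) & size s = n] >].
have ex : exists n, Q n by exists 0%N; apply/asboolP; exists [::].
have bd n : Q n -> (n <= N)%N by move=> /asboolP[s [us sP <-]]; exact: hN.
case: (ex_maxnP ex bd) => n /asboolP[s [us sP sn]] nmax.
exists s; split => // t Pt; apply: contraT => ts.
have : Q n.+1.
  apply/asboolP; exists (t :: s); rewrite /= ts us sn; split => // u.
  by rewrite inE => /predU1P[->|/sP].
by move=> /nmax; rewrite ltnn.
Qed.

Section FibreIntegral.
Variables (R : realType) (G : topGroupoid) (E : twist R G).
Hypothesis Ghaus : hausdorff_space G.
Implicit Types (x g : G) (e : E).
Local Notation pi := (@tw_pi _ _ E).
Local Notation lift := (tw_lift E).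

Lemma haar_circle : haar (@circle R : set (borelC R)) = 1%E.
Proof.
rewrite /haar /pushforward /mrestr.
rewrite (_ : _ @^-1` _ = setT).
  by rewrite setTI lebesgue_measure_itv/= lte_fin ltr01 oppr0 adde0.
apply/seteqP; split => // t _ /=; apply/circle_nc.
by rewrite /expi2pi /= cos2Dsin2 sqrtr1.
Qed.

Definition fibre g : set E := pi @^-1` [set g].

Lemma src_fibreE x e : src_fibre E x e <-> src (pi e) = x.
Proof. by rewrite /src_fibre /= pi_src. Qed.

Lemma closed_measurable x (A : set E) : closed A ->
  measurable (A : set (fibre_space E x)).
Proof.
move=> clA; rewrite -[X in measurable X]setCK; apply: measurableC.
by apply: sub_sigma_algebra; exact: closed_openC.
Qed.

Lemma continuous_measurable x (h : E -> R) : continuous h ->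
  measurable_fun setT (h : fibre_space E x -> R).
Proof.
move=> ch; apply: (measurability _ (RGenOInfty.measurableE R)) => _ [_ [a ->] <-].
rewrite setTI; apply: sub_sigma_algebra.
by move/continuousP : ch; apply; exact: interval_open.
Qed.

Lemma measurable_fibre x g : measurable (fibre g : set (fibre_space E x)).
Proof.
apply: closed_measurable; apply: closed_comp.
  by move=> e _; exact: tw_pi_continuous.
by apply: accessible_closed_set1; exact: hausdorff_accessible.
Qed.

Lemma nu_fibre x g : src g = x -> nu E x (fibre g) = 1%E.
Proof.
move=> gx; rewrite /nu esum_mkcond.
transitivity (\esum_(h in [set g]) (1 : \bar R))%E; last by rewrite esum_set1.
rewrite [RHS]esum_mkcond; apply: eq_esum => h _.
have [->|hg] := eqVneq h g.
  rewrite !mem_set//=.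
  rewrite -haar_circle; congr haar; apply/seteqP; split => [z []//|z cz].
  by split => //=; rewrite /fibre /= pi_act// pi_lift.
rewrite [X in _ = if X then _ else _]memNset; last first.
  by move=> /= hh; rewrite hh eqxx in hg.
case: ifP => // _; rewrite (_ : _ `&` _ = set0) ?measure0// -subset0 => z [cz].
by rewrite /fibre /= pi_act// pi_lift => /eqP; rewrite (negPf hg).
Qed.

Definition invariant_fun (F : E -> R) := forall z e, circle z -> F (tw_act z e) = F e.

Lemma integral_fibre x g (F : E -> R) : src g = x -> invariant_fun F ->
  (\int[nu E x]_(e in (fibre g : set (fibre_space E x))) (F e)%:E = (F (lift g))%:E)%E.
Proof.
move=> gx iF.
rewrite (eq_integral (cst (F (lift g))%:E)); last first.
  move=> e; rewrite inE => eg; congr EFin.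
  by have [z cz ->] := lift_fibre e; rewrite iF// (_ : pi e = g).
rewrite -[RHS]mule1 -(nu_fibre gx).
by apply: integral_cst; exact: measurable_fibre.
Qed.

Lemma fibre_trivIset (s : seq G) : trivIset [set` s] fibre.
Proof.
by move=> g h _ _ [e [/= eg eh]]; rewrite -[LHS]eg -[RHS]eh.
Qed.

Lemma integral_fibres x (s : seq G) (F : E -> R) : uniq s ->
  (forall g, g \in s -> src g = x) -> invariant_fun F -> (forall e, 0 <= F e) ->
  measurable_fun setT (F : fibre_space E x -> R) ->
  (\int[nu E x]_(e in (\big[setU/set0]_(g <- s) fibre g : set (fibre_space E x)))
    (F e)%:E = (\sum_(g <- s) F (lift g))%:E)%E.
Proof.
move=> us sx iF F0 mF; rewrite ge0_integral_bigsetU//.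
- rewrite -sumEFin; apply: eq_big_seq => g gs.
  by rewrite integral_fibre// sx.
- by move=> g; exact: measurable_fibre.
- exact: fibre_trivIset.
- by apply/measurable_EFinP; exact: measurable_funTS.
- by move=> e _; rewrite lee_fin.
Qed.

(** The fibre over a unit may be uncountable and the measure on it not
    sigma-finite, so the integral is compared with its finite partial sums. *)
Lemma integral_leP x (F : E -> R) (M : R) : invariant_fun F -> (forall e, 0 <= F e) ->
  (forall e, ~ src_fibre E x e -> F e = 0) ->
  measurable_fun setT (F : fibre_space E x -> R) ->
  (\int[nu E x]_e (F e)%:E <= M%:E)%E <->
  forall s : seq G, uniq s -> (forall g, g \in s -> src g = x) ->
    \sum_(g <- s) F (lift g) <= M.
Proof.
move=> iF F0 Foff mF.
have mFE (A : set (fibre_space E x)) : measurable_fun A (fun e : fibre_space E x => (F e)%:E).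
  by apply/measurable_EFinP; exact: measurable_funTS.
have mU (s : seq G) : measurable (\big[setU/set0]_(g <- s) fibre g : set (fibre_space E x)).
  by apply: bigsetU_measurable => g _; exact: measurable_fibre.
split=> [h s us sx|h].
  rewrite -lee_fin -(@integral_fibres x)//; apply: le_trans h.
  by apply: ge0_subset_integral => //= e _; rewrite lee_fin.
pose d n : R := n.+1%:R^-1.
pose D n : set (fibre_space E x) := [set e | d n < F e].
have mD n : measurable (D n).
  rewrite (_ : D n = F @^-1` `]d n, +oo[); last first.
    by apply/seteqP; split => e; rewrite /D /= in_itv/= andbT.
  by rewrite -[X in measurable X]setTI; exact: mF.
have d0 n : 0 < d n by rewrite invr_gt0.
have M0 : 0 <= M by have := h [::] isT; rewrite big_nil; exact.
have key n : (\int[nu E x]_(e in D n) (F e)%:E <= M%:E)%E.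
  have [|s [us sP sD]] := @finite_enum _ (fun g : G => src g = x /\ d n < F (lift g))
      (Num.bound (M / d n)).
    move=> s us sP; rewrite -(ler_nat R); apply: le_trans (ltW (archi_boundP _)).
      rewrite ler_pdivlMr//; apply: le_trans (h s us (fun g gs => (sP g gs).1)).
      have -> : (size s)%:R * d n = \sum_(g <- s) d n.
        by rewrite big_const_seq count_predT iter_addr_0 mulr_natl.
      rewrite big_seq [leRHS]big_seq.
      by apply: ler_sum => g /sP[_ /ltW].
    by rewrite divr_ge0// ltW.
  apply: le_trans (_ : _ <= (\sum_(g <- s) F (lift g))%:E)%E _; last first.
    by rewrite lee_fin; apply: h => // g /sP[].
  rewrite -(@integral_fibres x)//; last by move=> g /sP[].
  apply: ge0_subset_integral => //=; first by move=> e _; rewrite lee_fin.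
  move=> e De; rewrite -bigcup_seq; exists (pi e) => //=; apply: sD.
  have Fe : F (lift (pi e)) = F e.
    by have [z cz {2}->] := lift_fibre e; rewrite iF.
  rewrite Fe; split => //; apply/src_fibreE; apply: contrapT => /Foff Fe0.
  by move: De; rewrite /D /= Fe0 ltNge ltW.
have -> : (\int[nu E x]_e (F e)%:E = \int[nu E x]_(e in \bigcup_n D n) (F e)%:E)%E.
  rewrite [RHS]integral_mkcond; apply: eq_integral => e _.
  rewrite /patch; case: ifPn => //; rewrite notin_setE => nD.
  congr EFin; apply: le_anti; rewrite F0 andbT leNgt; apply/negP => Fe0.
  apply: nD; exists (Num.bound (F e)^-1) => //; rewrite /D /= /d.
  rewrite invf_plt ?posrE//; apply: lt_trans (archi_boundP _) _; last by rewrite ltr_nat.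
  by rewrite invr_ge0 ltW.
have nd : nondecreasing_seq D.
  move=> m n mn; apply/subsetPset => e; rewrite /D /=; apply: le_lt_trans.
  by rewrite /d lef_pV2 ?posrE// ler_nat.
have cv := @ge0_nondecreasing_set_cvg_integral _ _ _ D (fun e : fibre_space E x => (F e)%:E) (nu E x) nd mD
  (fun n => mFE (D n)) (fun n e _ => F0 e).
rewrite -(cvg_lim _ cv)//; apply: lime_le.
  by apply/cvg_ex; eexists; exact: cv.
by near=> n; exact: key.
Unshelve. all: by end_near. Qed.

End FibreIntegral.
Arguments fibre {R G} E g _.

Section FiniteIntegral.
Variables (R : realType) (G : topGroupoid) (E : twist R G).
Hypothesis Ghaus : hausdorff_space G.
Implicit Types (x g : G) (e : E).
Local Notation pi := (@tw_pi _ _ E).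
Local Notation lift := (tw_lift E).

Definition cut (K : seq G) (F : E -> R) e : R := if pi e \in K then F (lift (pi e)) else 0.

Lemma cut_indic K F : uniq K ->
  cut K F = fun e => \sum_(g <- K) F (lift g) * \1_(fibre E g) e.
Proof.
move=> uK; apply/funext => e; rewrite /cut; case: ifPn => eK.
  rewrite (bigD1_seq (pi e))//= big1 ?addr0.
    by rewrite indicE mem_set ?mulr1.
  by move=> g ge; rewrite indicE memNset ?mulr0// => eg; case/eqP: ge.
rewrite big_seq big1// => g gK; rewrite indicE memNset ?mulr0// => eg.
by move: eK; rewrite (eg : pi e = g) gK.
Qed.

Lemma measurable_cut x K F : uniq K ->
  measurable_fun setT (cut K F : fibre_space E x -> R).
Proof.
move=> uK; rewrite cut_indic//.
apply: (@measurable_sum _ _ _ _ _ _ (fun g (e : fibre_space E x) => F (lift g) * \1_(fibre E g) e)).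
move=> g; apply: measurable_funM => //.
by apply: measurable_indic; exact: measurable_fibre.
Qed.

Lemma cut_invariant K F : invariant_fun (cut K F).
Proof. by move=> z e cz; rewrite /cut pi_act. Qed.

Lemma integral_cut_ge0 x K F : uniq K -> (forall g, g \in K -> src g = x) ->
  (forall e, 0 <= F e) ->
  (\int[nu E x]_e (cut K F (e : fibre_space E x))%:E = (\sum_(g <- K) F (lift g))%:E)%E.
Proof.
move=> uK Kx F0.
have c0 e : 0 <= cut K F e by rewrite /cut; case: ifP.
transitivity (\int[nu E x]_(e in (\big[setU/set0]_(g <- K) fibre E g : set (fibre_space E x)))
    (cut K F e)%:E)%E.
  rewrite [RHS]integral_mkcond; apply: eq_integral => e _.
  rewrite /patch; case: ifPn => //; rewrite notin_setE => nD; congr EFin.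
  rewrite /cut; case: ifPn => // eK; case: nD.
  by rewrite -bigcup_seq; exists (pi e).
rewrite integral_fibres//; last 2 first.
- exact: cut_invariant.
- exact: measurable_cut.
congr EFin; apply: eq_big_seq => g gK.
by rewrite /cut pi_lift gK.
Qed.

Lemma Rintegral_cut x K F : uniq K -> (forall g, g \in K -> src g = x) ->
  (forall z e, src_fibre E x e -> circle z -> F (tw_act z e) = F e) ->
  (forall e, src_fibre E x e -> pi e \notin K -> F e = 0) ->
  Rintegral (nu E x) (src_fibre E x) F = \sum_(g <- K) F (lift g).
Proof.
move=> uK Kx iF FK; rewrite /Rintegral integral_mkcond.
pose Fp := cut K (fun e => Num.max (F e) 0); pose Fn := cut K (fun e => Num.max (- F e) 0).
have FE : ((fun e : fibre_space E x => (F e)%:E) \_ (src_fibre E x) =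
    (fun e : fibre_space E x => (cut K F e)%:E))%E.
  apply/funext => e; rewrite /patch /cut.
  case: ifPn => [/set_mem ex|]; last first.
    rewrite notin_setE => nex; case: ifPn => // /Kx ex.
    by case: nex; apply/src_fibreE.
  have Fl : F (lift (pi e)) = F e.
    have [z cz {2}->] := lift_fibre e; rewrite iF//.
    by apply/src_fibreE; rewrite pi_lift; apply/src_fibreE.
  by case: ifPn => [_|nK]; rewrite ?Fl// FK.
rewrite FE integralE.
have -> : ((fun e : fibre_space E x => (cut K F e)%:E)^\+ = (fun e : fibre_space E x => (Fp e)%:E))%E.
  apply/funext => e; rewrite funeposE /Fp /cut; case: ifP => _; last by rewrite maxxx.
  by rewrite EFin_max.
have -> : ((fun e : fibre_space E x => (cut K F e)%:E)^\- = (fun e : fibre_space E x => (Fn e)%:E))%E.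
  apply/funext => e; rewrite funenegE /Fn /cut; case: ifP => _; last by rewrite oppe0 maxxx.
  by rewrite EFin_max.
rewrite !integral_cut_ge0//; try by move=> e; rewrite le_max lexx orbT.
rewrite /= -sumrB; apply: eq_bigr => g _.
by have [h|h] := leP 0 (F (lift g)); rewrite /Num.max; case: ltgtP; lra.
Qed.

Lemma cintegral_cut x K (h : E -> R[i]) : uniq K -> (forall g, g \in K -> src g = x) ->
  (forall z e, src_fibre E x e -> circle z -> h (tw_act z e) = h e) ->
  (forall e, src_fibre E x e -> pi e \notin K -> h e = 0) ->
  cintegral (nu E x) (src_fibre E x) h = \sum_(g <- K) h (lift g).
Proof.
move=> uK Kx ih hK; rewrite /cintegral !(@Rintegral_cut x K)//.
- apply/eqP; rewrite eq_complex /=; apply/andP; split; apply/eqP.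
    by rewrite raddf_sum.
  by rewrite raddf_sum.
- by move=> z e ex cz; rewrite ih.
- by move=> e ex eK; rewrite hK.
- by move=> z e ex cz; rewrite ih.
- by move=> e ex eK; rewrite hK.
Qed.

End FiniteIntegral.

(** * The spaces [L^p] of the fibres *)

Section LpSpaces.
Variables (R : realType) (p : R) (G : topGroupoid) (E : twist R G).
Hypotheses (p1 : 1 <= p) (Glc : locally_compact [set: G]) (Ghaus : hausdorff_space G).
Implicit Types (x g : G) (e : E) (xi eta : E -> R[i]).
Local Notation pi := (@tw_pi _ _ E).
Local Notation lift := (tw_lift E).

Let p0 : 0 < p. Proof. exact: lt_le_trans ltr01 p1. Qed.

Definition pbounded x xi (M : R) := forall s : seq G, uniq s ->
  (forall g, g \in s -> src g = x) -> \sum_(g <- s) nc (xi (lift g)) `^ p <= M.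

Definition off_fibre x xi := forall e, ~ src_fibre E x e -> xi e = 0.

Lemma measurable_nc x xi :
  measurable_fun setT (fun e : fibre_space E x => complex.Re (xi e)) ->
  measurable_fun setT (fun e : fibre_space E x => complex.Im (xi e)) ->
  measurable_fun setT (fun e : fibre_space E x => nc (xi e)).
Proof.
move=> mr mi.
have -> : (fun e : fibre_space E x => nc (xi e)) =
    (fun y : R => y `^ 2^-1) \o (fun e => complex.Re (xi e) ^+ 2 + complex.Im (xi e) ^+ 2).
  by apply/funext => e /=; rewrite powR12_sqrt ?addr_ge0 ?sqr_ge0//; case: (xi e).
apply: measurableT_comp; first exact: measurable_powR.
by apply: measurable_funD; apply: measurable_funX.
Qed.

Lemma lift_nc xi e : equivariant xi -> nc (xi (lift (pi e))) = nc (xi e).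
Proof. by move=> exi; have [z cz {2}->] := lift_fibre e; rewrite exi// nc_circleM. Qed.

Lemma Lp_norm_leP x xi (r : R) : off_fibre x xi -> equivariant xi ->
  measurable_fun setT (fun e : fibre_space E x => complex.Re (xi e)) ->
  measurable_fun setT (fun e : fibre_space E x => complex.Im (xi e)) -> 0 <= r ->
  (Lp_norm p x xi <= r%:E)%E <-> pbounded x xi (r `^ p).
Proof.
move=> xoff exi mr mi r0.
have mn := measurable_nc mr mi.
have -> : (Lp_norm p x xi <= r%:E)%E <-> (Lp_norm p x xi `^ p <= (r `^ p)%:E)%E.
  have N0 : (0 <= Lp_norm p x xi)%E by exact: Lnorm_ge0.
  move: N0; case: (Lp_norm p x xi) => [t| |]//=.
    rewrite !lee_fin => t0.
    split=> h; first by apply: ge0_ler_powR => //; rewrite ?nnegrE// ltW.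
    rewrite leNgt; apply/negP => rt.
    suff : r `^ p < t `^ p by rewrite ltNge h.
    by apply: gt0_ltr_powR => //; rewrite ?nnegrE.
  by rewrite gt_eqF.
rewrite /Lp_norm poweR_Lnorm ?gt_eqF//.
have -> : (\int[nu E x]_e (`|(nc (xi e))%:E| `^ p) =
    \int[nu E x]_e ((fun e : E => nc (xi e) `^ p) e)%:E)%E.
  by apply: eq_integral => e _; rewrite gee0_abs ?lee_fin ?nc_ge0.
rewrite integral_leP//.
- by move=> z e cz /=; rewrite exi// nc_circleM.
- by move=> e; exact: powR_ge0.
- by move=> e /xoff ->; rewrite nc0 powR0// gt_eqF.
- by apply: (measurableT_comp (measurable_powR p)).
Qed.

Lemma off_src x xi e : off_fibre x xi -> xi e != 0 -> src (pi e) = x.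
Proof.
by move=> xoff xe; apply/src_fibreE; apply: contrapT => /xoff xe0; rewrite xe0 eqxx in xe.
Qed.

Lemma measurable_cutC x xi (K : seq G) : equivariant xi -> uniq K ->
  measurable_fun setT (fun e : fibre_space E x => complex.Re (if pi e \in K then xi e else 0)) /\
  measurable_fun setT (fun e : fibre_space E x => complex.Im (if pi e \in K then xi e else 0)).
Proof.
move=> exi uK.
have ex g : exists2 a : E -> R[i], Sigma_c a & a (lift g) = 1.
  have [a [U [K' [[Sa _ _ _ _] [a1 _ _]]]]] :=
    Sigma_bump Glc Ghaus (filterT : nbhs (lift g) setT).
  by exists a.
pose a g := sval (cid2 (ex g)).
have Sa g : Sigma_c (a g) by exact: (s2valP (cid2 (ex g))).
have a1 g : a g (lift g) = 1 by exact: (s2valP' (cid2 (ex g))).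
have E1 e : (if pi e \in K then xi e else 0) =
    \sum_(g <- K) (xi (lift g) * a g e) * (\1_(fibre E g) e : R)%:C%C.
  case: ifPn => eK.
    rewrite (bigD1_seq (pi e))//= big1 ?addr0.
      rewrite indicE mem_set// mulr1.
      have [z cz ez] := lift_fibre e.
      have [_ _ ea] := (Sigma_cP (a (pi e))).1 (Sa (pi e)).
      rewrite [in LHS]ez exi// [X in a _ X]ez.
      have [_ _ eqa] := Sa (pi e).
      by rewrite eqa// a1 mulr1 mulrC.
    by move=> g ge; rewrite indicE memNset ?mulr0// => eg; case/eqP: ge.
  rewrite big_seq big1// => g gK; rewrite indicE memNset ?mulr0// => eg.
  by move: eK; rewrite (eg : pi e = g) gK.
have ca g : continuous (fun e => xi (lift g) * a g e).
  by apply: contC_scale; have [] := Sa g.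
split.
- have -> : (fun e : fibre_space E x => complex.Re (if pi e \in K then xi e else 0)) =
      (fun e => \sum_(g <- K) complex.Re (xi (lift g) * a g e) * \1_(fibre E g) e).
    apply/funext => e; rewrite E1 raddf_sum; apply: eq_bigr => g _.
    by case: (xi _ * _) => u v /=; rewrite mulr0 subr0.
  apply: (@measurable_sum _ _ _ _ _ _ (fun g (e : fibre_space E x) =>
     complex.Re (xi (lift g) * a g e) * \1_(fibre E g) e)) => g.
  apply: measurable_funM; last by apply: measurable_indic; exact: measurable_fibre.
  apply: (@continuous_measurable _ _ _ x (fun e => complex.Re (xi (lift g) * a g e))) => e.
  by apply: (@continuous_comp _ _ _ (fun e => xi (lift g) * a g e) (fun z : R[i] => complex.Re z)); [exact: ca|exact: Re_continuous].
- have -> : (fun e : fibre_space E x => complex.Im (if pi e \in K then xi e else 0)) =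
      (fun e => \sum_(g <- K) complex.Im (xi (lift g) * a g e) * \1_(fibre E g) e).
    apply/funext => e; rewrite E1 raddf_sum; apply: eq_bigr => g _.
    by case: (xi _ * _) => u v /=; rewrite mulr0 add0r mulrC.
  apply: (@measurable_sum _ _ _ _ _ _ (fun g (e : fibre_space E x) =>
     complex.Im (xi (lift g) * a g e) * \1_(fibre E g) e)) => g.
  apply: measurable_funM; last by apply: measurable_indic; exact: measurable_fibre.
  apply: (@continuous_measurable _ _ _ x (fun e => complex.Im (xi (lift g) * a g e))) => e.
  by apply: (@continuous_comp _ _ _ (fun e => xi (lift g) * a g e) (fun z : R[i] => complex.Im z)); [exact: ca|exact: Im_continuous].
Qed.

(** Measurability is automatic: such a function is the pointwise limit of its
    restrictions to the finitely many fibres where it is not small. *)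
Lemma pbounded_measurable x xi M : off_fibre x xi -> equivariant xi -> pbounded x xi M ->
  measurable_fun setT (fun e : fibre_space E x => complex.Re (xi e)) /\
  measurable_fun setT (fun e : fibre_space E x => complex.Im (xi e)).
Proof.
move=> xoff exi xM.
pose d n : R := n.+1%:R^-1.
have d0 n : 0 < d n by rewrite invr_gt0.
have M0 : 0 <= M by have := xM [::] isT; rewrite big_nil; exact.
have ex n : exists s : seq G, [/\ uniq s,
    (forall g, g \in s -> src g = x /\ d n < nc (xi (lift g)) `^ p) &
    forall g, src g = x /\ d n < nc (xi (lift g)) `^ p -> g \in s].
  apply: (@finite_enum _ _ (Num.bound (M / d n))) => s us sP.
  rewrite -(ler_nat R); apply: le_trans (ltW (archi_boundP _)).
    rewrite ler_pdivlMr//; apply: le_trans (xM s us (fun g gs => (sP g gs).1)).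
    have -> : (size s)%:R * d n = \sum_(g <- s) d n.
      by rewrite big_const_seq count_predT iter_addr_0 mulr_natl.
    rewrite big_seq [leRHS]big_seq.
    by apply: ler_sum => g /sP[_ /ltW].
  by rewrite divr_ge0// ltW.
pose s n := sval (cid (ex n)).
have sP n := svalP (cid (ex n)).
have cv e : \forall n \near \oo, (if pi e \in s n then xi e else 0) = xi e.
  have [xe0|xe0] := eqVneq (xi e) 0; first by near=> n; case: ifP; rewrite ?xe0.
  have xe : 0 < nc (xi e) `^ p by rewrite powR_gt0// nc_gt0.
  near=> n; have [_ _ sn] := sP n.
  rewrite sn//; split; first exact: off_src xoff _.
  rewrite lift_nc// /d invf_plt ?posrE//.
  apply: lt_trans (archi_boundP _) _; first by rewrite invr_ge0 ltW.
  by rewrite ltr_nat ltnS; near: n; exact: nbhs_infty_ge.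
split.
- apply: (@measurable_fun_cvg _ _ _ _ (fun n (e : fibre_space E x) =>
    complex.Re (if pi e \in s n then xi e else 0))).
    by move=> n; have [us _ _] := sP n; have [] := measurable_cutC x exi us.
  move=> e _; apply: cvg_near_cst; apply: filterS (cv e) => n ->//.
- apply: (@measurable_fun_cvg _ _ _ _ (fun n (e : fibre_space E x) =>
    complex.Im (if pi e \in s n then xi e else 0))).
    by move=> n; have [us _ _] := sP n; have [] := measurable_cutC x exi us.
  move=> e _; apply: cvg_near_cst; apply: filterS (cv e) => n ->//.
Unshelve. all: by end_near. Qed.

Lemma LpP x xi :
  Lp p x xi <-> [/\ off_fibre x xi, equivariant xi & exists M, pbounded x xi M].
Proof.
split=> [[xoff exi mr mi xfin]|[xoff exi [M xM]]].
  split => //; exists (fine (Lp_norm p x xi) `^ p).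
  have N0 : (0 <= Lp_norm p x xi)%E by exact: Lnorm_ge0.
  by apply/Lp_norm_leP; rewrite ?fineK ?fine_ge0// ge0_fin_numE.
have [mr mi] := pbounded_measurable xoff exi xM.
have M0 : 0 <= M by have := xM [::] isT; rewrite big_nil; exact.
split => //; apply: (@le_lt_trans _ _ (M `^ p^-1)%:E); last by rewrite ltry.
apply/Lp_norm_leP => //; first exact: powR_ge0.
by rewrite -powRrM mulVf ?gt_eqF// powRr1.
Qed.

Definition Lpn x xi : R := fine (Lp_norm p x xi).

Lemma Lp_normE x xi : Lp p x xi -> Lp_norm p x xi = (Lpn x xi)%:E.
Proof.
move=> [_ _ _ _ xfin]; rewrite /Lpn fineK// ge0_fin_numE//.
exact: Lnorm_ge0.
Qed.

Lemma Lpn_ge0 x xi : 0 <= Lpn x xi.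
Proof. by apply: fine_ge0; exact: Lnorm_ge0. Qed.

Lemma Lpn_leP x xi r : Lp p x xi -> 0 <= r -> Lpn x xi <= r <-> pbounded x xi (r `^ p).
Proof.
move=> Lx r0; rewrite -lee_fin -Lp_normE//.
by have [? ? ? ? _] := Lx; apply: Lp_norm_leP.
Qed.

Lemma Lpn_sum x xi : Lp p x xi -> pbounded x xi (Lpn x xi `^ p).
Proof. by move=> Lx; apply/Lpn_leP => //; exact: Lpn_ge0. Qed.

Lemma powRp_le (a b : R) : 0 <= a -> 0 <= b -> (a `^ p <= b `^ p) = (a <= b).
Proof.
move=> a0 b0; apply/idP/idP => h.
  rewrite leNgt; apply/negP => ba.
  suff : b `^ p < a `^ p by rewrite ltNge h.
  by apply: gt0_ltr_powR => //; rewrite ?nnegrE.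
by apply: ge0_ler_powR => //; rewrite ?nnegrE// ltW.
Qed.

Lemma Lpn_eval x xi e : Lp p x xi -> nc (xi e) <= Lpn x xi.
Proof.
move=> Lx; have [/LpP[xoff exi _]] := (Lx, Lx) => _.
have [->|xe] := eqVneq (xi e) 0; first by rewrite nc0 Lpn_ge0.
rewrite -powRp_le ?nc_ge0 ?Lpn_ge0//.
have := Lpn_sum Lx (s := [:: pi e]) isT.
rewrite big_seq1 lift_nc//; apply => g; rewrite inE => /eqP ->.
exact: off_src xoff _.
Qed.

Lemma LpD x xi eta : Lp p x xi -> Lp p x eta ->
  Lp p x (xi + eta) /\ Lpn x (xi + eta) <= Lpn x xi + Lpn x eta.
Proof.
move=> Lx Ly; have [xoff exi mxr mxi xfin] := Lx.
have [yoff eyi myr myi yfin] := Ly.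
have mr : measurable_fun setT (fun e : fibre_space E x => complex.Re ((xi + eta) e)).
  rewrite (_ : (fun e : fibre_space E x => _) = fun e => complex.Re (xi e) + complex.Re (eta e)).
    exact: measurable_funD.
  by apply/funext => e; rewrite fctE raddfD.
have mi : measurable_fun setT (fun e : fibre_space E x => complex.Im ((xi + eta) e)).
  rewrite (_ : (fun e : fibre_space E x => _) = fun e => complex.Im (xi e) + complex.Im (eta e)).
    exact: measurable_funD.
  by apply/funext => e; rewrite fctE raddfD.
have mnx := measurable_nc mxr mxi; have mny := measurable_nc myr myi.
have le : (Lp_norm p x (xi + eta)%R <= (Lpn x xi + Lpn x eta)%:E)%E.
  rewrite EFinD -!Lp_normE//.
  apply: le_trans (@minkowski_EFin _ _ _ (nu E x) _ _ p mnx mny p1).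
  rewrite /Lp_norm unlock /Lnorm.
  have mono (a b : \bar R) : (0 <= a -> a <= b -> a `^ p^-1 <= b `^ p^-1)%E.
    move=> a0 ab; apply: gt0_ler_poweR => //; rewrite ?invr_ge0 ?ltW//= in_itv/= leey andbT//.
    exact: le_trans a0 ab.
  apply: mono; first by apply: integral_ge0 => e _; exact: poweR_ge0.
  apply: ge0_le_integral => //.
  - by move=> e _; exact: poweR_ge0.
  - have -> : (fun e : fibre_space E x => `|(nc ((xi + eta)%R e))%:E| `^ p)%E =
        (fun e : fibre_space E x => (nc ((xi + eta) e) `^ p)%:E).
      by apply/funext => e; rewrite gee0_abs ?lee_fin ?nc_ge0.
    apply/measurable_EFinP.
    by apply: (measurableT_comp (measurable_powR p)); exact: measurable_nc.
  - have -> : (fun e : fibre_space E x => `|((fun e => nc (xi e)) \+ (fun e => nc (eta e))) e|%:E `^ p)%E =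
        (fun e : fibre_space E x => ((nc (xi e) + nc (eta e)) `^ p)%:E).
      by apply/funext => e; rewrite /= ger0_norm// addr_ge0 ?nc_ge0.
    apply/measurable_EFinP.
    by apply: (measurableT_comp (measurable_powR p)); exact: measurable_funD.
  - move=> e _; rewrite /= !ger0_norm ?addr_ge0 ?nc_ge0// lee_fin.
    apply: ge0_ler_powR; rewrite ?nnegrE ?addr_ge0 ?nc_ge0 ?(ltW p0)//.
    exact: ncD.
have Lxy : Lp p x (xi + eta).
  split => //.
  - by move=> e ne; rewrite fctE xoff// yoff// addr0.
  - by move=> z e cz; rewrite fctE exi// eyi// mulrDr.
  - by apply: le_lt_trans le _; rewrite ltry.
by split => //; rewrite -lee_fin -Lp_normE.
Qed.

Lemma LpZ x k xi : Lp p x xi ->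
  Lp p x (fun e => k * xi e) /\ Lpn x (fun e => k * xi e) <= nc k * Lpn x xi.
Proof.
move=> Lx; have [/LpP[xoff exi _]] := (Lx, Lx) => _.
have b : pbounded x (fun e => k * xi e) ((nc k * Lpn x xi) `^ p).
  move=> s us sx; rewrite powRM ?nc_ge0 ?Lpn_ge0//.
  apply: le_trans (ler_wpM2l (powR_ge0 _ _) (Lpn_sum Lx us sx)).
  by rewrite mulr_sumr; apply: ler_sum => g _; rewrite ncM powRM ?nc_ge0.
have Lk : Lp p x (fun e => k * xi e).
  apply/LpP; split; last by eexists; exact: b.
  - by move=> e ne; rewrite xoff// mulr0.
  - by move=> z e cz; rewrite exi// mulrCA.
split => //; apply/Lpn_leP => //.
by rewrite mulr_ge0 ?nc_ge0 ?Lpn_ge0.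
Qed.

Lemma Lp0 x : Lp p x (fun _ : E => 0) /\ Lpn x (fun _ : E => 0) = 0.
Proof.
have b r : 0 <= r -> pbounded x (fun _ : E => 0) (r `^ p).
  move=> r0 s _ _; rewrite big1 ?powR_ge0// => g _.
  by rewrite nc0 powR0// gt_eqF.
have L0 : Lp p x (fun _ : E => 0).
  apply/LpP; split => //; last by exists (0 `^ p); exact: b.
  by move=> z e _; rewrite mulr0.
split => //; apply/eqP; rewrite eq_le Lpn_ge0 andbT.
by apply/Lpn_leP => //; exact: b.
Qed.

End LpSpaces.

(** * Convolution operators *)

Section Lambda.
Variables (R : realType) (p : R) (G : topGroupoid) (E : twist R G).
Hypotheses (p1 : 1 <= p) (Glc : locally_compact [set: G]) (Ghaus : hausdorff_space G).
Implicit Types (x : G) (e c : E) (f xi eta : E -> R[i]).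
Local Notation pi := (@tw_pi _ _ E).
Local Notation lift := (tw_lift E).

Let p0 : 0 < p. Proof. exact: lt_le_trans ltr01 p1. Qed.

Lemma lambda_off x f xi e : ~ src_fibre E x e -> lambda x f xi e = 0.
Proof. by move=> ne; rewrite /lambda memNset. Qed.

Lemma lambda_term_act f xi e c z : equivariant f -> equivariant xi ->
  src c = src e -> circle z ->
  f (gmul e (ginv (tw_act z c))) * xi (tw_act z c) = f (gmul e (ginv c)) * xi c.
Proof.
move=> ef ex ce cz; have cz' := circleV cz.
rewrite inv_act// act_mulr//; last by rewrite /composable rngV.
by rewrite ef// ex// mulrACA mulVf ?circle_neq0// mul1r.
Qed.

Lemma src_fibre_src x e c : src_fibre E x e -> src_fibre E x c -> src c = src e.
Proof. by move=> /src_fibreE ex /src_fibreE cx; apply/src_pi_eq; rewrite cx. Qed.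

Lemma lift_src x e g : src_fibre E x e -> src g = x -> src (lift g) = src e.
Proof.
by move=> ex gx; apply: (src_fibre_src ex); apply/src_fibreE; rewrite pi_lift.
Qed.

Lemma lambda_sumE x f xi e (K : seq G) : equivariant f -> equivariant xi ->
  src_fibre E x e -> uniq K -> (forall g, g \in K -> src g = x) ->
  (forall c, src_fibre E x c -> pi c \notin K -> f (gmul e (ginv c)) * xi c = 0) ->
  lambda x f xi e = \sum_(g <- K) f (gmul e (ginv (lift g))) * xi (lift g).
Proof.
move=> ef exi ex uK Kx hK; rewrite /lambda mem_set//.
apply: (@cintegral_cut _ _ _ Ghaus x K (fun c => f (gmul e (ginv c)) * xi c)) => // z c cx cz.
by apply: lambda_term_act => //; exact: src_fibre_src ex cx.
Qed.

Lemma rowset f e : Sigma_c f -> exists K : seq G,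
  [/\ uniq K, (forall g, g \in K -> src g = src (pi e)) &
    forall c, src c = src e -> pi c \notin K -> f (gmul e (ginv c)) = 0].
Proof.
move=> Sf; have [K hK] := finite_row Glc Ghaus Sf e.
exists (undup [seq g <- K | src g == src (pi e)]); split; first exact: undup_uniq.
  by move=> g; rewrite mem_undup mem_filter => /andP[/eqP].
move=> c ce; rewrite mem_undup mem_filter => h; apply/eqP; apply: contraNT h => h.
by rewrite (hK c)// andbT; apply/eqP/src_pi_eq.
Qed.

Lemma colset f x : Sigma_c f -> exists K : seq G,
  [/\ uniq K, (forall g, g \in K -> src g = x) &
    forall c, src_fibre E x c -> pi c \notin K -> f c = 0].
Proof.
move=> Sf.
have [[c0 c0x]|nx] := pselect (exists c0, src_fibre E x c0); last first.
  by exists [::]; split => // c cx; case: nx; exists c.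
have [K hK] := finite_col Glc Ghaus Sf (src c0).
exists (undup [seq g <- K | src g == x]); split; first exact: undup_uniq.
  by move=> g; rewrite mem_undup mem_filter => /andP[/eqP].
move=> c cx; rewrite mem_undup mem_filter => h; apply/eqP; apply: contraNT h => h.
rewrite (hK c)// ?andbT; last exact: src_fibre_src c0x cx.
by apply/eqP/src_fibreE.
Qed.

Lemma lambda_row x f xi e K : Sigma_c f -> equivariant xi ->
  src_fibre E x e -> uniq K -> (forall g, g \in K -> src g = x) ->
  (forall c, src c = src e -> pi c \notin K -> f (gmul e (ginv c)) = 0) ->
  lambda x f xi e = \sum_(g <- K) f (gmul e (ginv (lift g))) * xi (lift g).
Proof.
move=> Sf exi ex uK Kx hK; apply: lambda_sumE => //; first by have [] := Sf.
by move=> c cx cK; rewrite hK ?mul0r//; exact: src_fibre_src ex cx.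
Qed.

Lemma lambda_equivariant x f xi : Sigma_c f -> equivariant xi -> equivariant (lambda x f xi).
Proof.
move=> Sf exi z e cz; have [_ _ ef] := Sf.
have [ex|nex] := pselect (src_fibre E x e); last first.
  rewrite !lambda_off ?mulr0// => /src_fibreE; rewrite pi_act// => h.
  by apply: nex; apply/src_fibreE.
have zex : src_fibre E x (tw_act z e) by apply/src_fibreE; rewrite pi_act//; apply/src_fibreE.
have [K [uK Kx hK]] := rowset e Sf.
have Kx' g : g \in K -> src g = x by move=> /Kx ->; apply/src_fibreE.
have fz c : src c = src e -> f (gmul (tw_act z e) (ginv c)) = z * f (gmul e (ginv c)).
  by move=> ce; rewrite act_mull ?ef//; rewrite /composable rngV.
rewrite !(@lambda_row x f xi _ K)//; last first.
  by move=> c; rewrite src_act// => ce cK; rewrite fz// hK ?mulr0.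
rewrite mulr_sumr; apply: eq_big_seq => g gK.
by rewrite fz ?mulrA//; apply: lift_src ex (Kx' _ gK).
Qed.

Lemma lambdaDl x f g xi : Sigma_c f -> Sigma_c g -> equivariant xi ->
  lambda x (f + g) xi = lambda x f xi + lambda x g xi.
Proof.
move=> Sf Sg exi; apply/funext => e; rewrite addCE.
have [ex|nex] := pselect (src_fibre E x e); last by rewrite !lambda_off ?addr0.
have [K [uK Kx hK]] := rowset e Sf; have [L [uL Lx hL]] := rowset e Sg.
have xe : src (pi e) = x by apply/src_fibreE.
pose M := undup (K ++ L).
have uM : uniq M by exact: undup_uniq.
have Mx h : h \in M -> src h = x.
  by rewrite mem_undup mem_cat => /orP[/Kx|/Lx]; rewrite xe.
have MK c : pi c \notin M -> pi c \notin K /\ pi c \notin L.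
  by rewrite mem_undup mem_cat negb_or => /andP[].
rewrite (@lambda_row x f xi e M)//; last by move=> c ce /MK[cK _]; rewrite hK.
rewrite (@lambda_row x g xi e M)//; last by move=> c ce /MK[_ cL]; rewrite hL.
rewrite (@lambda_row x (f + g) xi e M)//; first last.
- by move=> c ce /MK[cK cL]; rewrite addCE hK// hL// addr0.
- exact: Sigma_cD.
by rewrite -big_split/=; apply: eq_bigr => h _; rewrite addCE mulrDl.
Qed.

Lemma lambdaZl x k f xi : Sigma_c f -> equivariant xi ->
  lambda x (k *: f) xi = fun e => k * lambda x f xi e.
Proof.
move=> Sf exi; apply/funext => e.
have [ex|nex] := pselect (src_fibre E x e); last by rewrite !lambda_off ?mulr0.
have [K [uK Kx hK]] := rowset e Sf.
have xe : src (pi e) = x by apply/src_fibreE.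
rewrite xe in Kx; rewrite !(@lambda_row x _ xi e K)//.
- by rewrite mulr_sumr; apply: eq_bigr => h _; rewrite scaleCE mulrA.
- exact: Sigma_cZ.
- by move=> c ce cK; rewrite scaleCE hK// mulr0.
Qed.

Lemma lambdaDr x f xi eta : Sigma_c f -> equivariant xi -> equivariant eta ->
  lambda x f (xi + eta) = lambda x f xi + lambda x f eta.
Proof.
move=> Sf exi eeta; apply/funext => e; rewrite addCE.
have [ex|nex] := pselect (src_fibre E x e); last by rewrite !lambda_off ?addr0.
have [K [uK Kx hK]] := rowset e Sf.
have xe : src (pi e) = x by apply/src_fibreE.
rewrite xe in Kx; rewrite !(@lambda_row x _ _ e K)//.
- by rewrite -big_split/=; apply: eq_bigr => h _; rewrite addCE mulrDr.
- by move=> z c cz; rewrite addCE exi// eeta// mulrDr.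
Qed.

Lemma lambdaZr x k f xi : Sigma_c f -> equivariant xi ->
  lambda x f (fun e => k * xi e) = fun e => k * lambda x f xi e.
Proof.
move=> Sf exi; apply/funext => e.
have [ex|nex] := pselect (src_fibre E x e); last by rewrite !lambda_off ?mulr0.
have [K [uK Kx hK]] := rowset e Sf.
have xe : src (pi e) = x by apply/src_fibreE.
rewrite xe in Kx; rewrite !(@lambda_row x _ _ e K)//.
- by rewrite mulr_sumr; apply: eq_bigr => h _; rewrite mulrCA.
- by move=> z c cz; rewrite exi// mulrCA.
Qed.

Lemma lambda0l x xi : lambda x (fun _ : E => 0) xi = (fun _ => 0).
Proof.
apply/funext => e; have [ex|nex] := pselect (src_fibre E x e); last by rewrite lambda_off.
rewrite /lambda mem_set//.
rewrite (@cintegral_cut _ _ _ Ghaus x [::])// ?big_nil//.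
  by move=> z c cx cz; rewrite !mul0r.
by move=> c _ _; rewrite mul0r.
Qed.

Lemma Sigma_c_sum (fs : seq (E -> R[i])) : (forall f, f \in fs -> Sigma_c f) ->
  Sigma_c (\sum_(f <- fs) f).
Proof.
elim: fs => [|f fs IH] h; first by rewrite big_nil; exact: Sigma_c0.
rewrite big_cons; apply: Sigma_cD; first by apply: h; rewrite mem_head.
by apply: IH => g gfs; apply: h; rewrite inE gfs orbT.
Qed.

(** An elementary function acts as a weighted partial permutation of the
    fibres, so its operator norm is at most its supremum. *)
Lemma lambda_elementary_entry x f xi e : elementary f -> equivariant xi ->
  src_fibre E x e -> lambda x f xi e != 0 ->
  exists c, [/\ src_fibre E x c, f (gmul e (ginv c)) != 0 &
    lambda x f xi e = f (gmul e (ginv c)) * xi c].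
Proof.
move=> ef exi ex l0; have [Sf _] := ef.
have [K [uK Kx hK]] := rowset e Sf.
have xe : src (pi e) = x by apply/src_fibreE.
rewrite xe in Kx; move: l0; rewrite (@lambda_row x f xi e K)// => l0.
have [g gK fg] := sum_neq0 l0.
have sl := lift_src ex (Kx _ gK).
exists (lift g); split.
- by apply/src_fibreE; rewrite pi_lift Kx.
- by apply: contra_neq fg => ->; rewrite mul0r.
rewrite (bigD1_seq g)//= big1_seq ?addr0// => h /andP[hg hK'].
have slh := lift_src ex (Kx _ hK').
have [->|fh] := eqVneq (f (gmul e (ginv (lift h)))) 0; first by rewrite mul0r.
have fg' : f (gmul e (ginv (lift g))) != 0 by apply: contra_neq fg => ->; rewrite mul0r.
have := elementary_row ef _ fh fg'; rewrite !rng_div// => /(_ erefl) h'.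
have := congr1 (fun x => gmul (ginv x) (pi e)) h'.
have cg := composable_div (esym sl); have ch := composable_div (esym slh).
rewrite !pi_mul// !pi_inv !pi_lift.
have sg : src (pi e) = src g by rewrite xe Kx.
have sh : src (pi e) = src h by rewrite xe Kx.
by rewrite !gpd_invD// !gpd_divK// => hh; case/eqP: hg.
Qed.

Lemma lambda_elementary x f xi M : elementary f -> 0 <= M -> (forall e, nc (f e) <= M) ->
  Lp p x xi -> Lp p x (lambda x f xi) /\ Lpn p x (lambda x f xi) <= M * Lpn p x xi.
Proof.
move=> ef M0 fM Lx; have [Sf _] := ef.
have [xoff exi _] := (LpP p1 Glc Ghaus x xi).1 Lx.
have eql : equivariant (lambda x f xi) by exact: lambda_equivariant.
have offl : off_fibre x (lambda x f xi) by move=> e; exact: lambda_off.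
have b : pbounded p x (lambda x f xi) ((M * Lpn p x xi) `^ p).
  move=> s us sx.
  pose P g := `[< lambda x f xi (lift g) != 0 >].
  have ex g : exists c : E, g \in s -> P g -> [/\ src_fibre E x c,
      f (gmul (lift g) (ginv c)) != 0 &
      lambda x f xi (lift g) = f (gmul (lift g) (ginv c)) * xi c].
    have [gs|] := boolP (g \in s); last by exists (lift g).
    have [/asboolP Pg|] := boolP (P g); last by exists (lift g).
    have lx : src_fibre E x (lift g) by apply/src_fibreE; rewrite pi_lift sx.
    by have [c hc] := lambda_elementary_entry ef exi lx Pg; exists c.
  pose c g := sval (cid (ex g)).
  have cP g : g \in s -> P g -> _ := svalP (cid (ex g)).
  rewrite (bigID P)/= [X in _ + X]big1 ?addr0; last first.
    by move=> g /asboolPn/negP; rewrite negbK => /eqP ->; rewrite nc0 powR0// gt_eqF.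
  rewrite -big_filter; set s' := [seq g <- s | P g].
  have us' : uniq s' by exact: filter_uniq.
  have s'P g : g \in s' -> g \in s /\ P g by rewrite mem_filter => /andP[].
  apply: (@le_trans _ _ (M `^ p * \sum_(h <- [seq pi (c g) | g <- s']) nc (xi (lift h)) `^ p)).
    rewrite big_map mulr_sumr big_seq [leRHS]big_seq; apply: ler_sum => g /s'P[gs Pg].
    have [_ _ ->] := cP _ gs Pg.
    rewrite ncM powRM ?nc_ge0// lift_nc//; apply: ler_wpM2r; first exact: powR_ge0.
    by rewrite powRp_le ?nc_ge0.
  rewrite powRM ?Lpn_ge0//; apply: ler_wpM2l; first exact: powR_ge0.
  apply: (Lpn_sum p1 Ghaus Lx).
    rewrite map_inj_in_uniq// => g h gs hs e.
    have [gs1 gP] := s'P _ gs; have [hs1 hP] := s'P _ hs.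
    have [cg fg _] := cP _ gs1 gP; have [ch fh _] := cP _ hs1 hP.
    have lg : src_fibre E x (lift g) by apply/src_fibreE; rewrite pi_lift sx.
    have lh : src_fibre E x (lift h) by apply/src_fibreE; rewrite pi_lift sx.
    have sg := src_fibre_src cg lg; have sh := src_fibre_src ch lh.
    have := elementary_col ef _ fg fh; rewrite !src_div// => /(_ (pi_eq_rng e)).
    rewrite !pi_mul; try exact: composable_div.
    rewrite !pi_inv !pi_lift e.
    have sg' : src g = src (pi (c h)).
      by rewrite -e -[g in LHS](pi_lift E); apply/src_pi_eq.
    have sh' : src h = src (pi (c h)) by rewrite -[h in LHS](pi_lift E); apply/src_pi_eq.
    by move=> /(congr1 (fun y => gmul y (pi (c h)))); rewrite !gpd_divK.
  move=> _ /mapP[g /s'P[gs Pg] ->].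
  by have [cx _ _] := cP _ gs Pg; apply/src_fibreE.
have Ll : Lp p x (lambda x f xi).
  by apply/LpP => //; split => //; exists ((M * Lpn p x xi) `^ p).
by split => //; apply/Lpn_leP => //; rewrite mulr_ge0 ?Lpn_ge0.
Qed.

Lemma Sigma_c_bounded f : Sigma_c f -> exists2 M, 0 <= M & forall e, nc (f e) <= M.
Proof.
move=> /Sigma_cP[cf ef [K cK fK]].
have [|s [sK sc]] := @compact_subcover _ K (fun e => [set t | nc (f t) < nc (f e) + 1]) cK.
  move=> e Ke; apply: open_nbhs_nbhs; split; first exact: open_nc_lt.
  by rewrite /= ltrDl.
exists (\sum_(e <- s) (nc (f e) + 1)).
  by apply: sumr_ge0 => e _; rewrite addr_ge0 ?nc_ge0.
move=> e; have [->|/fK Ke] := eqVneq (f e) 0.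
  by rewrite nc0; apply: sumr_ge0 => t _; rewrite addr_ge0 ?nc_ge0.
have [t ts /= /ltW h] := sc _ Ke; apply: le_trans h _.
rewrite (big_rem t)//= lerDl; apply: sumr_ge0 => u _.
by rewrite addr_ge0 ?nc_ge0.
Qed.

(** Fragmentation reduces the bound to elementary functions. *)
Lemma lambda_bounded f : Sigma_c f -> exists2 C, 0 <= C &
  forall x xi, Lp p x xi -> Lp p x (lambda x f xi) /\ Lpn p x (lambda x f xi) <= C * Lpn p x xi.
Proof.
move=> /(fragmentation Glc Ghaus)[fs [hfs ->]].
elim: fs hfs => {f} [|f fs IH] hfs.
  exists 0 => // x xi Lx; rewrite big_nil lambda0l mul0r.
  by have [L0 ->] := Lp0 E p1 Glc Ghaus x.
have [|C C0 hC] := IH; first by move=> g gfs; apply: hfs; rewrite inE gfs orbT.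
have ef : elementary f by apply: hfs; rewrite mem_head.
have [M M0 hM] := Sigma_c_bounded ef.1.
exists (M + C); first exact: addr_ge0.
move=> x xi Lx; rewrite big_cons.
have [_ exi _ _ _] := Lx.
have Ss : Sigma_c (\sum_(g <- fs) g).
  by apply: Sigma_c_sum => g gfs; have [] : elementary g by apply: hfs; rewrite inE gfs orbT.
rewrite lambdaDl//; last exact: ef.1.
have [L1 n1] := lambda_elementary ef M0 hM Lx; have [L2 n2] := hC x xi Lx.
have [L3 n3] := LpD p1 L1 L2; split => //.
by apply: le_trans n3 _; rewrite mulrDl lerD.
Qed.

End Lambda.

(** * Convolution and the reduced norm *)

Section Convolution.
Variables (R : realType) (G : topGroupoid) (E : twist R G).
Hypotheses (Glc : locally_compact [set: G]) (Ghaus : hausdorff_space G).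
Implicit Types (x : G) (e c d : E) (f xi : E -> R[i]).
Local Notation pi := (@tw_pi _ _ E).
Local Notation lift := (tw_lift E).

Lemma conv_lambda f (g : E -> R[i]) e : conv f g e = lambda (pi (src e)) f g e.
Proof. by rewrite /lambda mem_set. Qed.

Lemma conv_row f (g : E -> R[i]) e (K : seq G) : Sigma_c f -> equivariant g -> uniq K ->
  (forall h, h \in K -> src h = src (pi e)) ->
  (forall c, src c = src e -> pi c \notin K -> f (gmul e (ginv c)) = 0) ->
  conv f g e = \sum_(h <- K) f (gmul e (ginv (lift h))) * g (lift h).
Proof.
move=> Sf eg uK Kx hK; rewrite conv_lambda; apply: lambda_row => //.
by move=> h /Kx ->; rewrite pi_src.
Qed.

Lemma conv_equivariant f (g : E -> R[i]) : Sigma_c f -> equivariant g -> equivariant (conv f g).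
Proof.
move=> Sf eg z e cz; rewrite !conv_lambda src_act//.
exact: (lambda_equivariant Glc Ghaus).
Qed.

Lemma conv_neq0 f (g : E -> R[i]) e : Sigma_c f -> equivariant g -> conv f g e != 0 ->
  exists c, [/\ src c = src e, f (gmul e (ginv c)) != 0 & g c != 0].
Proof.
move=> Sf eg; have [K [uK Kx hK]] := rowset Glc Ghaus e Sf.
rewrite (conv_row Sf eg uK Kx hK) => n0.
have [h hK' fh] := sum_neq0 n0; exists (lift h); split.
- by apply/src_pi_eq; rewrite pi_lift Kx.
- by apply: contra_neq fh => ->; rewrite mul0r.
- by apply: contra_neq fh => ->; rewrite mulr0.
Qed.

(** All classes of the source fibre other than that of [c] contribute zero to
    the sum. *)
Lemma conv_col f (g : E -> R[i]) e c : Sigma_c f -> equivariant g -> src c = src e ->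
  (forall d, src d = src e -> g d != 0 -> pi d = pi c) ->
  conv f g e = f (gmul e (ginv c)) * g c.
Proof.
move=> Sf eg ce hg; have [_ _ ef] := Sf.
rewrite conv_lambda (@lambda_sumE _ _ _ Ghaus _ f g e [:: pi c])//.
- rewrite big_seq1; have [z cz ez] := lift_fibre c.
  rewrite [in RHS]ez lambda_term_act//.
  by rewrite -ce; apply: pi_eq_src; rewrite pi_lift.
- by move=> h; rewrite inE => /eqP ->; rewrite -pi_src ce.
- move=> d; rewrite inE => /src_fibreE dx dc; have [->|gd] := eqVneq (g d) 0.
    by rewrite mulr0.
  case/negP: dc; apply/eqP; apply: hg => //.
  by apply/src_pi_eq; rewrite dx pi_src.
Qed.

Lemma conv_translate f (g : E -> R[i]) e c (K : seq G) : Sigma_c f -> equivariant g ->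
  src c = src e -> uniq K -> (forall h, h \in K -> src h = src (pi e)) ->
  (forall d, src d = src e -> pi d \notin K -> f (gmul e (ginv d)) = 0) ->
  conv f g (gmul e (ginv c)) =
  \sum_(h <- K) f (gmul e (ginv (lift h))) * g (gmul (lift h) (ginv c)).
Proof.
move=> Sf eg ce uK Kx hK; have [_ _ ef] := Sf.
have sl h : h \in K -> src (lift h) = src c.
  by move=> /Kx hx; rewrite ce; apply/src_pi_eq; rewrite pi_lift.
have slh h : h \in K -> src h = src (pi c).
  by move=> /Kx ->; apply/src_pi_eq.
pose K' := [seq gmul h (ginv (pi c)) | h <- K].
have s' : src (gmul e (ginv c)) = rng c by rewrite src_div.
rewrite conv_lambda (@lambda_sumE _ _ _ Ghaus _ f g _ K')//.
- rewrite big_map; apply: eq_big_seq => h hK'.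
  have [z cz ez] := lift_fibre (gmul (lift h) (ginv c)).
  have cl : composable (lift h) (ginv c) by apply: composable_div; exact: sl.
  have pE : pi (gmul (lift h) (ginv c)) = gmul h (ginv (pi c)).
    by rewrite pi_mul// pi_lift pi_inv.
  rewrite pE in ez.
  rewrite -(lambda_term_act ef eg _ cz); last first.
    by rewrite s' -(src_div (sl _ hK')); apply: pi_eq_src; rewrite pi_lift.
  by rewrite -ez div_div// sl.
- rewrite map_inj_in_uniq// => h k hK' kK' /(congr1 (fun y => gmul y (pi c))).
  by rewrite !gpd_divK// slh.
- move=> _ /mapP[h hK' ->]; rewrite s' pi_rng src_div//; exact: slh.
- move=> d /src_fibreE; rewrite s' => dx dK.
  have dc : composable d c.
    by rewrite /composable -srcV; apply/src_pi_eq; rewrite dx pi_inv srcV pi_rng.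
  rewrite div_mul// hK ?mul0r//; first by rewrite src_mul.
  apply: contra dK => dK; apply/mapP; exists (pi (gmul d c)) => //.
  by rewrite pi_mul// gpdKr//; have [] := @tw_pi_hom _ _ E _ _ dc.
Qed.

Lemma conv_suml f (gs : seq (E -> R[i])) : Sigma_c f -> (forall g, g \in gs -> equivariant g) ->
  conv f (\sum_(g <- gs) g) = \sum_(g <- gs) conv f g.
Proof.
move=> Sf; elim: gs => [|g gs IH] hg.
  rewrite !big_nil; apply/funext => e; rewrite (@conv_col _ _ e e)// ?mulr0//.
    by move=> z c _; rewrite mulr0.
  by move=> d _; rewrite eqxx.
have eg : equivariant g by apply: hg; rewrite mem_head.
have egs : equivariant (\sum_(h <- gs) h).
  rewrite big_seq; elim/big_ind : _.
  - by move=> z e _; rewrite mulr0.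
  - by move=> a b ea eb z e cz; rewrite !addCE ea// eb// mulrDr.
  - by move=> h hgs; apply: hg; rewrite inE hgs orbT.
rewrite !big_cons -IH; last by move=> h hgs; apply: hg; rewrite inE hgs orbT.
apply/funext => e; rewrite addCE !conv_lambda (lambdaDr Glc Ghaus)//.
Qed.

Lemma conv_elementary f g e c U K : Sigma_c f -> Sigma_c g -> open_bisection U ->
  K `<=` U -> supported_in g K -> src c = src e -> U (pi c) ->
  conv f g e = f (gmul e (ginv c)) * g c.
Proof.
move=> Sf [_ _ eg] [_ sU _] KU gK ce Uc; apply: conv_col => // d de /gK/KU Ud.
by apply: sU; rewrite ?inE//; apply/src_pi_eq; rewrite de.
Qed.

Hypothesis Get : etale G.

Lemma over_source_open (O : set E) : open O -> open [set e | exists2 c, O c & src c = src e].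
Proof.
move=> oO.
have -> : [set e | exists2 c, O c & src c = src e] =
    (fun e => src (pi e)) @^-1` (@src G @` (pi @` O)).
  apply/seteqP; split => [e [c Oc ce]|e [g [c Oc <-]] /src_pi_eq ce]; last by exists c.
  by exists (pi c); [exists c|apply/src_pi_eq].
apply: open_comp; last by apply: src_open => //; exact: pi_open.
move=> e _; apply: (@continuous_comp _ _ _ pi (@src G)); first exact: tw_pi_continuous.
exact: src_continuous.
Qed.

(** Over the sources of a bisection containing the support of [g], the
    convolution is the single term [f (e c^-1) g(c)], in which [c] depends
    continuously on [e] because the source map is open. *)
Lemma conv_elementary_continuous f g : Sigma_c f -> elementary g -> continuous (conv f g).
Proof.
move=> Sf [Sg [U [K [bU cK KU gK]]]].
have [M M0 fM] := Sigma_c_bounded Sf; have [N N0 gN] := Sigma_c_bounded Sg.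
have [cf _ ef] := Sf; have [cg _ eg] := Sg; have [oU _ _] := bU.
apply/continuousC_near => e eps eps0.
have [[c ce Uc]|nc0] := pselect (exists2 c, src c = src e & U (pi c)); last first.
  have clK : closed (@src G @` K).
    apply: compact_closed => //; apply: continuous_compact => //.
    by apply: continuous_subspaceT; exact: src_continuous.
  have oe : open (~` ((fun e => src (pi e)) @^-1` (@src G @` K))).
    apply: closed_openC; apply: closed_comp => // t _.
    apply: (@continuous_comp _ _ _ pi (@src G)); first exact: tw_pi_continuous.
    exact: src_continuous.
  have z t : (~` ((fun e => src (pi e)) @^-1` (@src G @` K))) t -> conv f g t = 0.
    move=> nt; apply/eqP; apply: contra_notT nt => /(conv_neq0 Sf eg)[c [ct _ /gK Kc]].
    by exists (pi c) => //; apply/src_pi_eq.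
  have ne : (~` ((fun e => src (pi e)) @^-1` (@src G @` K))) e.
    move=> [h Kh /= hs]; apply: nc0; have [c ch] := tw_pi_surj E h.
    by exists c; rewrite ?ch; [apply/src_pi_eq; rewrite ch|exact: KU].
  apply: near_sub (open_nbhs_nbhs (conj oe ne)) => t /z ->.
  by rewrite z// subr0 Normc.normc0.
pose dl := eps / (M + N + 1).
have D0 : 0 < M + N + 1 by lra.
have dl0 : 0 < dl by rewrite divr_gt0.
have nW : nbhs (gmul e (ginv c)) [set y | nc (f (gmul e (ginv c)) - f y) < dl].
  exact: (continuousC_near f).1 cf _ _ dl0.
have [A [B [nA nB AB]]] := div_near (esym ce) nW.
have nB' : nbhs c [set y | nc (g c - g y) < dl].
  exact: (continuousC_near g).1 cg _ _ dl0.
have nU : nbhs c (pi @^-1` U).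
  by apply: tw_pi_continuous; apply: open_nbhs_nbhs.
pose O := B `&` ([set y | nc (g c - g y) < dl] `&` pi @^-1` U).
have nI : nbhs c O by apply: filterI => //; exact: filterI.
have nO : nbhs e [set e | exists2 c, interior O c & src c = src e].
  apply: open_nbhs_nbhs; split; last by exists c.
  exact: (over_source_open (@open_interior _ O)).
have nAO : nbhs e (A `&` [set e | exists2 c, interior O c & src c = src e]).
  exact: filterI.
apply: near_sub nAO => t [At [d /interior_subset[Bd [gd Ud]] dt]].
rewrite (conv_elementary Sf Sg bU KU gK ce Uc) (conv_elementary Sf Sg bU KU gK dt Ud).
have fd := AB _ _ At Bd (esym dt).
set a := f _ in fd *; set b := f (gmul t _) in fd *.
have -> : a * g c - b * g d = (a - b) * g c + b * (g c - g d) by ring.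
apply: le_lt_trans (ncD _ _) _; rewrite !ncM.
have h1 : nc (a - b) * nc (g c) <= dl * N.
  by apply: ler_pM; rewrite ?nc_ge0 ?gN// ltW.
have h2 : nc b * nc (g c - g d) <= M * dl.
  by apply: ler_pM; rewrite ?nc_ge0 ?fM// ltW.
have : dl * (M + N + 1) = eps by rewrite /dl divfK// gt_eqF.
by nra.
Qed.

Lemma conv_Sigma f g : Sigma_c f -> Sigma_c g -> Sigma_c (conv f g).
Proof.
move=> Sf Sg; have [_ _ eg] := Sg; apply/Sigma_cP; split.
- have [gs [hgs ->]] := fragmentation Glc Ghaus Sg.
  rewrite conv_suml//; last by move=> h /hgs[[]].
  rewrite big_seq; elim/big_ind : _.
  + by move=> e; exact: cvg_cst.
  + by move=> a b ca cb; exact: (contC_add ca cb).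
  + by move=> h /hgs; exact: conv_elementary_continuous.
- exact: conv_equivariant.
- have /Sigma_cP[_ _ [K cK fK]] := Sf; have /Sigma_cP[_ _ [L cL gL]] := Sg.
  exists ((fun ab : E * E => gmul ab.1 ab.2) @`
      ((K `*` L) `&` [set ab : E * E | composable ab.1 ab.2])).
    apply: continuous_compact.
      by apply: continuous_subspaceW (@gmul_continuous E) => ab [].
    apply: compact_closedI; first exact: compact_setX.
    by apply: composable_closed; exact: tw_hausdorff.
  move=> e /(conv_neq0 Sf eg)[c [ce fc gc]].
  exists (gmul e (ginv c), c) => /=; last by rewrite gpd_divK.
  split; first by split; [exact: fK|exact: gL].
  by rewrite /composable src_div.
Qed.

Lemma lambda_conv x f g xi : Sigma_c f -> Sigma_c g -> equivariant xi ->
  lambda x (conv f g) xi = lambda x f (lambda x g xi).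
Proof.
move=> Sf Sg exi; apply/funext => e.
have [_ _ ef] := Sf; have [_ _ eg] := Sg.
have Sfg := conv_Sigma Sf Sg.
have [ex|nex] := pselect (src_fibre E x e); last by rewrite !lambda_off.
have xe : src (pi e) = x by apply/src_fibreE.
have [K [uK Kx hK]] := rowset Glc Ghaus e Sf.
have [M [uM Mx hM]] := rowset Glc Ghaus e Sfg.
rewrite xe in Mx Kx.
have ex' h : exists L : seq G, h \in K -> [/\ uniq L,
    (forall g, g \in L -> src g = x) &
    forall c, src c = src e -> pi c \notin L -> g (gmul (lift h) (ginv c)) = 0].
  have [hK'|] := boolP (h \in K); last by exists [::].
  have [L [uL Lx hL]] := rowset Glc Ghaus (lift h) Sg.
  have sh := lift_src ex (Kx _ hK').
  exists L => _; split => //; first by move=> k /Lx ->; rewrite pi_lift Kx.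
  by move=> c ce; apply: hL; rewrite ce.
pose L h := sval (cid (ex' h)).
have LP h : h \in K -> _ := svalP (cid (ex' h)).
pose N := undup (M ++ flatten [seq L h | h <- K]).
have uN : uniq N by exact: undup_uniq.
have Nx g' : g' \in N -> src g' = x.
  rewrite mem_undup mem_cat => /orP[/Mx//|/flattenP[_ /mapP[h hK' ->]]].
  by have [_ Lx _] := LP _ hK'; exact: Lx.
have NM c : pi c \notin N -> pi c \notin M.
  by rewrite mem_undup mem_cat negb_or => /andP[].
have NL c h : h \in K -> pi c \notin N -> pi c \notin L h.
  move=> hK'; rewrite mem_undup mem_cat negb_or => /andP[_].
  by apply: contra => cL; apply/flattenP; exists (L h) => //; apply/mapP; exists h.
rewrite (@lambda_row _ _ _ Ghaus x (conv f g) xi e N)//; last by move=> c ce /NM; exact: hM.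
rewrite (@lambda_row _ _ _ Ghaus x f _ e K)//; last first.
  exact: (lambda_equivariant Glc Ghaus).
transitivity (\sum_(k <- N) \sum_(h <- K)
    f (gmul e (ginv (lift h))) * (g (gmul (lift h) (ginv (lift k))) * xi (lift k))).
  apply: eq_big_seq => k kN; rewrite (@conv_translate _ _ _ _ K)//.
  - by rewrite mulr_suml; apply: eq_bigr => h _; rewrite mulrA.
  - exact: lift_src ex (Nx _ kN).
  - by rewrite xe.
rewrite exchange_big; apply: eq_big_seq => h hK'; rewrite -mulr_sumr; congr (_ * _).
have sh := lift_src ex (Kx _ hK').
have [_ _ hL] := LP _ hK'.
rewrite (@lambda_row _ _ _ Ghaus x g xi (lift h) N)//.
- by apply/src_fibreE; rewrite pi_lift Kx.
- by move=> c ce cN; rewrite hL//; [rewrite ce|exact: NL].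
Qed.

End Convolution.

Section ReducedNormFacts.
Variables (R : realType) (p : R) (G : topGroupoid) (E : twist R G).
Hypotheses (p1 : 1 <= p) (Glc : locally_compact [set: G]) (Ghaus : hausdorff_space G).
Hypothesis Get : etale G.
Implicit Types (x : G) (e c d : E) (f g xi : E -> R[i]).
Local Notation pi := (@tw_pi _ _ E).
Local Notation lift := (tw_lift E).

Let p0 : 0 < p. Proof. exact: lt_le_trans ltr01 p1. Qed.

Definition rn f : R := locked (fine (reduced_norm p f)).

Lemma rn_spec f : Sigma_c f -> [/\ reduced_norm p f = (rn f)%:E, 0 <= rn f,
    (forall x xi, units G x -> Lp p x xi ->
      Lpn p x (lambda x f xi) <= rn f * Lpn p x xi) &
    forall M, 0 <= M -> (forall x xi, units G x -> Lp p x xi ->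
      Lpn p x (lambda x f xi) <= M * Lpn p x xi) -> rn f <= M].
Proof.
move=> Sf; have [C C0 hC] := lambda_bounded p1 Glc Ghaus Sf.
have ub M : 0 <= M -> (forall x xi, units G x -> Lp p x xi ->
    Lpn p x (lambda x f xi) <= M * Lpn p x xi) -> (reduced_norm p f <= M%:E)%E.
  move=> M0 hM; rewrite /reduced_norm ge_max lee_fin M0/=.
  apply: ge_ereal_sup => _ [x ux <-]; apply: ge_ereal_sup => _ [xi [Lx x1] <-].
  have [Ll _] := hC x xi Lx; rewrite Lp_normE// lee_fin.
  apply: le_trans (hM x xi ux Lx) _; rewrite -[leRHS]mulr1 ler_wpM2l//.
  by rewrite -lee_fin -Lp_normE.
have r0 : (0 <= reduced_norm p f)%E by rewrite /reduced_norm le_max lexx.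
have rE : reduced_norm p f = (rn f)%:E.
  rewrite /rn -lock fineK// ge0_fin_numE//; apply: (@le_lt_trans _ _ C%:E); last exact: ltry.
  by apply: ub => // x xi _ Lx; have [] := hC x xi Lx.
have rn0 : 0 <= rn f by rewrite /rn -lock fine_ge0.
split=> // [x xi ux Lx|M M0 hM]; last by rewrite -lee_fin -rE; exact: ub.
have [Ll Lle] := hC x xi Lx; have [_ exi _ _ _] := Lx.
have h1 eta : Lp p x eta -> Lpn p x eta <= 1 -> Lpn p x (lambda x f eta) <= rn f.
  move=> Le e1; have [Lle' _] := hC x eta Le.
  rewrite -lee_fin -rE -Lp_normE//.
  apply: (@le_trans _ _ (lambda_norm p x f)).
    apply: ereal_sup_ubound; exists eta => //; split => //=.
    by rewrite Lp_normE// lee_fin.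
  rewrite /reduced_norm le_max; apply/orP; right.
  by apply: ereal_sup_ubound; exists x.
have [t0|t0] := eqVneq (Lpn p x xi) 0.
  by move: Lle; rewrite t0 !mulr0.
have tp : 0 < Lpn p x xi by rewrite lt_neqAle eq_sym t0 Lpn_ge0.
set t := Lpn p x xi in t0 tp *.
have [Lk nk] := LpZ p1 Glc Ghaus (t^-1)%:C%C Lx.
rewrite nc_real ger0_norm ?invr_ge0 ?Lpn_ge0// mulVf// in nk.
have [Ll' _] := hC x _ Lk; have := h1 _ Lk nk.
have [Lb nb] := LpZ p1 Glc Ghaus t%:C%C Ll'.
have -> : lambda x f xi = (fun e => t%:C%C * lambda x f (fun e0 => (t^-1)%:C%C * xi e0) e).
  rewrite (lambdaZr Glc Ghaus x (t^-1)%:C%C Sf exi); apply/funext => e.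
  by rewrite mulrA -rmorphM divff// mul1r.
move=> h; apply: le_trans nb _; rewrite nc_real ger0_norm ?Lpn_ge0// mulrC.
by apply: ler_wpM2r; rewrite ?Lpn_ge0.
Qed.

Lemma rnE f : Sigma_c f -> reduced_norm p f = (rn f)%:E.
Proof. by move=> /rn_spec[]. Qed.

Lemma rn_ge0 f : Sigma_c f -> 0 <= rn f.
Proof. by move=> /rn_spec[]. Qed.

Lemma rn_bound f x xi : Sigma_c f -> units G x -> Lp p x xi ->
  Lpn p x (lambda x f xi) <= rn f * Lpn p x xi.
Proof. by move=> /rn_spec[_ _ + _]; apply. Qed.

Lemma rn_le f M : Sigma_c f -> 0 <= M -> (forall x xi, units G x -> Lp p x xi ->
  Lpn p x (lambda x f xi) <= M * Lpn p x xi) -> rn f <= M.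
Proof. by move=> /rn_spec[_ _ _]; apply. Qed.

Lemma lambda_Lp f x xi : Sigma_c f -> Lp p x xi -> Lp p x (lambda x f xi).
Proof. by move=> Sf Lx; have [C _ /(_ x xi Lx)[]] := lambda_bounded p1 Glc Ghaus Sf. Qed.

Lemma Lp_equivariant x xi : Lp p x xi -> equivariant xi.
Proof. by case. Qed.

Lemma rnD f g : Sigma_c f -> Sigma_c g -> rn (f + g) <= rn f + rn g.
Proof.
move=> Sf Sg; apply: rn_le; [exact: Sigma_cD|by rewrite addr_ge0 ?rn_ge0|].
move=> x xi ux Lx; rewrite (lambdaDl Glc Ghaus)//; last exact: Lp_equivariant Lx.
have [_ h] := LpD p1 (lambda_Lp Sf Lx) (lambda_Lp Sg Lx); apply: le_trans h _.
by rewrite mulrDl; apply: lerD; exact: rn_bound.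
Qed.

Lemma rnZ k f : Sigma_c f -> rn (k *: f) <= nc k * rn f.
Proof.
move=> Sf; apply: rn_le; [exact: Sigma_cZ|by rewrite mulr_ge0 ?nc_ge0 ?rn_ge0|].
move=> x xi ux Lx; rewrite (lambdaZl Glc Ghaus)//; last exact: Lp_equivariant Lx.
have [_ h] := LpZ p1 Glc Ghaus k (lambda_Lp Sf Lx); apply: le_trans h _.
rewrite -mulrA; apply: ler_wpM2l; first exact: nc_ge0.
exact: rn_bound.
Qed.

Lemma rnM f g : Sigma_c f -> Sigma_c g -> rn (conv f g) <= rn f * rn g.
Proof.
move=> Sf Sg; apply: rn_le; [exact: conv_Sigma|by rewrite mulr_ge0 ?rn_ge0|].
move=> x xi ux Lx; rewrite lambda_conv//; last exact: Lp_equivariant Lx.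
apply: le_trans (rn_bound Sf ux (lambda_Lp Sg Lx)) _.
rewrite -mulrA; apply: ler_wpM2l; first exact: rn_ge0.
exact: rn_bound.
Qed.

(** The basis vector at [c] of the [L^p] space of its source fibre. *)
Definition dvec c : E -> R[i] := fun e =>
  if pselect (exists z, circle z /\ e = tw_act z c) is left h then sval (cid h) else 0.

Lemma dvec_act c z : circle z -> dvec c (tw_act z c) = z.
Proof.
move=> cz; rewrite /dvec; case: pselect => [h|]; last by case; exists z.
by case: cid => w /= [cw /act_inj]; move/(_ cz cw) => ->.
Qed.

Lemma dvec1 c : dvec c c = 1.
Proof. by rewrite -{2}[c]act1 dvec_act//; exact: circle1. Qed.

Lemma dvec_neq0 c e : dvec c e != 0 -> pi e = pi c.
Proof.
rewrite /dvec; case: pselect => [[z [cz ez]] _|_]; last by rewrite eqxx.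
by rewrite ez pi_act.
Qed.

Lemma dvec_equivariant c : equivariant (dvec c).
Proof.
move=> z e cz; have [/esym h|h] := pselect (pi e = pi c).
  have [w cw ->] := pi_fibre h.
  by rewrite actM// !dvec_act//; exact: circleM.
have h0 : dvec c e = 0 by apply/eqP; apply: contra_notT h; exact: dvec_neq0.
by rewrite h0 mulr0; apply/eqP; apply: contra_notT h => /dvec_neq0; rewrite pi_act.
Qed.

Lemma dvec_circle c e : pi e = pi c -> nc (dvec c e) = 1.
Proof.
by move=> /esym h; have [w cw ->] := pi_fibre h; rewrite dvec_act//; apply/circle_nc.
Qed.

Lemma dvec_Lp x c : src_fibre E x c -> Lp p x (dvec c) /\ Lpn p x (dvec c) <= 1.
Proof.
move=> cx.
have b : pbounded p x (dvec c) (1 `^ p).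
  move=> s us sx; rewrite powR1.
  have [cs|cs] := boolP (pi c \in s).
    rewrite (bigD1_seq (pi c))//= dvec_circle ?pi_lift// powR1 big1 ?addr0// => g gc.
    suff -> : dvec c (lift g) = 0 by rewrite Normc.normc0 powR0// gt_eqF.
    by apply/eqP; apply: contraNT gc => /dvec_neq0; rewrite pi_lift => ->.
  rewrite big_seq big1 ?ler01// => g gs.
  suff -> : dvec c (lift g) = 0 by rewrite Normc.normc0 powR0// gt_eqF.
  by apply/eqP; apply: contraNT cs => /dvec_neq0; rewrite pi_lift => <-.
have L : Lp p x (dvec c).
  apply/LpP => //; split; [|exact: dvec_equivariant|by eexists; exact: b].
  move=> e nex; apply/eqP; apply: contra_notT nex => /dvec_neq0 h.
  by apply/src_fibreE; rewrite h; apply/src_fibreE.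
by split => //; apply/Lpn_leP.
Qed.

Lemma lambda_dvec x f c e : Sigma_c f -> src_fibre E x c -> src_fibre E x e ->
  lambda x f (dvec c) e = f (gmul e (ginv c)).
Proof.
move=> Sf cx ex; have [_ _ ef] := Sf; have ed := @dvec_equivariant c.
have xc : src (pi c) = x by apply/src_fibreE.
rewrite (@lambda_sumE _ _ _ Ghaus x f (dvec c) e [:: pi c])//.
- rewrite big_seq1; have [z cz ez] := lift_fibre c.
  have h := lambda_term_act ef ed (lift_src ex xc) cz.
  by rewrite -h -ez dvec1 mulr1.
- by move=> g; rewrite inE => /eqP ->.
- move=> d _; rewrite inE => dc.
  suff -> : dvec c d = 0 by rewrite mulr0.
  by apply/eqP; apply: contraNT dc => /dvec_neq0 ->.
Qed.

Lemma rn_eval f e : Sigma_c f -> nc (f e) <= rn f.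
Proof.
move=> Sf; pose u := src e; pose x := pi u.
have ux : units G x by exact: units_pi_src.
have ex : src_fibre E x e by [].
have su : src_fibre E x u by rewrite /src_fibre /= /u; have [_ ->] := unitsP (units_src e).
have [Ld d1] := dvec_Lp su.
have -> : f e = lambda x f (dvec u) e.
  by rewrite lambda_dvec// inv_unit ?gmulr_src//; exact: units_src.
apply: le_trans (Lpn_eval p1 Glc Ghaus _ (lambda_Lp Sf Ld)) _.
apply: le_trans (rn_bound Sf ux Ld) _.
by rewrite -[leRHS]mulr1 ler_wpM2l// rn_ge0.
Qed.

Lemma rn0 : rn (0 : E -> R[i]) = 0.
Proof.
rewrite [0 in LHS](_ : _ = fun _ => 0)//.
apply/eqP; rewrite eq_le rn_ge0 ?andbT; last exact: Sigma_c0.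
apply: rn_le => // [|x xi ux Lx]; first exact: Sigma_c0.
by rewrite (lambda0l Ghaus) mul0r; have [_ ->] := Lp0 E p1 Glc Ghaus x.
Qed.

End ReducedNormFacts.

(** * The completed algebra *)

Section SmallSequences.
Variable R : realType.
Implicit Types (w : nat -> R).

Definition small w := forall eps, 0 < eps -> exists n0, forall n, (n0 <= n)%N -> w n < eps.

Definition cauchyR w := forall eps, 0 < eps -> exists n0, forall m n,
  (n0 <= m)%N -> (n0 <= n)%N -> `|w m - w n| < eps.

Lemma small_le w w' : small w -> (forall n, w' n <= w n) -> small w'.
Proof.
by move=> sw h e /sw[n0 hn0]; exists n0 => n /hn0; apply: le_lt_trans.
Qed.

Lemma small_add w1 w2 : small w1 -> small w2 -> small (fun n => w1 n + w2 n).
Proof.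
move=> s1 s2 e e0; have e2 : 0 < e / 2 by rewrite divr_gt0.
have [n1 h1] := s1 _ e2; have [n2 h2] := s2 _ e2; exists (maxn n1 n2) => n.
by rewrite geq_max => /andP[/h1 a /h2 b]; lra.
Qed.

Lemma small_scale C w : 0 <= C -> small w -> small (fun n => C * w n).
Proof.
move=> C0 sw e e0; have D0 : 0 < C + 1 by lra.
have [n0 h0] := sw _ (divr_gt0 e0 D0); exists n0 => n /h0 h.
have [w0|w0] := leP 0 (w n); last by apply: le_lt_trans e0; nra.
have : w n * (C + 1) < e by rewrite -ltr_pdivlMr.
by nra.
Qed.

Lemma small_cst_le (a : R) w : small w -> (forall n, a <= w n) -> a <= 0.
Proof.
move=> sw h; rewrite leNgt; apply/negP => /sw[n0 /(_ n0 (leqnn _))].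
by rewrite ltNge h.
Qed.

Lemma cauchyR_cvg w : cauchyR w -> exists l, small (fun n => `|w n - l|).
Proof.
move=> cw; have : cvgn w.
  apply/cauchy_cvgP/cauchy_exP => e e0; have [n0 h0] := cw _ e0.
  exists (w n0); exists n0 => // n /= n0n.
  by rewrite /ball /=; exact: h0.
move=> /cvg_ex[l cl]; exists l => e e0.
have /cvgrPdist_lt/(_ e e0)[n0 _ h0] := cl.
by exists n0 => n n0n; rewrite distrC; exact: h0.
Qed.

Lemma small_cvg w l : small (fun n => `|w n - l|) -> w @ \oo --> l.
Proof.
move=> sw; apply/cvgrPdist_lt => e /sw[n0 h0]; exists n0 => // n /= n0n.
by rewrite distrC; exact: h0.
Qed.

Lemma cauchyC_cvg (w : nat -> R[i]) :
  (forall eps, 0 < eps -> exists n0, forall m n,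
    (n0 <= m)%N -> (n0 <= n)%N -> nc (w m - w n) < eps) ->
  exists l, small (fun n => nc (w n - l)).
Proof.
move=> cw.
have [|a ha] := @cauchyR_cvg (fun n => complex.Re (w n)).
  move=> e /cw[n0 h0]; exists n0 => m n hm hn; apply: le_lt_trans (h0 _ _ hm hn).
  by rewrite -raddfB; exact: Re_le_nc.
have [|b hb] := @cauchyR_cvg (fun n => complex.Im (w n)).
  move=> e /cw[n0 h0]; exists n0 => m n hm hn; apply: le_lt_trans (h0 _ _ hm hn).
  by rewrite -raddfB; exact: Im_le_nc.
exists (a +i* b)%C; apply: small_le (small_add ha hb) _ => n.
apply: le_trans (nc_le_ReIm _) _; case: (w n) => u v /=.
by rewrite lexx.
Qed.

Lemma small_limC (w : nat -> R[i]) l l' : small (fun n => nc (w n - l)) ->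
  small (fun n => nc (w n - l')) -> l = l'.
Proof.
move=> h h'; apply/eqP; rewrite -subr_eq0 -nc_eq0 eq_le nc_ge0 andbT.
apply: small_cst_le (small_add h h') _ => n.
have -> : l - l' = (w n - l') - (w n - l) by ring.
by rewrite [leRHS]addrC; exact: ncB.
Qed.

Lemma small_limR (w : nat -> R) l l' : small (fun n => `|w n - l|) ->
  small (fun n => `|w n - l'|) -> l = l'.
Proof.
move=> h h'; apply/eqP; rewrite -subr_eq0 -normr_eq0 eq_le normr_ge0 andbT.
apply: small_cst_le (small_add h h') _ => n.
have -> : l - l' = (w n - l') - (w n - l) by ring.
by rewrite [leRHS]addrC; exact: ler_normB.
Qed.

End SmallSequences.

Section CompletedAlgebra.
Variables (R : realType) (p : R) (G : topGroupoid) (E : twist R G).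
Hypotheses (p1 : 1 <= p) (Glc : locally_compact [set: G]) (Ghaus : hausdorff_space G).
Hypothesis Get : etale G.
Local Notation A := (Fplambda p E).
Local Notation rn := (rn p (E := E)).
Implicit Types (f g : E -> R[i]) (u v w : nat -> E -> R[i]) (a b : A) (e : E).

Definition cauchyS u := (forall n, Sigma_c (u n)) /\
  forall eps, 0 < eps -> exists n0, forall m n,
    (n0 <= m)%N -> (n0 <= n)%N -> rn (u m - u n) < eps.

Lemma cauchySP u : cauchy_in (Sigma_c (E := E)) (reduced_norm p (E := E)) u <-> cauchyS u.
Proof.
split=> -[Su h]; split=> // e /h[n0 h0]; exists n0 => m n hm hn; have := h0 m n hm hn.
  by rewrite rnE ?lte_fin//; exact: Sigma_cB.
by rewrite rnE ?lte_fin//; exact: Sigma_cB.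
Qed.

Lemma rn_distC f g : Sigma_c f -> Sigma_c g -> rn (f - g) = rn (g - f).
Proof.
move=> Sf Sg; have h f' g' : Sigma_c f' -> Sigma_c g' -> rn (f' - g') <= rn (g' - f').
  move=> Sf' Sg'; rewrite -opprB -scaleN1r.
  apply: le_trans (rnZ p1 Glc Ghaus _ (Sigma_cB Sg' Sf')) _.
  by rewrite ncN nc1 mul1r.
by apply: le_anti; apply/andP; split; [exact: (h f g Sf Sg)|exact: (h g f Sg Sf)].
Qed.

Lemma rn_tri f g h : Sigma_c f -> Sigma_c g -> Sigma_c h ->
  rn (f - h) <= rn (f - g) + rn (g - h).
Proof.
move=> Sf Sg Sh; have -> : f - h = (f - g) + (g - h) by rewrite addrA subrK.
exact: (rnD p1 Glc Ghaus (Sigma_cB Sf Sg) (Sigma_cB Sg Sh)).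
Qed.

Lemma rn_dist f g : Sigma_c f -> Sigma_c g -> `|rn f - rn g| <= rn (f - g).
Proof.
move=> Sf Sg; rewrite ler_norml; apply/andP; split.
  have := rnD p1 Glc Ghaus (Sigma_cB Sg Sf) Sf; rewrite subrK (rn_distC Sg Sf).
  by rewrite lerNl opprB lerBlDr.
by have := rnD p1 Glc Ghaus (Sigma_cB Sf Sg) Sg; rewrite subrK -lerBlDr.
Qed.

(** [u] is a Cauchy sequence representing [a]. *)
Definition rep u a := completion_set a u.

Lemma rn_small u v : (forall n, Sigma_c (u n)) -> (forall n, Sigma_c (v n)) ->
  (reduced_norm p (u n - v n) @[n --> \oo] --> 0%E) <-> small (fun n => rn (u n - v n)).
Proof.
move=> Su Sv; have -> : (fun n => reduced_norm p (u n - v n)) = (fun n => (rn (u n - v n))%:E).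
  by apply/funext => n; rewrite rnE//; exact: Sigma_cB.
have r0 n : 0 <= rn (u n - v n) by apply: rn_ge0 => //; exact: Sigma_cB.
split=> [/fine_cvgP[_ /cvgrPdist_lt h] e /h[n0 _ h0]|h].
  exists n0 => n n0n; have := h0 n n0n.
  by rewrite /= sub0r normrN ger0_norm.
apply: cvg_EFin; first by near=> n.
apply/cvgrPdist_lt => e /h[n0 h0]; exists n0 => // n /= n0n.
by rewrite sub0r normrN ger0_norm//; exact: h0.
Unshelve. all: by end_near. Qed.

Lemma repr_cauchy a : cauchyS (repr a).
Proof. by rewrite /repr; case: cid2 => u /= /cauchySP. Qed.

Lemma repr_set a : completion_set a = cauchy_class (Sigma_c (E := E)) (reduced_norm p (E := E)) (repr a).
Proof. by rewrite /repr; case: cid2. Qed.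

Lemma repP u a : rep u a <-> cauchyS u /\ small (fun n => rn (repr a n - u n)).
Proof.
have [Sa _] := repr_cauchy a.
rewrite /rep repr_set /cauchy_class /=; split=> -[cu h].
  have cu' := (cauchySP u).1 cu; split => //.
  by apply/rn_small => //; exact: cu'.1.
split; first exact/cauchySP.
by apply/rn_small => //; exact: cu.1.
Qed.

Lemma rep_cauchy u a : rep u a -> cauchyS u.
Proof. by move=> /repP[]. Qed.

Lemma rep_Sigma u a n : rep u a -> Sigma_c (u n).
Proof. by move=> /rep_cauchy[+ _]; apply. Qed.

Lemma rep_repr a : rep (repr a) a.
Proof.
apply/repP; split; first exact: repr_cauchy.
apply: small_le (_ : small (fun _ => 0)) _; first by move=> e e0; exists 0%N.
by move=> n; rewrite subrr (rn0 E p1 Glc Ghaus).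
Qed.

Lemma rep_small u v a : rep u a -> rep v a -> small (fun n => rn (u n - v n)).
Proof.
move=> ru rv; have [Sa _] := repr_cauchy a.
have /repP[[Su _] hu] := ru; have /repP[[Sv _] hv] := rv.
apply: small_le (small_add hu hv) _ => n.
by rewrite (rn_distC (Sa n) (Su n)); exact: (rn_tri (Su n) (Sa n) (Sv n)).
Qed.

Lemma rep_change u v a : rep u a -> cauchyS v -> small (fun n => rn (u n - v n)) -> rep v a.
Proof.
move=> ru cv h; have [Sa _] := repr_cauchy a; have /repP[[Su _] hu] := ru.
apply/repP; split; first exact: cv.
apply: small_le (small_add hu h) _ => n.
exact: (rn_tri (Sa n) (Su n) (cv.1 n)).
Qed.

Lemma rep_inj u a b : rep u a -> rep u b -> a = b.
Proof.
move=> ra rb.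
have eqs : completion_set a = completion_set b.
  have h c d v : rep u c -> rep u d -> rep v c -> rep v d.
    move=> rc rd rv; apply: rep_change rd (rep_cauchy rv) _.
    exact: rep_small rc rv.
  by apply/seteqP; split => v hv; [exact: h ra rb hv|exact: h rb ra hv].
case: a b eqs {ra rb} => sa pa [sb pb] /= eqs; subst sb.
by congr Completion; exact: Prop_irrelevance.
Qed.

Lemma rep_ex u : cauchyS u -> exists a, rep u a.
Proof.
move=> cu; have cu' := (cauchySP u).2 cu.
exists (Completion (ex_intro2 _ _ u cu' erefl)); split => //.
apply/rn_small; [exact: cu.1|exact: cu.1|].
apply: small_le (_ : small (fun _ => 0)) _; first by move=> e e0; exists 0%N.
by move=> n; rewrite subrr (rn0 E p1 Glc Ghaus).
Qed.

Lemma rep_class u a : cauchyS u -> rep u (class_of a u).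
Proof.
move=> cu; rewrite /class_of; case: pselect => [cu'|]; last first.
  by case; exact/cauchySP.
split => //; apply/rn_small; [exact: cu.1|exact: cu.1|].
apply: small_le (_ : small (fun _ => 0)) _; first by move=> e e0; exists 0%N.
by move=> n; rewrite subrr (rn0 E p1 Glc Ghaus).
Qed.

Lemma cauchyS_bounded u : cauchyS u -> exists2 C, 0 <= C & forall n, rn (u n) <= C.
Proof.
move=> [Su cu]; have [n0 h0] := cu 1 ltr01.
exists (\sum_(i < n0) rn (u i) + (rn (u n0) + 1)).
  by rewrite addr_ge0 ?sumr_ge0 ?addr_ge0 ?rn_ge0// => i _; exact: rn_ge0.
move=> n; have [nn0|n0n] := ltnP n n0.
  rewrite (bigD1 (Ordinal nn0))//= -addrA lerDl addr_ge0 ?addr_ge0 ?rn_ge0//.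
  by apply: sumr_ge0 => i _; exact: rn_ge0.
have h := rnD p1 Glc Ghaus (Sigma_cB (Su n) (Su n0)) (Su n0); rewrite subrK in h.
have h1 := h0 n n0 n0n (leqnn _); have : 0 <= \sum_(i < n0) rn (u i).
  by apply: sumr_ge0 => i _; exact: rn_ge0.
move: (rn (u n)) (rn (u n0)) (rn _) (\sum_(i < n0) _) h h1 => x y z t h h1 h2.
lra.
Qed.

Lemma cauchyS_D u v : cauchyS u -> cauchyS v -> cauchyS (fun n => u n + v n).
Proof.
move=> [Su cu] [Sv cv]; split=> [n|e e0]; first exact: Sigma_cD.
have e2 : 0 < e / 2 by rewrite divr_gt0.
have [n1 h1] := cu _ e2; have [n2 h2] := cv _ e2; exists (maxn n1 n2) => m n.
rewrite !geq_max => /andP[m1 m2] /andP[l1 l2].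
have := h1 _ _ m1 l1; have := h2 _ _ m2 l2.
have -> : u m + v m - (u n + v n) = (u m - u n) + (v m - v n).
  by rewrite opprD addrACA.
have := rnD p1 Glc Ghaus (Sigma_cB (Su m) (Su n)) (Sigma_cB (Sv m) (Sv n)).
move: (rn (u m - u n)) (rn (v m - v n)) (rn _) => x y z h a1 a2.
by apply: le_lt_trans h _; rewrite [ltRHS](splitr e) ltrD.
Qed.

Lemma cauchyS_Z k u : cauchyS u -> cauchyS (fun n => k *: u n).
Proof.
move=> [Su cu]; split=> [n|e e0]; first exact: Sigma_cZ.
have D0 : 0 < nc k + 1 by rewrite ltr_wpDl ?nc_ge0.
have [n0 h0] := cu _ (divr_gt0 e0 D0); exists n0 => m n hm hn.
rewrite -scalerBr; have Smn := Sigma_cB (Su m) (Su n).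
apply: le_lt_trans (rnZ p1 Glc Ghaus _ Smn) _.
have := h0 m n hm hn; rewrite ltr_pdivlMr//; have := rn_ge0 p1 Glc Ghaus Smn.
move: (rn _) => t t0; rewrite mulrDr mulr1 mulrC => h.
by apply: le_lt_trans h; rewrite lerDl.
Qed.

Lemma convBl f g h : Sigma_c f -> Sigma_c g -> Sigma_c h ->
  conv (f - g) h = conv f h - conv g h.
Proof.
move=> Sf Sg Sh; have [_ _ eh] := Sh; apply/funext => e.
rewrite addCE [(- _) e]/(- conv g h e) !conv_lambda (lambdaDl Glc Ghaus)//; last exact: Sigma_cN.
by rewrite addCE -scaleN1r (lambdaZl Glc Ghaus)// mulN1r.
Qed.

Lemma convBr f g h : Sigma_c f -> Sigma_c g -> Sigma_c h ->
  conv h (f - g) = conv h f - conv h g.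
Proof.
move=> Sf Sg Sh; have [_ _ ef] := Sf; have [_ _ eg] := Sg; apply/funext => e.
have [_ _ eg'] := Sigma_cN Sg.
rewrite addCE [(- _) e]/(- conv h g e) !conv_lambda (lambdaDr Glc Ghaus)//.
rewrite addCE (_ : - g = (fun e => -1 * g e)); last by apply/funext => c; rewrite mulN1r.
by rewrite (lambdaZr Glc Ghaus)// mulN1r.
Qed.

Lemma rn_conv_dist f f' g g' : Sigma_c f -> Sigma_c f' -> Sigma_c g -> Sigma_c g' ->
  rn (conv f g - conv f' g') <= rn (f - f') * rn g + rn f' * rn (g - g').
Proof.
move=> Sf Sf' Sg Sg'.
have -> : conv f g - conv f' g' = conv (f - f') g + conv f' (g - g').
  by rewrite convBl// convBr// addrA subrK.
have S1 := Sigma_cB Sf Sf'; have S2 := Sigma_cB Sg Sg'.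
apply: le_trans (rnD p1 Glc Ghaus (conv_Sigma Glc Ghaus Get S1 Sg) (conv_Sigma Glc Ghaus Get Sf' S2)) _.
by apply: lerD; exact: rnM.
Qed.

Lemma cauchyS_M u v : cauchyS u -> cauchyS v -> cauchyS (fun n => conv (u n) (v n)).
Proof.
move=> cu' cv'; have [Su cu] := cu'; have [Sv cv] := cv'.
split=> [n|e e0]; first exact: conv_Sigma.
have [C C0 hC] := cauchyS_bounded cu'; have [D D0 hD] := cauchyS_bounded cv'.
have K0 : 0 < C + D + 1 by lra.
have [n1 h1] := cu _ (divr_gt0 e0 K0); have [n2 h2] := cv _ (divr_gt0 e0 K0).
exists (maxn n1 n2) => m n; rewrite !geq_max => /andP[m1 m2] /andP[l1 l2].
apply: le_lt_trans (rn_conv_dist (Su m) (Su n) (Sv m) (Sv n)) _.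
have b1 := h1 _ _ m1 l1; have b2 := h2 _ _ m2 l2.
have r1 := rn_ge0 p1 Glc Ghaus (Sigma_cB (Su m) (Su n)).
have r2 := rn_ge0 p1 Glc Ghaus (Sigma_cB (Sv m) (Sv n)).
have r3 := rn_ge0 p1 Glc Ghaus (Sv m); have r4 := rn_ge0 p1 Glc Ghaus (Su n).
have b3 := hD m; have b4 := hC n.
move: (rn (u m - u n)) (rn (v m)) (rn (u n)) (rn (v m - v n)) r1 r2 r3 r4 b1 b2 b3 b4.
move=> x s t y r1 r2 r3 r4; rewrite !ltr_pdivlMr// => b1 b2 b3 b4.
have c1 : x * s <= x * D by apply: ler_wpM2l.
have c2 : t * y <= C * y by apply: ler_wpM2r.
have [xy|yx] := leP x y.
  have : x * D <= y * D by apply: ler_wpM2r.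
  by nra.
have : C * y <= C * x by apply: ler_wpM2l => //; exact: ltW.
by nra.
Qed.

Lemma rep_D u v a b : rep u a -> rep v b -> rep (fun n => u n + v n) (Fadd a b).
Proof.
move=> ra rb; have ca := repr_cauchy a; have cb := repr_cauchy b.
have cu := rep_cauchy ra; have cv := rep_cauchy rb.
apply: (rep_change (rep_class a (cauchyS_D ca cb))); first exact: cauchyS_D.
apply: small_le (small_add (rep_small (rep_repr a) ra) (rep_small (rep_repr b) rb)) _ => n.
rewrite opprD addrACA.
exact: (rnD p1 Glc Ghaus (Sigma_cB (ca.1 n) (cu.1 n)) (Sigma_cB (cb.1 n) (cv.1 n))).
Qed.

Lemma rep_Z k u a : rep u a -> rep (fun n => k *: u n) (Fscale k a).
Proof.
move=> ra; have ca := repr_cauchy a; have cu := rep_cauchy ra.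
apply: (rep_change (rep_class a (cauchyS_Z k ca))); first exact: cauchyS_Z.
apply: small_le (small_scale (nc_ge0 k) (rep_small (rep_repr a) ra)) _ => n.
by rewrite -scalerBr; exact: (rnZ p1 Glc Ghaus k (Sigma_cB (ca.1 n) (cu.1 n))).
Qed.

Lemma rep_M u v a b : rep u a -> rep v b -> rep (fun n => conv (u n) (v n)) (Fmul a b).
Proof.
move=> ra rb; have ca := repr_cauchy a; have cb := repr_cauchy b.
have cu := rep_cauchy ra; have cv := rep_cauchy rb.
apply: (rep_change (rep_class a (cauchyS_M ca cb))); first exact: cauchyS_M.
have [C C0 hC] := cauchyS_bounded cu; have [D D0 hD] := cauchyS_bounded cb.
have s1 := small_scale D0 (rep_small (rep_repr a) ra).
have s2 := small_scale C0 (rep_small (rep_repr b) rb).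
apply: small_le (small_add s1 s2) _ => n.
apply: le_trans (rn_conv_dist (ca.1 n) (cu.1 n) (cb.1 n) (cv.1 n)) _.
have r1 := rn_ge0 p1 Glc Ghaus (Sigma_cB (ca.1 n) (cu.1 n)).
have r2 := rn_ge0 p1 Glc Ghaus (Sigma_cB (cb.1 n) (cv.1 n)).
apply: lerD; first by rewrite mulrC; exact: (ler_wpM2r r1 (hD n)).
exact: (ler_wpM2r r2 (hC n)).
Qed.

Lemma cauchyS_norm u : cauchyS u -> cauchyR (fun n => rn (u n)).
Proof.
move=> [Su cu] e /cu[n0 h0]; exists n0 => m n hm hn.
apply: le_lt_trans (h0 m n hm hn); exact: rn_dist.
Qed.

Lemma cauchyS_eval u e : cauchyS u -> exists l, small (fun n => nc (u n e - l)).
Proof.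
move=> [Su cu]; apply: cauchyC_cvg => eps /cu[n0 h0]; exists n0 => m n hm hn.
apply: le_lt_trans (h0 m n hm hn).
exact: (rn_eval p1 Glc Ghaus e (Sigma_cB (Su m) (Su n))).
Qed.

Fact nrm_subproof a : {r : R | r = fine (Fnorm a)}.
Proof. by exists (fine (Fnorm a)). Qed.

Definition nrm a : R := sval (nrm_subproof a).

Lemma nrm_fine a : nrm a = fine (Fnorm a).
Proof. exact: (svalP (nrm_subproof a)). Qed.

Lemma rep_norm u a : rep u a -> small (fun n => `|rn (u n) - nrm a|).
Proof.
move=> ra; have ca := repr_cauchy a; have [l hl] := cauchyR_cvg (cauchyS_norm ca).
have nE : Fnorm a = l%:E.
  rewrite /Fnorm /cnorm; have -> : (fun n => reduced_norm p (repr a n)) = (fun n => (rn (repr a n))%:E).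
    by apply/funext => n; rewrite rnE//; exact: ca.1.
  by apply/cvg_lim => //; apply: cvg_EFin; [near=> n|exact: small_cvg].
rewrite nrm_fine nE /=.
apply: small_le (small_add hl (rep_small ra (rep_repr a))) _ => n.
rewrite /=; have := rn_dist (rep_Sigma n ra) (ca.1 n).
move: (rn (u n)) (rn (repr a n)) (rn (u n - repr a n)) => x y z h.
have -> : x - l = (y - l) + (x - y) by ring.
by apply: le_trans (ler_normD _ _) _; rewrite lerD2l.
Unshelve. all: by end_near. Qed.

Lemma nrmE a : Fnorm a = (nrm a)%:E.
Proof.
have ca := repr_cauchy a; have [l hl] := cauchyR_cvg (cauchyS_norm ca).
rewrite nrm_fine /Fnorm /cnorm; have -> : (fun n => reduced_norm p (repr a n)) = (fun n => (rn (repr a n))%:E).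
  by apply/funext => n; rewrite rnE//; exact: ca.1.
suff -> : lim ((rn (repr a n))%:E @[n --> \oo]) = l%:E by [].
by apply/cvg_lim => //; apply: cvg_EFin; [near=> n|exact: small_cvg].
Unshelve. all: by end_near. Qed.

Fact jmap_subproof a : {f : E -> R[i] | forall e,
  (exists l, small (fun n => nc (repr a n e - l))) -> small (fun n => nc (repr a n e - f e))}.
Proof.
exists (fun e => if pselect (exists l, small (fun n => nc (repr a n e - l))) is left h
  then sval (cid h) else 0) => e; case: pselect => // h _.
by case: cid.
Qed.

(** Renault's map [j]: an element of the completion seen as a function. *)
Definition jmap a : E -> R[i] := sval (jmap_subproof a).

Lemma rep_eval u a e : rep u a -> small (fun n => nc (u n e - jmap a e)).
Proof.
move=> ra; have ca := repr_cauchy a.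
have hl : small (fun n => nc (repr a n e - jmap a e)).
  by apply: (svalP (jmap_subproof a)); exact: cauchyS_eval.
apply: small_le (small_add hl (rep_small ra (rep_repr a))) _ => n.
rewrite /=; have h : nc (u n e - repr a n e) <= rn (u n - repr a n).
  exact: (rn_eval p1 Glc Ghaus e (Sigma_cB (rep_Sigma n ra) (ca.1 n))).
move: (u n e) (repr a n e) (jmap a e) (rn (u n - repr a n)) h => x y l z h.
have -> : x - l = (y - l) + (x - y) by ring.
by apply: le_trans (ncD _ _) _; rewrite lerD2l.
Qed.

End CompletedAlgebra.

#[global] Opaque Fadd Fscale Fmul Fnorm.

(** * Elements of the completion as functions *)

Section PartialPermutations.
Variables (R : realType) (p : R).
Hypothesis p1 : 1 <= p.
Let p0 : 0 < p. Proof. exact: lt_le_trans ltr01 p1. Qed.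

Lemma nc_sum_single (T : eqType) (s : seq T) (F : T -> R[i]) : uniq s ->
  (forall g h, g \in s -> h \in s -> F g != 0 -> F h != 0 -> g = h) ->
  nc (\sum_(g <- s) F g) `^ p <= \sum_(g <- s) nc (F g) `^ p.
Proof.
move=> us sg; have [[g gs Fg]|nF] := pselect (exists2 g, g \in s & F g != 0).
  rewrite (bigD1_seq g)//= big1_seq ?addr0; last first.
    move=> h /andP[hg hs]; apply/eqP; apply: contraNT hg => Fh.
    by rewrite (sg h g).
  rewrite (bigD1_seq g)//= lerDl; apply: sumr_ge0 => h _; exact: powR_ge0.
rewrite big1_seq ?Normc.normc0 ?powR0 ?gt_eqF//.
  by apply: sumr_ge0 => h _; exact: powR_ge0.
move=> h /andP[_ hs]; apply/eqP; apply: contra_notT nF => Fh.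
by exists h.
Qed.

Lemma sum_single_le (T : eqType) (s : seq T) (F : T -> R[i]) M : uniq s -> 0 <= M ->
  (forall g h, g \in s -> h \in s -> F g != 0 -> F h != 0 -> g = h) ->
  (forall g, nc (F g) <= M) -> \sum_(g <- s) nc (F g) `^ p <= M `^ p.
Proof.
move=> us M0 sg FM; have [[g gs Fg]|nF] := pselect (exists2 g, g \in s & F g != 0).
  rewrite (bigD1_seq g)//= big1_seq ?addr0; first by rewrite powRp_le ?nc_ge0.
  move=> h /andP[hg hs]; suff -> : F h = 0 by rewrite Normc.normc0 powR0 ?gt_eqF.
  by apply/eqP; apply: contraNT hg => Fh; rewrite (sg h g).
rewrite big1_seq ?powR_ge0// => h /andP[_ hs].
suff -> : F h = 0 by rewrite Normc.normc0 powR0 ?gt_eqF.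
by apply/eqP; apply: contra_notT nF => Fh; exists h.
Qed.

(** Each inner sum has at most one term, and after exchanging the order of
    summation each [h] is met at most once. *)
Lemma partial_permutation_bound (T : eqType) (s l : seq T) (m : T -> T -> R[i])
    (t : T -> R[i]) M : uniq s -> uniq l -> 0 <= M ->
  (forall g h h', g \in s -> h \in l -> h' \in l -> m g h != 0 -> m g h' != 0 -> h = h') ->
  (forall g g' h, g \in s -> g' \in s -> h \in l -> m g h != 0 -> m g' h != 0 -> g = g') ->
  (forall g h, nc (m g h) <= M) ->
  \sum_(g <- s) nc (\sum_(h <- l) m g h * t h) `^ p <= M `^ p * \sum_(h <- l) nc (t h) `^ p.
Proof.
move=> us ul M0 row col mM.
apply: (@le_trans _ _ (\sum_(g <- s) \sum_(h <- l) nc (m g h) `^ p * nc (t h) `^ p)).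
  rewrite big_seq [leRHS]big_seq; apply: ler_sum => g gs.
  under [leRHS]eq_bigr do rewrite -powRM ?nc_ge0// -ncM.
  apply: nc_sum_single => // h h' hl hl' n n'; apply: (row g) => //.
    by apply: contra_neq n => ->; rewrite mul0r.
  by apply: contra_neq n' => ->; rewrite mul0r.
rewrite exchange_big mulr_sumr big_seq [leRHS]big_seq; apply: ler_sum => h hl.
rewrite -mulr_suml; apply: ler_wpM2r; first exact: powR_ge0.
by apply: sum_single_le => // g g' gs gs' n n'; apply: (col g g' h).
Qed.

End PartialPermutations.

Section FiniteVectors.
Variables (R : realType) (p : R) (G : topGroupoid) (E : twist R G).
Hypotheses (p1 : 1 <= p) (Glc : locally_compact [set: G]) (Ghaus : hausdorff_space G).
Implicit Types (x g h : G) (e c d : E) (w : G -> R[i]).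
Local Notation pi := (@tw_pi _ _ E).
Local Notation lift := (tw_lift E).
Let p0 : 0 < p. Proof. exact: lt_le_trans ltr01 p1. Qed.

Definition fvec (s : seq G) w : E -> R[i] := fun e => \sum_(g <- s) w g * dvec (lift g) e.

Lemma fvec_neq0 s w e : fvec s w e != 0 -> pi e \in s.
Proof.
by move=> /sum_neq0[g gs]; rewrite mulf_eq0 negb_or => /andP[_ /dvec_neq0 ->]; rewrite pi_lift.
Qed.

Lemma fvec_lift s w g : uniq s -> g \in s -> fvec s w (lift g) = w g.
Proof.
move=> us gs; rewrite /fvec (bigD1_seq g)//= dvec1 mulr1 big1 ?addr0// => h hg.
suff -> : dvec (lift h) (lift g) = 0 by rewrite mulr0.
by apply/eqP; apply: contraNT hg => /dvec_neq0; rewrite !pi_lift => ->.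
Qed.

Lemma fvec_equivariant s w : equivariant (fvec s w).
Proof.
move=> z e cz; rewrite /fvec mulr_sumr; apply: eq_bigr => g _.
by rewrite (@dvec_equivariant _ _ E _ z)// mulrCA.
Qed.

Lemma fvec_Lp x s w r : uniq s -> (forall g, g \in s -> src g = x) -> 0 <= r ->
  \sum_(g <- s) nc (w g) `^ p <= r `^ p ->
  Lp p x (fvec s w) /\ Lpn p x (fvec s w) <= r.
Proof.
move=> us sx r0 hr.
have b : pbounded p x (fvec s w) (r `^ p).
  move=> s' us' sx'; apply: le_trans hr.
  rewrite (bigID (mem s))/= [X in _ + X]big1 ?addr0; last first.
    move=> g gs; suff -> : fvec s w (lift g) = 0 by rewrite Normc.normc0 powR0 ?gt_eqF.
    by apply/eqP; apply: contraNT gs => /fvec_neq0; rewrite pi_lift.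
  rewrite -big_filter; set s1 := [seq _ <- _ | _].
  have us1 : uniq s1 by exact: filter_uniq.
  have s1s g : g \in s1 -> g \in s by rewrite mem_filter => /andP[].
  clearbody s1.
  apply: (@le_trans _ _ (\sum_(g <- s1) nc (w g) `^ p)).
    by rewrite big_seq [leRHS]big_seq; apply: ler_sum => g /s1s gs; rewrite fvec_lift.
  rewrite [leRHS](bigID (mem s1))/= -[X in X <= _]addr0; apply: lerD; last first.
    by apply: sumr_ge0 => g _; exact: powR_ge0.
  rewrite -[leRHS]big_filter (perm_big [seq g <- s | g \in s1])//=.
  apply: uniq_perm => //; first exact: filter_uniq.
  move=> g; rewrite mem_filter; case: (boolP (g \in s1)) => gs //=; by rewrite (s1s _ gs).
have L : Lp p x (fvec s w).
  apply/LpP => //; split; [|exact: fvec_equivariant|by exists (r `^ p)].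
  move=> e nex; apply/eqP; apply: contra_notT nex => /fvec_neq0/sx h.
  exact/src_fibreE.
by split => //; apply/Lpn_leP.
Qed.

Lemma fvec_Lp' x s w : uniq s -> (forall g, g \in s -> src g = x) ->
  Lp p x (fvec s w).
Proof.
move=> us sx; set S := \sum_(g <- s) nc (w g) `^ p.
have S0 : 0 <= S by apply: sumr_ge0 => g _; exact: powR_ge0.
have [] := @fvec_Lp x s w (S `^ p^-1) us sx; rewrite ?powR_ge0//.
by rewrite -powRrM mulVf ?gt_eqF// powRr1.
Qed.

Lemma fvec_norm x s w : uniq s -> (forall g, g \in s -> src g = x) ->
  Lpn p x (fvec s w) `^ p = \sum_(g <- s) nc (w g) `^ p.
Proof.
move=> us sx; set S := \sum_(g <- s) nc (w g) `^ p.
have S0 : 0 <= S by apply: sumr_ge0 => g _; exact: powR_ge0.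
have SE : (S `^ p^-1) `^ p = S by rewrite -powRrM mulVf ?gt_eqF// powRr1.
have [L n] := @fvec_Lp x s w (S `^ p^-1) us sx (powR_ge0 _ _) (eq_ind_r (fun t => _ <= t) (lexx _) SE).
apply/eqP; rewrite eq_le; apply/andP; split.
  by rewrite -SE powRp_le ?Lpn_ge0 ?powR_ge0.
have := Lpn_sum p1 Ghaus L us sx.
by rewrite [X in X <= _ -> _]big_seq [X in _ -> X <= _]big_seq (eq_bigr (fun g => nc (w g) `^ p))// => g gs; rewrite fvec_lift.
Qed.

Lemma fvec_add s w w' : fvec s (fun g => w g + w' g) = fvec s w + fvec s w'.
Proof.
apply/funext => e; rewrite addCE /fvec -big_split; apply: eq_bigr => g _.
by rewrite /= mulrDl.
Qed.

Lemma fvec_le_sum x s w : uniq s -> (forall g, g \in s -> src g = x) ->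
  Lpn p x (fvec s w) <= \sum_(g <- s) nc (w g).
Proof.
move=> us sx; suff [] : Lp p x (fvec s w) /\ Lpn p x (fvec s w) <= \sum_(g <- s) nc (w g) by [].
have -> : fvec s w = \sum_(g <- s) (fun e => w g * dvec (lift g) e).
  by apply/funext => e; rewrite fct_sumE.
elim: s us sx => [|g s IH] /=.
  by rewrite !big_nil => _ _; have [L0 ->] := Lp0 E p1 Glc Ghaus x.
move=> /andP[_ us] sx; have [|L1 n1] := IH us.
  by move=> h hs; apply: sx; rewrite inE hs orbT.
have gx : src_fibre E x (lift g) by apply/src_fibreE; rewrite pi_lift sx// mem_head.
have [Ld nd] := dvec_Lp p1 Glc Ghaus gx.
have [L2 n2] := LpZ p1 Glc Ghaus (w g) Ld.
rewrite !big_cons; have [L3 n3] := LpD p1 L2 L1; split => //.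
apply: le_trans n3 _; apply: lerD => //; apply: le_trans n2 _.
by rewrite -[leRHS]mulr1; apply: ler_wpM2l => //; exact: nc_ge0.
Qed.

Lemma lambda_fvec x f w e (s : seq G) : Sigma_c f -> uniq s ->
  (forall g, g \in s -> src g = x) -> src_fibre E x e ->
  lambda x f (fvec s w) e = \sum_(h <- s) f (gmul e (ginv (lift h))) * w h.
Proof.
move=> Sf us sx ex; have [_ _ ef] := Sf.
rewrite (@lambda_sumE _ _ _ Ghaus x f _ e s)//.
- by apply: eq_big_seq => h hs; rewrite fvec_lift.
- exact: fvec_equivariant.
- move=> c cx cs; suff -> : fvec s w c = 0 by rewrite mulr0.
  by apply/eqP; apply: contraNT cs; exact: fvec_neq0.
Qed.

End FiniteVectors.
Arguments fvec {R G} E s w _.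

Section JMap.
Variables (R : realType) (p : R) (G : topGroupoid) (E : twist R G).
Hypotheses (p1 : 1 <= p) (Glc : locally_compact [set: G]) (Ghaus : hausdorff_space G).
Hypothesis Get : etale G.
Local Notation A := (Fplambda p E).
Local Notation rn := (rn p (E := E)).
Local Notation pi := (@tw_pi _ _ E).
Local Notation lift := (tw_lift E).
Implicit Types (f g : E -> R[i]) (u v w : nat -> E -> R[i]) (a b : A) (e c d : E).

Lemma jD a b e : jmap (Fadd a b) e = jmap a e + jmap b e.
Proof.
have ra := rep_repr p1 Glc Ghaus a; have rb := rep_repr p1 Glc Ghaus b.
have := rep_eval p1 Glc Ghaus e (rep_D p1 Glc Ghaus ra rb).
have ha := rep_eval p1 Glc Ghaus e ra; have hb := rep_eval p1 Glc Ghaus e rb.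
move=> h; apply: small_limC h _; apply: small_le (small_add ha hb) _ => n /=.
rewrite addCE; move: (repr a n e) (repr b n e) (jmap a e) (jmap b e) => x y z t.
have -> : x + y - (z + t) = (x - z) + (y - t) by ring.
exact: ncD.
Qed.

Lemma jZ k a e : jmap (Fscale k a) e = k * jmap a e.
Proof.
have ra := rep_repr p1 Glc Ghaus a.
have := rep_eval p1 Glc Ghaus e (rep_Z p1 Glc Ghaus k ra).
have ha := rep_eval p1 Glc Ghaus e ra.
move=> h; apply: small_limC h _; apply: small_le (small_scale (nc_ge0 k) ha) _ => n /=.
rewrite scaleCE; move: (repr a n e) (jmap a e) => x y.
have -> : k * x - k * y = k * (x - y) by ring.
by rewrite ncM.
Qed.

Definition Fsub a b : A := Fadd a (Fscale (-1) b).

Lemma jB a b e : jmap (Fsub a b) e = jmap a e - jmap b e.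
Proof. by rewrite jD jZ mulN1r. Qed.

Lemma nrm_ge0 a : 0 <= nrm a.
Proof.
have h := rep_norm p1 Glc Ghaus (rep_repr p1 Glc Ghaus a).
have [Sa _] := repr_cauchy p1 Glc Ghaus a.
rewrite -oppr_le0; apply: small_cst_le h _ => n /=.
have := rn_ge0 p1 Glc Ghaus (Sa n); move: (rn _) (nrm a) => x y x0.
have := ler_norm (x - y); lra.
Qed.

Lemma rep_nrm_le u a C : rep u a -> (exists n0, forall n, (n0 <= n)%N -> rn (u n) <= C) ->
  nrm a <= C.
Proof.
move=> /(rep_norm p1 Glc Ghaus) h [n0 h0]; rewrite -subr_le0 leNgt; apply/negP => e0.
have [n1 h1] := h _ e0.
have := h0 _ (leq_maxl n0 n1); have := h1 _ (leq_maxr n0 n1).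
move: (rn _) (nrm a) => x y; rewrite ltr_norml => /andP[h2 h3]; lra.
Qed.

Lemma rep_nrm_near u a eps : rep u a -> 0 < eps ->
  exists n0, forall n, (n0 <= n)%N -> `|rn (u n) - nrm a| < eps.
Proof. by move=> /(rep_norm p1 Glc Ghaus) h /h. Qed.

Lemma j_le a e : nc (jmap a e) <= nrm a.
Proof.
have ra := rep_repr p1 Glc Ghaus a; have [Sa _] := repr_cauchy p1 Glc Ghaus a.
have h := small_add (rep_eval p1 Glc Ghaus e ra) (rep_norm p1 Glc Ghaus ra).
rewrite -subr_le0; apply: small_cst_le h _ => n /=.
have := rn_eval p1 Glc Ghaus e (Sa n).
move: (repr a n e) (jmap a e) (rn _) (nrm a) => x y r s xr.
have h1 := nc_dist x y; have h2 := ler_norm (r - s).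
have := ler_norm (nc y - nc x); rewrite distrC; lra.
Qed.

Lemma nrmM a b : nrm (Fmul a b) <= nrm a * nrm b.
Proof.
have ra := rep_repr p1 Glc Ghaus a; have rb := rep_repr p1 Glc Ghaus b.
have [Sa _] := repr_cauchy p1 Glc Ghaus a; have [Sb _] := repr_cauchy p1 Glc Ghaus b.
have [C C0 hC] := cauchyS_bounded p1 Glc Ghaus (repr_cauchy p1 Glc Ghaus b).
have h := rep_norm p1 Glc Ghaus (rep_M p1 Glc Ghaus Get ra rb).
have h1 := small_scale C0 (rep_norm p1 Glc Ghaus ra).
have h2 := small_scale (nrm_ge0 a) (rep_norm p1 Glc Ghaus rb).
rewrite -subr_le0; apply: small_cst_le (small_add h (small_add h1 h2)) _ => n /=.
have := rnM p1 Glc Ghaus Get (Sa n) (Sb n); have := hC n.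
have := rn_ge0 p1 Glc Ghaus (Sb n); have := nrm_ge0 a.
move: (rn (conv _ _)) (rn (repr a n)) (rn (repr b n)).
move: (nrm (Fmul a b)) (nrm a) (nrm b) => x y z r s t y0 t0 tC h4.
have h5 := ler_norm (- (r - x)); rewrite normrN in h5.
have h6 : (s - y) * t <= C * `|s - y|.
  rewrite mulrC; apply: le_trans (ler_wpM2l t0 (ler_norm _)) _.
  by apply: ler_wpM2r.
have h7 : y * (t - z) <= y * `|t - z| by apply: ler_wpM2l => //; exact: ler_norm.
nra.
Qed.

(** The embedding of [Sigma_c] into its completion by constant sequences, as a
    relation. *)
Definition iota f a := rep (fun _ => f) a.

Lemma iota_ex f : Sigma_c f -> exists a, iota f a.
Proof.
move=> Sf; apply: rep_ex => //; split=> // eps e0; exists 0%N => m n _ _.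
by rewrite subrr (rn0 E p1 Glc Ghaus).
Qed.

Lemma iota_j f a : iota f a -> jmap a = f.
Proof.
move=> ra; apply/funext => e; apply/esym/eqP; rewrite -subr_eq0 -nc_eq0 eq_le nc_ge0 andbT.
exact: small_cst_le (rep_eval p1 Glc Ghaus e ra) _.
Qed.

Lemma iota_Sigma f a : iota f a -> Sigma_c f.
Proof. by move=> /(rep_Sigma p1 Glc Ghaus 0). Qed.

Lemma iota_approx a eps : 0 < eps -> exists f b,
  [/\ Sigma_c f, iota f b & nrm (Fsub a b) < eps].
Proof.
move=> e0; have ra := rep_repr p1 Glc Ghaus a.
have [Sa ca] := repr_cauchy p1 Glc Ghaus a.
have [n0 h0] := ca (eps / 2) (divr_gt0 e0 (ltr0n _ 2)).
have [b rb] := iota_ex (Sa n0); exists (repr a n0), b; split => //.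
apply: (@le_lt_trans _ _ (eps / 2)); last by lra.
apply: (rep_nrm_le (rep_D p1 Glc Ghaus ra (rep_Z p1 Glc Ghaus (-1) rb))).
exists n0 => n n0n; rewrite scaleN1r; apply: ltW; exact: h0.
Qed.

Lemma FmulBl a b (c : A) : Fmul (Fsub a b) c = Fsub (Fmul a c) (Fmul b c).
Proof.
have ra := rep_repr p1 Glc Ghaus a; have rb := rep_repr p1 Glc Ghaus b.
have rc := rep_repr p1 Glc Ghaus c.
have [Sa _] := repr_cauchy p1 Glc Ghaus a; have [Sb _] := repr_cauchy p1 Glc Ghaus b.
have [Sc _] := repr_cauchy p1 Glc Ghaus c.
have h1 := rep_M p1 Glc Ghaus Get (rep_D p1 Glc Ghaus ra (rep_Z p1 Glc Ghaus (-1) rb)) rc.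
have h2 := rep_D p1 Glc Ghaus (rep_M p1 Glc Ghaus Get ra rc)
  (rep_Z p1 Glc Ghaus (-1) (rep_M p1 Glc Ghaus Get rb rc)).
apply: (rep_inj p1 Glc Ghaus h1); apply: (eq_rect _ (fun u => rep u _) h2); apply/funext => n.
by rewrite !scaleN1r (convBl Glc Ghaus (Sa n) (Sb n) (Sc n)).
Qed.

Lemma FmulBr a b (c : A) : Fmul c (Fsub a b) = Fsub (Fmul c a) (Fmul c b).
Proof.
have ra := rep_repr p1 Glc Ghaus a; have rb := rep_repr p1 Glc Ghaus b.
have rc := rep_repr p1 Glc Ghaus c.
have [Sa _] := repr_cauchy p1 Glc Ghaus a; have [Sb _] := repr_cauchy p1 Glc Ghaus b.
have [Sc _] := repr_cauchy p1 Glc Ghaus c.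
have h1 := rep_M p1 Glc Ghaus Get rc (rep_D p1 Glc Ghaus ra (rep_Z p1 Glc Ghaus (-1) rb)).
have h2 := rep_D p1 Glc Ghaus (rep_M p1 Glc Ghaus Get rc ra)
  (rep_Z p1 Glc Ghaus (-1) (rep_M p1 Glc Ghaus Get rc rb)).
apply: (rep_inj p1 Glc Ghaus h1); apply: (eq_rect _ (fun u => rep u _) h2); apply/funext => n.
by rewrite !scaleN1r (convBr Glc Ghaus (Sa n) (Sb n) (Sc n)).
Qed.

Lemma j_continuous a : continuous (jmap a).
Proof.
apply/continuousC_near => e eps e0.
have e3 : 0 < eps / 3 by rewrite divr_gt0.
have [f [b [Sf rb hb]]] := iota_approx a e3.
have [cf _ _] := Sf.
apply: near_sub ((continuousC_near f).1 cf e _ e3) => t ft.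
have h1 := j_le (Fsub a b) e; have h2 := j_le (Fsub a b) t.
rewrite !jB (iota_j rb) in h1 h2.
move: h1 h2 hb ft; move: (jmap a e) (jmap a t) (f e) (f t) (nrm _) => x y z w n h1 h2 h3 h4.
have -> : x - y = ((x - z) + (z - w)) - (y - w) by ring.
by have := ncB (x - z + (z - w)) (y - w); have := ncD (x - z) (z - w); lra.
Qed.

Lemma j_equivariant a : equivariant (jmap a).
Proof.
move=> z e cz; have ra := rep_repr p1 Glc Ghaus a.
have [Sa _] := repr_cauchy p1 Glc Ghaus a.
apply: small_limC (rep_eval p1 Glc Ghaus (tw_act z e) ra) _.
apply: small_le (rep_eval p1 Glc Ghaus e ra) _ => n /=.
have [_ _ ef] := Sa n; rewrite ef//.
by rewrite -mulrBr nc_circleM.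
Qed.

(** Up to an error below [eps] the function is one of compact support. *)
Lemma j_compact a eps : 0 < eps -> compact [set e | eps <= nc (jmap a e)].
Proof.
move=> e0; have e2 : 0 < eps / 2 by rewrite divr_gt0.
have [f [b [Sf rb hb]]] := iota_approx a e2.
have [_ cK _] := Sf.
apply: (subclosed_compact _ cK).
  by apply: closed_nc_ge; exact: j_continuous.
move=> e /= he; apply: subset_closure => /=; apply/eqP => fe0.
have := j_le (Fsub a b) e; rewrite jB (iota_j rb) fe0 subr0; lra.
Qed.

(** The support lies over a subset of [G] on which range and source are
    injective, as for a normaliser of the diagonal. *)
Definition bisupported (phi : E -> R[i]) :=
  (forall e e', phi e != 0 -> phi e' != 0 -> src e = src e' -> pi e = pi e') /\
  (forall e e', phi e != 0 -> phi e' != 0 -> rng e = rng e' -> pi e = pi e').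

Lemma elementary_bisupported f : elementary f -> bisupported f.
Proof.
move=> ef; split=> e e' fe fe' h.
  exact: elementary_col ef _ _ h fe fe'.
exact: elementary_row ef _ _ h fe fe'.
Qed.

End JMap.

Section JProducts.
Variables (R : realType) (p : R) (G : topGroupoid) (E : twist R G).
Hypotheses (p1 : 1 <= p) (Glc : locally_compact [set: G]) (Ghaus : hausdorff_space G).
Hypothesis Get : etale G.
Local Notation A := (Fplambda p E).
Local Notation rn := (rn p (E := E)).
Local Notation pi := (@tw_pi _ _ E).
Local Notation lift := (tw_lift E).
Implicit Types (f : E -> R[i]) (u v w : nat -> E -> R[i]) (a b : A) (e c d : E).
Let p0 : 0 < p. Proof. exact: lt_le_trans ltr01 p1. Qed.

Lemma mul_dist (x y z w : R[i]) (r s t : R) : nc (y - w) <= s -> nc (x - w * z) <= r ->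
  r <= s * t -> nc (x - y * z) <= s * (t + nc z).
Proof.
move=> h1 h2 h3; have -> : x - y * z = (x - w * z) - (y - w) * z by ring.
apply: le_trans (ncB _ _) _; rewrite mulrDr ncM; apply: lerD.
  exact: le_trans h2 h3.
by apply: ler_wpM2r => //; exact: nc_ge0.
Qed.

Lemma mul_distr (x y z w : R[i]) (r s t : R) : nc (y - w) <= s -> nc (x - z * w) <= r ->
  r <= t * s -> nc (x - z * y) <= s * (t + nc z).
Proof. by move=> h1; rewrite mulrC [t * s]mulrC [z * y]mulrC; exact: mul_dist h1. Qed.

Lemma ratio_contra (C D y : R) : 0 < D -> 0 < C + 1 -> 0 <= y -> y < D / (C + 1) ->
  D <= y * C -> False.
Proof. by move=> D0 C0 y0; rewrite ltr_pdivlMr// => h1 h2; nra. Qed.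

Lemma small_sumC (T : Type) (s : seq T) (k : T -> R[i]) (w : T -> nat -> R[i]) (l : T -> R[i]) :
  (forall t, small (fun n => nc (w t n - l t))) ->
  small (fun n => nc (\sum_(t <- s) k t * w t n - \sum_(t <- s) k t * l t)).
Proof.
move=> h; elim: s => [|t s IH].
  apply: small_le (_ : small (fun _ => 0)) _; first by move=> e e0; exists 0%N.
  by move=> n; rewrite !big_nil subrr Normc.normc0.
apply: small_le (small_add (small_scale (nc_ge0 (k t)) (h t)) IH) _ => n /=.
rewrite !big_cons.
have -> (x y z r : R[i]) : x + y - (z + r) = (x - z) + (y - r) by ring.
by apply: le_trans (ncD _ _) _; rewrite -mulrBr ncM.
Qed.

Lemma small_sumCr (T : Type) (s : seq T) (k : T -> R[i]) (w : T -> nat -> R[i]) (l : T -> R[i]) :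
  (forall t, small (fun n => nc (w t n - l t))) ->
  small (fun n => nc (\sum_(t <- s) w t n * k t - \sum_(t <- s) l t * k t)).
Proof.
move=> h; apply: small_le (small_sumC s k h) _ => n /=.
have -> : \sum_(t <- s) w t n * k t = \sum_(t <- s) k t * w t n.
  by apply: eq_bigr => t _; rewrite mulrC.
have -> : \sum_(t <- s) l t * k t = \sum_(t <- s) k t * l t.
  by apply: eq_bigr => t _; rewrite mulrC.
by [].
Qed.

Lemma small_sumR (T : Type) (s : seq T) (w : T -> nat -> R) :
  (forall t, small (w t)) -> small (fun n => \sum_(t <- s) w t n).
Proof.
move=> h; elim: s => [|t s IH].
  apply: small_le (_ : small (fun _ => 0)) _; first by move=> e e0; exists 0%N.
  by move=> n; rewrite big_nil.
by apply: small_le (small_add (h t) IH) _ => n /=; rewrite big_cons.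
Qed.

(** For an approximating sequence [u], the finitely many entries in a finite
    window of [lambda_x (u_n)] converge to entries of [jmap a], and these form
    a partial permutation matrix; the window is chosen to carry the norm of one
    of the operators [lambda_x (u_m)] at a given vector. *)
Lemma bisupported_norm a M : bisupported (jmap a) -> 0 <= M ->
  (forall e, nc (jmap a e) <= M) -> nrm a <= M.
Proof.
move=> [colB rowB] M0 aM; rewrite -subr_le0 leNgt; apply/negP => e0.
set eps := nrm a - M in e0; have e2 : 0 < eps / 2 by rewrite divr_gt0.
have ra := rep_repr p1 Glc Ghaus a; set u := repr a in ra.
have [Su cu] := repr_cauchy p1 Glc Ghaus a.
have [m hm] := cu _ e2.
suff h : nrm a <= M + eps / 2.
  by move: e0 h; rewrite /eps; move: (nrm a) => y; lra.
apply: (rep_nrm_le p1 Glc Ghaus ra); exists m => n0 mn0.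
have N0 : 0 <= M + eps / 2 by rewrite addr_ge0// ltW.
apply: (rn_le p1 Glc Ghaus (Su n0) N0) => x xi ux Lx.
have [xoff exi _] := (LpP p1 Glc Ghaus x xi).1 Lx.
have Ll := lambda_Lp p1 Glc Ghaus (Su n0) Lx.
set X := Lpn p x xi; have X0 : 0 <= X by exact: Lpn_ge0.
apply/Lpn_leP => //; first exact: mulr_ge0.
move=> s us sx.
have ex g : exists K : seq G, g \in s -> [/\ uniq K, (forall h, h \in K -> src h = x) &
    forall c, src c = src (lift g) -> pi c \notin K -> u n0 (gmul (lift g) (ginv c)) = 0].
  have [gs|] := boolP (g \in s); last by exists [::].
  have [K [uK Kx hK]] := rowset Glc Ghaus (lift g) (Su n0).
  by exists K => _; split => // h /Kx ->; rewrite pi_lift sx.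
pose K g := sval (cid (ex g)).
have KP g : g \in s -> _ := svalP (cid (ex g)).
pose l := undup (flatten [seq K g | g <- s]).
have ul : uniq l by exact: undup_uniq.
have lx h : h \in l -> src h = x.
  rewrite mem_undup => /flattenP[_ /mapP[g gs ->]].
  by have [_ Kx _] := KP _ gs; exact: Kx.
have sx' g : g \in s -> src_fibre E x (lift g).
  by move=> gs; apply/src_fibreE; rewrite pi_lift sx.
pose t h := xi (lift h); pose eta := fvec E l t.
pose mat k g h := u k (gmul (lift g) (ginv (lift h))).
have lamE k g : g \in s -> lambda x (u k) eta (lift g) = \sum_(h <- l) mat k g h * t h.
  by move=> gs; rewrite (lambda_fvec Ghaus)//; exact: sx'.
have lam0 g : g \in s -> lambda x (u n0) xi (lift g) = \sum_(h <- l) mat n0 g h * t h.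
  move=> gs; have [uK Kx hK] := KP _ gs.
  rewrite (@lambda_row _ _ _ Ghaus x _ xi _ l)//; first exact: sx'.
  move=> c cg cl; apply: hK => //; apply: contra cl => cK.
  by rewrite mem_undup; apply/flattenP; exists (K g) => //; apply/mapP; exists g.
have tX : \sum_(h <- l) nc (t h) `^ p <= X `^ p by exact: (Lpn_sum p1 Ghaus Lx ul lx).
have [Leta neta] := fvec_Lp E p1 Glc Ghaus ul lx X0 tX.
pose jm g h := jmap a (gmul (lift g) (ginv (lift h))).
pose W k g := lambda x (u k) eta (lift g).
pose Wj g := \sum_(h <- l) jm g h * t h.
have nWj : Lpn p x (fvec E s Wj) <= M * X.
  have [|_ h] := fvec_Lp E p1 Glc Ghaus us sx (mulr_ge0 M0 X0) (w := Wj); last exact: h.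
  rewrite powRM//; apply: le_trans (ler_wpM2l (powR_ge0 _ _) tX).
  have slift g h : g \in s -> h \in l -> src (lift g) = src (lift h).
    by move=> gs hl; apply/src_pi_eq; rewrite !pi_lift sx// lx.
  apply: partial_permutation_bound => //.
  - move=> g h h' gs hl hl' n n'.
    have := rowB _ _ n n'; rewrite (rng_div (slift _ _ gs hl)) (rng_div (slift _ _ gs hl')) => /(_ erefl) q.
    have := congr1 (fun y => gmul (ginv y) g) q.
    rewrite (pi_mul (composable_div (slift _ _ gs hl))) (pi_mul (composable_div (slift _ _ gs hl'))).
    have sg h1 : h1 \in l -> src g = src h1 by move=> h1l; rewrite sx// lx.
    by rewrite !pi_inv !pi_lift (gpd_invD (sg _ hl)) (gpd_invD (sg _ hl')) !gpd_divK// -sg.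
  - move=> g g' h gs gs' hl n n'.
    have := colB _ _ n n'; rewrite (src_div (slift _ _ gs hl)) (src_div (slift _ _ gs' hl)) => /(_ erefl) q.
    have := congr1 (fun y => gmul y h) q.
    rewrite (pi_mul (composable_div (slift _ _ gs hl))) (pi_mul (composable_div (slift _ _ gs' hl))).
    have sg g1 : g1 \in s -> src g1 = src h by move=> g1s; rewrite sx// lx.
    by rewrite !pi_inv !pi_lift (gpd_divK (sg _ gs)) (gpd_divK (sg _ gs')).
  - by move=> g h; exact: aM.
have nW k : (m <= k)%N -> Lpn p x (fvec E s (W n0)) <=
    (eps / 2 * X + M * X) + \sum_(g <- s) nc (W k g - Wj g).
  move=> mk.
  have E1 : fvec E s (W n0) = fvec E s (fun g => lambda x (u n0 - u k) eta (lift g)) +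
      (fvec E s Wj + fvec E s (fun g => W k g - Wj g)).
    have [_ ee _] := (LpP p1 Glc Ghaus x eta).1 Leta.
    rewrite -!fvec_add; apply/funext => e; rewrite /fvec; apply: eq_bigr => g _.
    congr (_ * _); rewrite (lambdaDl Glc Ghaus x (Su n0) (Sigma_cN (Su k)) ee) addCE.
    rewrite -scaleN1r (lambdaZl Glc Ghaus x _ (Su k) ee) /W.
    by move: (lambda x (u n0) eta (lift g)) (lambda x (u k) eta (lift g)) (Wj g) => r q z; ring.
  rewrite E1.
  have L1 := fvec_Lp' E p1 Glc Ghaus (fun g => lambda x (u n0 - u k) eta (lift g)) us sx.
  have L2 := fvec_Lp' E p1 Glc Ghaus Wj us sx.
  have L3 := fvec_Lp' E p1 Glc Ghaus (fun g => W k g - Wj g) us sx.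
  have [L4 n4] := LpD p1 L2 L3; have [_ n5] := LpD p1 L1 L4.
  apply: le_trans n5 _; rewrite -addrA; apply: lerD; last first.
    by apply: le_trans n4 _; apply: lerD => //; exact: (fvec_le_sum E p1 Glc Ghaus).
  have Sd := Sigma_cB (Su n0) (Su k).
  have Ld := lambda_Lp p1 Glc Ghaus Sd Leta.
  have rX : rn (u n0 - u k) * Lpn p x eta <= eps / 2 * X.
    by apply: ler_pM; rewrite ?Lpn_ge0//; [exact: (rn_ge0 p1 Glc Ghaus Sd)|apply: ltW; exact: hm].
  apply: le_trans rX; apply: le_trans (rn_bound p1 Glc Ghaus Sd ux Leta).
  have [|_ h] := fvec_Lp E p1 Glc Ghaus us sx (Lpn_ge0 p x (lambda x (u n0 - u k) eta))
    (w := fun g => lambda x (u n0 - u k) eta (lift g)); last exact: h.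
  exact: (Lpn_sum p1 Ghaus Ld us sx).
have sW : small (fun k => \sum_(g <- s) nc (W k g - Wj g)).
  suff h g : small (fun k => if g \in s then nc (W k g - Wj g) else 0).
    apply: small_le (small_sumR s h) _ => k.
    by rewrite [leLHS]big_seq [leRHS]big_seq; apply: ler_sum => g ->.
  have [gs|gs] := boolP (g \in s); last first.
    by apply: small_le (_ : small (fun _ => 0)) _; first by move=> e e0'; exists 0%N.
  have h := small_sumCr l t (fun h => rep_eval p1 Glc Ghaus (gmul (lift g) (ginv (lift h))) ra).
  by apply: small_le h _ => k; rewrite /W lamE.
have nW0 : Lpn p x (fvec E s (W n0)) <= (M + eps / 2) * X.
  rewrite -subr_le0; have [n1 _] := sW 1 ltr01.
  suff h : small (fun k => \sum_(g <- s) nc (W (m + k)%N g - Wj g)).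
    apply: small_cst_le h _ => k; have := nW (m + k)%N (leq_addr _ _).
    by move: (Lpn _ _ _) (\sum_(g <- s) _) => y z hy; rewrite mulrDl; lra.
  by move=> d /sW[n2 h2]; exists n2 => k hk; apply: h2; rewrite (leq_trans hk)// leq_addl.
rewrite (eq_big_seq (fun g => nc (W n0 g) `^ p)); last first.
  by move=> g gs; rewrite lam0// /W lamE.
rewrite -(fvec_norm E p1 Glc Ghaus (W n0) us sx).
by rewrite (powRp_le p1) ?Lpn_ge0// mulr_ge0.
Qed.

(** A difference with all values zero is bisupported with bound zero. *)
Lemma j_inj a b : jmap a = jmap b -> a = b.
Proof.
move=> ab; have ra := rep_repr p1 Glc Ghaus a; have rb := rep_repr p1 Glc Ghaus b.
have z e : jmap (Fsub a b) e = 0 by rewrite (jB p1 Glc Ghaus) ab subrr.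
have n0 : nrm (Fsub a b) <= 0.
  apply: bisupported_norm => // [|e]; last by rewrite z Normc.normc0.
  by split=> e e'; rewrite !z eqxx.
apply: (rep_inj p1 Glc Ghaus ra); apply: (rep_change p1 Glc Ghaus rb).
  exact: rep_cauchy ra.
have rd := rep_D p1 Glc Ghaus ra (rep_Z p1 Glc Ghaus (-1) rb).
have [Sa _] := repr_cauchy p1 Glc Ghaus a; have [Sb _] := repr_cauchy p1 Glc Ghaus b.
move=> e /(rep_nrm_near p1 Glc Ghaus rd)[k hk]; exists k => n /hk.
rewrite scaleN1r (rn_distC p1 Glc Ghaus (Sb n) (Sa n)) -/(Fsub a b).
move: (rn _) (nrm _) n0 => x y n0; rewrite ltr_norml => /andP[_]; lra.
Qed.

Lemma j_iota_mul f a b e (K : seq G) : iota f a -> uniq K ->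
  (forall g, g \in K -> src g = src (pi e)) ->
  (forall c, src c = src e -> pi c \notin K -> f (gmul e (ginv c)) = 0) ->
  jmap (Fmul a b) e = \sum_(h <- K) f (gmul e (ginv (lift h))) * jmap b (lift h).
Proof.
move=> ra uK Kx hK; have rb := rep_repr p1 Glc Ghaus b.
have Sf := iota_Sigma p1 Glc Ghaus ra; have [Sb _] := repr_cauchy p1 Glc Ghaus b.
apply: small_limC (rep_eval p1 Glc Ghaus e (rep_M p1 Glc Ghaus Get ra rb)) _.
have h := small_sumC K (fun h => f (gmul e (ginv (lift h))))
  (fun h => rep_eval p1 Glc Ghaus (lift h) rb).
apply: small_le h _ => n /=; have [_ _ eb] := Sb n.
by rewrite (conv_row Ghaus Sf eb uK Kx hK).
Qed.

Lemma j_mul_iota f a b e (K : seq G) : iota f b -> uniq K ->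
  (forall g, g \in K -> src g = src (pi e)) ->
  (forall c, src c = src e -> pi c \notin K -> f c = 0) ->
  jmap (Fmul a b) e = \sum_(h <- K) jmap a (gmul e (ginv (lift h))) * f (lift h).
Proof.
move=> rb uK Kx hK; have ra := rep_repr p1 Glc Ghaus a.
have Sf := iota_Sigma p1 Glc Ghaus rb; have [Sa _] := repr_cauchy p1 Glc Ghaus a.
apply: small_limC (rep_eval p1 Glc Ghaus e (rep_M p1 Glc Ghaus Get ra rb)) _.
have h := small_sumCr K (fun h => f (lift h))
  (fun h => rep_eval p1 Glc Ghaus (gmul e (ginv (lift h))) ra).
apply: small_le h _ => n /=; have [_ _ ef] := Sf; have [_ _ ea] := Sa n.
rewrite conv_lambda (@lambda_sumE _ _ _ Ghaus _ _ f e K)//.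
- by move=> g /Kx ->; rewrite pi_src.
- move=> c cx cK; rewrite [f c]hK ?mulr0//.
  by move/src_fibreE : cx; rewrite pi_src => /src_pi_eq.
Qed.

Lemma j_term_act a b e c z : src c = src e -> circle z ->
  jmap a (gmul e (ginv (tw_act z c))) * jmap b (tw_act z c) =
  jmap a (gmul e (ginv c)) * jmap b c.
Proof.
by move=> ce cz; apply: lambda_term_act => //; exact: j_equivariant.
Qed.

(** With [a] approximated by an element of [Sigma_c] the product is a finite sum
    in which only the class of [c] survives; the error is at most the distance
    times [nrm b + |b(c)|]. *)
Lemma j_mul_col a b e c : src c = src e ->
  (forall d, src d = src e -> jmap b d != 0 -> pi d = pi c) ->
  jmap (Fmul a b) e = jmap a (gmul e (ginv c)) * jmap b c.
Proof.
move=> ce hb; apply/eqP; rewrite -subr_eq0 -nc_eq0 eq_le nc_ge0 andbT leNgt; apply/negP => n0.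
set D := nc _ in n0; pose C := nrm b + nc (jmap b c).
have C0 : 0 < C + 1.
  by rewrite ltr_wpDl// addr_ge0 ?nc_ge0//; exact: (nrm_ge0 p1 Glc Ghaus).
have [f [a' [Sf ra ha]]] := iota_approx p1 Glc Ghaus a (divr_gt0 n0 C0).
have ja := iota_j p1 Glc Ghaus ra.
have [K [uK Kx hK]] := rowset Glc Ghaus e Sf.
have E1 : jmap (Fmul a' b) e = f (gmul e (ginv c)) * jmap b c.
  rewrite (j_iota_mul b ra uK Kx hK).
  have [z cz ez] := lift_fibre c.
  have sl : src (lift (pi c)) = src e by rewrite -ce; apply: pi_eq_src; rewrite pi_lift.
  have := j_term_act a' b sl cz; rewrite -ez ja => ->.
  have zero h : h \in K -> h != pi c -> f (gmul e (ginv (lift h))) * jmap b (lift h) = 0.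
    move=> hK' hc; suff -> : jmap b (lift h) = 0 by rewrite mulr0.
    apply/eqP; apply: contraNT hc => nb; have := hb (lift h) _ nb; rewrite pi_lift => -> //.
    by apply/src_pi_eq; rewrite pi_lift Kx.
  have [cK|cK] := boolP (pi c \in K).
    rewrite (bigD1_seq (pi c))//= big1_seq ?addr0// => h /andP[hc hK'].
    exact: zero.
  rewrite big1_seq; last first.
    by move=> h /andP[_ hK']; apply: zero => //; apply: contraNneq cK => <-.
  by rewrite hK ?mul0r// ?pi_lift.
have h1 : nc (jmap a (gmul e (ginv c)) - f (gmul e (ginv c))) <= nrm (Fsub a a').
  by rewrite -ja -(jB p1 Glc Ghaus); exact: (j_le p1 Glc Ghaus).
have h2 : nc (jmap (Fmul a b) e - f (gmul e (ginv c)) * jmap b c) <= nrm (Fmul (Fsub a a') b).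
  rewrite -E1 -(jB p1 Glc Ghaus) -(FmulBl p1 Glc Ghaus Get).
  exact: (j_le p1 Glc Ghaus).
have h3 := nrmM p1 Glc Ghaus Get (Fsub a a') b.
have h4 := nrm_ge0 p1 Glc Ghaus b; have h5 := nrm_ge0 p1 Glc Ghaus (Fsub a a').
exact: (ratio_contra n0 C0 h5 ha (mul_dist h1 h2 h3)).
Qed.

(** The row version approximates the second factor instead. *)
Lemma j_mul_row a b e c : rng c = rng e ->
  (forall d, rng d = rng e -> jmap a d != 0 -> pi d = pi c) ->
  jmap (Fmul a b) e = jmap a c * jmap b (gmul (ginv c) e).
Proof.
move=> ce ha; apply/eqP; rewrite -subr_eq0 -nc_eq0 eq_le nc_ge0 andbT leNgt; apply/negP => n0.
set D := nc _ in n0; pose C := nrm a + nc (jmap a c).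
have C0 : 0 < C + 1.
  by rewrite ltr_wpDl// addr_ge0 ?nc_ge0//; exact: (nrm_ge0 p1 Glc Ghaus).
have [f [b' [Sf rb hb]]] := iota_approx p1 Glc Ghaus b (divr_gt0 n0 C0).
have jb := iota_j p1 Glc Ghaus rb.
have [K [uK Kx hK]] := colset Glc Ghaus (src (pi e)) Sf.
have hK' c' : src c' = src e -> pi c' \notin K -> f c' = 0.
  by move=> c'e; apply: hK; apply/src_fibreE/src_pi_eq.
pose d := gmul (ginv c) e.
have cvd : composable (ginv c) e by rewrite /composable srcV.
have de : src d = src e by rewrite /d src_mul.
have cd : gmul e (ginv d) = c.
  by rewrite /d gpd_invM// ginvK gpdVKl.
have E1 : jmap (Fmul a b') e = jmap a c * f d.
  rewrite (j_mul_iota a rb uK Kx hK').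
  have [z cz ez] := lift_fibre d.
  have sl : src (lift (pi d)) = src e by rewrite -de; apply: pi_eq_src; rewrite pi_lift.
  have := j_term_act a b' sl cz; rewrite -ez jb cd => ->.
  have zero h : h \in K -> h != pi d -> jmap a (gmul e (ginv (lift h))) * f (lift h) = 0.
    move=> hK'' hc; suff -> : jmap a (gmul e (ginv (lift h))) = 0 by rewrite mul0r.
    have sh : src (lift h) = src e by apply/src_pi_eq; rewrite pi_lift Kx.
    apply/eqP; apply: contraNT hc => na; have := ha _ _ na; rewrite rng_div// => /(_ erefl) q.
    have := congr1 (fun y => gmul (ginv y) (pi e)) q.
    rewrite pi_mul; last exact: composable_div.
    rewrite pi_inv pi_lift gpd_invD; last by rewrite Kx.
    rewrite gpd_divK ?Kx// => ->; rewrite /d pi_mul// pi_inv.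
    exact/eqP.
  have [cK|cK] := boolP (pi d \in K).
    rewrite (bigD1_seq (pi d))//= big1_seq ?addr0// => h /andP[hc hK''].
    exact: zero.
  rewrite big1_seq; last first.
    by move=> h /andP[_ hK'']; apply: zero => //; apply: contraNneq cK => <-.
  by rewrite [f _]hK' ?mulr0// ?pi_lift.
have h1 : nc (jmap b d - f d) <= nrm (Fsub b b').
  by rewrite -jb -(jB p1 Glc Ghaus); exact: (j_le p1 Glc Ghaus).
have h2 : nc (jmap (Fmul a b) e - jmap a c * f d) <= nrm (Fmul a (Fsub b b')).
  rewrite -E1 -(jB p1 Glc Ghaus) -(FmulBr p1 Glc Ghaus Get).
  exact: (j_le p1 Glc Ghaus).
have h3 := nrmM p1 Glc Ghaus Get a (Fsub b b').
have h4 := nrm_ge0 p1 Glc Ghaus a; have h5 := nrm_ge0 p1 Glc Ghaus (Fsub b b').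
exact: (ratio_contra n0 C0 h5 hb (mul_distr h1 h2 h3)).
Qed.

End JProducts.

(** * Rigidity of isometries of [l^p] for [p] different from [2] *)

Section Clarkson.
Variables (R : realType) (p : R).
Hypothesis p1 : 1 <= p.
Let p0 : 0 < p. Proof. exact: lt_le_trans ltr01 p1. Qed.

Lemma powR_midpoint (q x y : R) : 1 <= q -> 0 <= x -> 0 <= y ->
  2 * ((x + y) / 2) `^ q <= x `^ q + y `^ q.
Proof.
move=> q1 x0 y0; have h0 : 0 <= (2^-1 : R) by lra. have h1 : (2^-1 : R) <= 1 by lra.
have i01 : Itv.spec (@Itv.num_sem R) (Itv.Real `[0%Z, 1%Z]) (2^-1 : R).
  by rewrite /= /Itv.num_sem /= ger0_real//= in_itv/= h0 h1.
have := @convex_powR R q q1 (@Itv.mk _ _ _ (2^-1 : R) i01) x y.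
rewrite !inE /= !in_itv /= !andbT => /(_ x0 y0).
have e : unstable.onem 2^-1 = 2^-1 :> R by rewrite /unstable.onem; lra.
rewrite [convex.conv _ _ _]convRE [X in _ <= X]convRE /= e => h.
have -> : (x + y) / 2 = 2^-1 * x + 2^-1 * y by lra.
by move: h; move: (_ `^ q) (x `^ q) (y `^ q) => a b c; lra.
Qed.

Lemma powR_small (w : nat -> R) l : (forall n, 0 <= w n) -> 0 <= l ->
  small (fun n => `|w n - l|) -> small (fun n => `|w n `^ p - l `^ p|).
Proof.
move=> w0 l0 sw; move: l0; rewrite le_eqVlt => /predU1P[l0|l0].
  move=> e e0; have [|n0 h] := sw (Num.min e 1); first by rewrite lt_min e0 ltr01.
  exists n0 => n /h; rewrite -l0 powR0 ?gt_eqF// !subr0 ger0_norm// ger0_norm ?powR_ge0//.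
  rewrite lt_min => /andP[we w1]; apply: le_lt_trans we.
  have := w0 n; rewrite le_eqVlt => /predU1P[<-|wn]; first by rewrite powR0// gt_eqF.
  by apply: ge1r_powR => //; rewrite wn ltW.
have cl : {for l, continuous (fun x => x `^ p)}.
  apply: differentiable_continuous; apply/derivable1_diffP/derivable_powR.
  by rewrite in_itv/= l0.
move=> e e0; have /cvgrPdist_lt/(_ _ e0) := cl; rewrite near_simpl.
move=> /nbhs_ballP[d d0 hd]; have [n0 h] := sw d d0.
by exists n0 => n /h hn; rewrite distrC; apply: hd; rewrite /ball/= distrC.
Qed.

Lemma nc_sqr (z : R[i]) : nc z ^+ 2 = complex.Re z ^+ 2 + complex.Im z ^+ 2.
Proof. by case: z => a b; rewrite /= sqr_sqrtr// addr_ge0// sqr_ge0. Qed.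

Lemma parallelogram (a b : R[i]) :
  nc (a + b) ^+ 2 + nc (a - b) ^+ 2 = 2 * (nc a ^+ 2 + nc b ^+ 2).
Proof. by rewrite !nc_sqr; case: a b => [a1 a2] [b1 b2] /=; ring. Qed.

Lemma powR_super (q x y : R) : 1 < q -> 0 <= x -> 0 <= y ->
  x `^ q + y `^ q <= (x + y) `^ q ?= iff ((x == 0) || (y == 0)).
Proof.
move=> q1 x0 y0; have q0 : q != 0 by rewrite gt_eqF// (lt_trans ltr01).
apply/leifP; case: ifPn => [/orP[]/eqP ->|]; rewrite ?add0r ?addr0 ?powR0 ?add0r ?addr0//.
rewrite negb_or => /andP[xn yn].
have xp : 0 < x by rewrite lt0r xn. have yp : 0 < y by rewrite lt0r yn.
have q10 : 0 < q - 1 by lra.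
have hp z : 0 <= z -> z `^ q = z * z `^ (q - 1).
  by move=> z0; rewrite mulr_powRB1// (lt_trans ltr01).
rewrite !hp ?addr_ge0// mulrDl.
by apply: ltrD; rewrite ltr_pM2l//; apply: gt0_ltr_powR; rewrite // ?nnegrE ?addr_ge0//; lra.
Qed.

(** The defect of the parallelogram law in exponent [p]. *)
Definition defect (a b : R[i]) :=
  nc (a + b) `^ p + nc (a - b) `^ p - 2 * (nc a `^ p + nc b `^ p).

Lemma powR_half (x : R) : 0 <= x -> x `^ p = (x ^+ 2) `^ (p / 2).
Proof.
move=> x0; rewrite -powR_mulrn// -powRrM; congr (_ `^ _).
by rewrite mulrCA divff ?mulr1.
Qed.

(** With [A = |a+b|^2], [B = |a-b|^2] the parallelogram law reads
    [A + B = 2 (|a|^2 + |b|^2)]; compare [A^(p/2) + B^(p/2)] with twice the power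
    of the midpoint by convexity or concavity, and the latter with
    [|a|^p + |b|^p] by strict super- or subadditivity. *)
Lemma defect_sign : p != 2 -> exists s : R, (s = 1 \/ s = -1) /\
  forall a b, 0 <= s * defect a b ?= iff ((a == 0) || (b == 0)).
Proof.
move=> p2.
suff h : exists s : R, (s = 1 \/ s = -1) /\ forall a b : R[i],
    0 <= s * defect a b /\ (a != 0 -> b != 0 -> 0 < s * defect a b).
  have [s [s1 hs]] := h; exists s; split => // a b.
  have [h1 h2] := hs a b; apply/leifP; case: ifPn => [ab|].
    suff -> : defect a b = 0 by rewrite mulr0.
    by move: ab => /orP[]/eqP ->; rewrite /defect ?add0r ?addr0 ?sub0r ?subr0 ?ncN Normc.normc0 powR0 ?gt_eqF//; lra.
  by rewrite negb_or => /andP[a0 b0]; exact: h2.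
pose q := p / 2.
have sq (z : R[i]) : 0 <= nc z ^+ 2 by rewrite sqr_ge0.
have dE (a b : R[i]) : defect a b = (nc (a + b) ^+ 2) `^ q + (nc (a - b) ^+ 2) `^ q
    - 2 * ((nc a ^+ 2) `^ q + (nc b ^+ 2) `^ q).
  by rewrite /defect !powR_half ?nc_ge0.
have mid (a b : R[i]) : (nc (a + b) ^+ 2 + nc (a - b) ^+ 2) / 2 = nc a ^+ 2 + nc b ^+ 2.
  by rewrite parallelogram mulrAC divff ?mul1r.
have s0 (a : R[i]) : a != 0 -> (nc a ^+ 2 == 0) = false.
  by move=> an; rewrite sqrf_eq0 nc_eq0; exact: negbTE.
have [q1|q1] := ltP 1 q.
  exists 1; split; first by left.
  move=> a b; rewrite dE mul1r.
  have h1 := powR_midpoint (ltW q1) (sq (a + b)) (sq (a - b)); rewrite mid in h1.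
  have h2 := powR_super q1 (sq a) (sq b).
  split; first by have := h2.1; move: h1; move: (_ `^ q) (_ `^ q) (_ `^ q) => x y z; lra.
  move=> a0 b0; have := lt_leif h2; rewrite !s0//= => h3.
  by move: h1 h3; move: (_ `^ q) (_ `^ q) (_ `^ q) => x y z; lra.
have ql : q < 1.
  by rewrite lt_neqAle q1 andbT; apply: contra_neq p2; rewrite /q => h; lra.
have q0 : 0 < q by rewrite divr_gt0.
have qV1 : 1 < q^-1 by rewrite invf_gt1.
have qV x : 0 <= x -> (x `^ q) `^ q^-1 = x.
  by move=> x0; rewrite -powRrM divff ?gt_eqF// powRr1.
exists (-1); split; first by right.
move=> a b; rewrite dE mulN1r.
have h1 : (nc (a + b) ^+ 2) `^ q + (nc (a - b) ^+ 2) `^ q <= 2 * (nc a ^+ 2 + nc b ^+ 2) `^ q.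
  have := powR_midpoint (ltW qV1) (powR_ge0 (nc (a + b) ^+ 2) q) (powR_ge0 (nc (a - b) ^+ 2) q).
  rewrite !qV// => h.
  have h' : (((nc (a + b) ^+ 2) `^ q + (nc (a - b) ^+ 2) `^ q) / 2) `^ q^-1 <= nc a ^+ 2 + nc b ^+ 2.
    by rewrite -mid; lra.
  have h3 := ge0_ler_powR (ltW q0) (powR_ge0 _ _) (addr_ge0 (sq a) (sq b)) h'.
  rewrite -powRrM mulVf ?gt_eqF// powRr1 in h3; first lra.
  by rewrite divr_ge0// addr_ge0// powR_ge0.
have h2 := powR_super qV1 (powR_ge0 (nc a ^+ 2) q) (powR_ge0 (nc b ^+ 2) q).
rewrite !qV// in h2.
have h3 : (nc a ^+ 2 + nc b ^+ 2) `^ q <= (nc a ^+ 2) `^ q + (nc b ^+ 2) `^ q.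
  have := ge0_ler_powR (ltW q0) (addr_ge0 (sq a) (sq b)) (powR_ge0 _ _) h2.1.
  by rewrite -powRrM mulVf ?gt_eqF// powRr1// addr_ge0// powR_ge0.
split; first by move: h1 h3; move: (_ `^ q) (_ `^ q) (_ `^ q) => x y z; lra.
move=> a0 b0; have h4 := lt_leif h2; rewrite !powR_eq0 !s0//= in h4.
have := gt0_ltr_powR q0 (addr_ge0 (sq a) (sq b)) (powR_ge0 _ _) h4.
rewrite -powRrM mulVf ?gt_eqF// powRr1 ?addr_ge0 ?powR_ge0// => h5.
by move: h1 h5; move: (_ `^ q) (_ `^ q) (_ `^ q) => x y z; lra.
Qed.

End Clarkson.

Section IsometryRows.
Variables (R : realType) (p : R) (G : topGroupoid) (E : twist R G).
Hypotheses (p1 : 1 <= p) (Glc : locally_compact [set: G]) (Ghaus : hausdorff_space G).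
Hypothesis Get : etale G.
Local Notation A := (Fplambda p E).
Local Notation rn := (rn p (E := E)).
Local Notation pi := (@tw_pi _ _ E).
Local Notation lift := (tw_lift E).
Implicit Types (x : G) (f xi : E -> R[i]) (a b u v : A) (e c d : E).
Let p0 : 0 < p. Proof. exact: lt_le_trans ltr01 p1. Qed.

Lemma unit_div_pi e c : src c = src e -> units G (pi (gmul e (ginv c))) -> pi c = pi e.
Proof.
move=> ce; rewrite pi_mul; last exact: composable_div.
rewrite pi_inv => uw; have sce : src (pi e) = src (pi c) by apply/src_pi_eq.
have [rw sw] := unitsP uw.
have := gpd_divK sce; rewrite -{1}sw src_div// => <-.
by rewrite gmull_rng.
Qed.

Lemma lambda_unit x xi : Sigma_c (unit_coord (E := E)) -> off_fibre x xi -> equivariant xi ->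
  lambda x (unit_coord (E := E)) xi = xi.
Proof.
move=> S1 xoff exi; apply/funext => e.
have [ex|nex] := pselect (src_fibre E x e); last by rewrite lambda_off// xoff.
have [_ _ e1] := S1.
rewrite (@lambda_row _ _ _ Ghaus x _ xi e [:: pi e])//.
- rewrite big_seq1; have [z cz ez] := lift_fibre e.
  have sl : src (lift (pi e)) = src e by apply: pi_eq_src; rewrite pi_lift.
  have := lambda_term_act e1 exi sl cz; rewrite -ez => <-.
  by rewrite -[gmul e (ginv e)]/(rng e) unit_coord_unit ?mul1r//; exact: units_rng.
- by move=> g; rewrite inE => /eqP ->; apply/src_fibreE.
- move=> c ce; rewrite inE => /eqP nc; apply/eqP; apply: contra_notT nc.
  by move=> /unit_coord_neq0/(unit_div_pi ce).
Qed.

Lemma Lpn_finite x xi (K : seq G) : Lp p x xi -> uniq K -> (forall g, g \in K -> src g = x) ->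
  (forall e, xi e != 0 -> pi e \in K) ->
  Lpn p x xi `^ p = \sum_(g <- K) nc (xi (lift g)) `^ p.
Proof.
move=> Lx uK Kx hK; have [xoff exi _] := (LpP p1 Glc Ghaus x xi).1 Lx.
rewrite -(fvec_norm E p1 Glc Ghaus (fun g => xi (lift g)) uK Kx).
suff <- : xi = fvec E K (fun g => xi (lift g)) by [].
apply/funext => e; have [eK|eK] := boolP (pi e \in K).
  have [z cz ->] := lift_fibre e.
  by rewrite exi// (fvec_equivariant K _ _ cz) fvec_lift.
have -> : xi e = 0 by apply/eqP; apply: contraNT eK; exact: hK.
by apply/esym/eqP; apply: contraNT eK; exact: fvec_neq0.
Qed.

Variables (u v one : A).
Hypotheses (one1 : iota (unit_coord (E := E)) one) (vu : Fmul v u = one).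
Hypotheses (u1 : nrm u <= 1) (v1 : nrm v <= 1).

Lemma squeeze_bound (X L C r s d : R) : 0 <= L -> 0 <= X -> L <= C * X -> L <= (1 + r) * X ->
  X <= d * X + (1 + s) * L -> 0 <= r -> 0 <= s -> 0 <= d -> 
  `|L - X| <= X * r + (X * d + C * X * s).
Proof.
move=> L0 X0 LC h1 h2 r0 s0 d0; rewrite ler_norml; apply/andP; split; last first.
  have h : 0 <= C * X * s by apply: mulr_ge0 => //; exact: le_trans LC.
  by have := mulr_ge0 X0 d0; lra.
have h : L * s <= C * X * s by apply: ler_wpM2r.
have := mulr_ge0 X0 r0; lra.
Qed.

(** Products [V_n U_n] tend to the identity and both factors have norm at most
    [1 + o(1)], so [U_n] neither stretches nor shrinks a vector in the limit. *)
Lemma asymptotic_isometry x xi : units G x -> Lp p x xi ->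
  small (fun n => `|Lpn p x (lambda x (repr u n) xi) - Lpn p x xi|).
Proof.
move=> ux Lx; have ru := rep_repr p1 Glc Ghaus u; have rv := rep_repr p1 Glc Ghaus v.
have [Su _] := repr_cauchy p1 Glc Ghaus u; have [Sv _] := repr_cauchy p1 Glc Ghaus v.
have [C C0 hC] := cauchyS_bounded p1 Glc Ghaus (repr_cauchy p1 Glc Ghaus u).
have [xoff exi _] := (LpP p1 Glc Ghaus x xi).1 Lx.
have S1 := iota_Sigma p1 Glc Ghaus one1.
have rvu : rep (fun n => conv (repr v n) (repr u n)) one.
  by rewrite -vu; exact: (rep_M p1 Glc Ghaus Get rv ru).
have sd := rep_small p1 Glc Ghaus one1 rvu.
have su := rep_norm p1 Glc Ghaus ru; have sv := rep_norm p1 Glc Ghaus rv.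
have X0 := Lpn_ge0 p x xi.
have CX : 0 <= C * Lpn p x xi by exact: mulr_ge0.
apply: small_le (small_add (small_scale X0 su) (small_add (small_scale X0 sd) (small_scale CX sv))) _ => n /=.
have Lu := lambda_Lp p1 Glc Ghaus (Su n) Lx.
have Sc := conv_Sigma Glc Ghaus Get (Sv n) (Su n).
have Sd := Sigma_cB S1 Sc.
have b1 := rn_bound p1 Glc Ghaus (Su n) ux Lx.
have b2 := rn_bound p1 Glc Ghaus (Sv n) ux Lu.
have b3 := rn_bound p1 Glc Ghaus Sd ux Lx.
have E1 : xi = lambda x (unit_coord (E := E) - conv (repr v n) (repr u n)) xi +
    lambda x (repr v n) (lambda x (repr u n) xi).
  rewrite -(lambda_conv Glc Ghaus Get x (Sv n) (Su n) exi).
  rewrite -(lambdaDl Glc Ghaus x Sd Sc exi) subrK.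
  by rewrite lambda_unit.
have Lvu := lambda_Lp p1 Glc Ghaus (Sv n) Lu.
have Ld := lambda_Lp p1 Glc Ghaus Sd Lx.
have b4 : Lpn p x xi <= Lpn p x (lambda x (unit_coord (E := E) - conv (repr v n) (repr u n)) xi)
    + Lpn p x (lambda x (repr v n) (lambda x (repr u n) xi)).
  by rewrite [in X in X <= _]E1; have [] := LpD p1 Ld Lvu.
have b5 := hC n.
have n1 := rn_ge0 p1 Glc Ghaus Sd.
have L0 := Lpn_ge0 p x (lambda x (repr u n) xi).
move: b1 b2 b3 b4 b5 n1 L0 X0 u1 v1.
move: (rn (_ - _)) (rn (repr u n)) (rn (repr v n)) (nrm u) (nrm v) => d r s r' s'.
move: (Lpn p x (lambda x (repr v n) _)) (Lpn p x (lambda x (repr u n) xi)).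
move: (Lpn p x (lambda x (_ - _) xi)) (Lpn p x xi) => Y X Z L b1 b2 b3 b4 b5 n1 L0 X0 r1 s1.
have n2 := ler_norm (r - r'); have n3 := ler_norm (s - s').
apply: squeeze_bound => //.
- by apply: le_trans b1 _; apply: ler_wpM2r.
- by apply: le_trans b1 _; apply: ler_wpM2r => //; lra.
- apply: le_trans b4 _; apply: lerD => //; apply: le_trans b2 _.
  by apply: ler_wpM2r => //; lra.
Qed.

Lemma defect_small (al be : nat -> R[i]) (a b : R[i]) :
  small (fun n => nc (al n - a)) -> small (fun n => nc (be n - b)) ->
  small (fun n => `|defect p (al n) (be n) - defect p a b|).
Proof.
move=> sa sb.
have h (w : nat -> R[i]) l : small (fun n => nc (w n - l)) ->
    small (fun n => `|nc (w n) `^ p - nc l `^ p|).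
  move=> sw; apply: (powR_small p1) => [n||]; [exact: nc_ge0|exact: nc_ge0|].
  by apply: small_le sw _ => n; exact: nc_dist.
have sD : small (fun n => nc (al n + be n - (a + b))).
  apply: small_le (small_add sa sb) _ => n /=; apply: le_trans (ncD _ _).
  by rewrite opprD addrACA.
have sB : small (fun n => nc (al n - be n - (a - b))).
  apply: small_le (small_add sa sb) _ => n /=; apply: le_trans (ncB _ _).
  move: (al n) (be n) => x y.
  by have -> : x - y - (a - b) = (x - a) - (y - b) by ring.
have h2 : (0 : R) <= 2 by [].
apply: small_le (small_add (small_add (h _ _ sD) (h _ _ sB))
  (small_scale h2 (small_add (h _ _ sa) (h _ _ sb)))) _ => n /=.
rewrite /defect; move: (_ `^ p) (_ `^ p) (_ `^ p) (_ `^ p) => x1 x2 x3 x4.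
move: (_ `^ p) (_ `^ p) (_ `^ p) (_ `^ p) => y1 y2 y3 y4.
have t (r : R) : - `|r| <= r /\ r <= `|r|.
  by split; [rewrite lerNl -normrN; exact: ler_norm|exact: ler_norm].
have [? ?] := t (x1 - y1); have [? ?] := t (x2 - y2).
have [? ?] := t (x3 - y3); have [? ?] := t (x4 - y4).
by rewrite ler_norml; apply/andP; split; lra.
Qed.

Lemma j_neq0_pi a e e' : pi e = pi e' -> jmap a e != 0 -> jmap a e' != 0.
Proof.
move=> /pi_fibre[z cz ->] n; rewrite (j_equivariant p1 Glc Ghaus)// mulf_neq0//.
exact: circle_neq0.
Qed.

Lemma column_window f h : Sigma_c f -> exists K : seq G, forall c, src c = src (lift h) ->
  f (gmul c (ginv (lift h))) != 0 -> pi c \in K.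
Proof.
move=> Sf; have [K [_ _ hK]] := colset Glc Ghaus (rng h) Sf.
exists [seq gmul k h | k <- K] => c ch fc.
have sc : src (pi c) = src h by rewrite -{1}(pi_lift E h); apply/src_pi_eq.
have e1 : pi (gmul c (ginv (lift h))) = gmul (pi c) (ginv h).
  by rewrite pi_mul ?pi_inv ?pi_lift//; exact: composable_div.
apply/mapP; exists (gmul (pi c) (ginv h)); last by rewrite gpd_divK.
rewrite -e1; apply: contraNT fc => nK; apply/eqP; apply: hK => //.
by apply/src_fibreE; rewrite e1 src_div.
Qed.

(** Two nonzero entries of the limit in one row would give two basis vectors
    [t1], [t2] whose images have a common support point; the norms of the images
    of [t1], [t2], [t1 + t2] and [t1 - t2] are asymptotically those of the
    vectors, so the sum of the defects over the row tends to [0], although all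
    its terms have the same sign. *)
Lemma isometry_row e e' : p != 2 -> rng e = rng e' -> jmap u e != 0 -> jmap u e' != 0 ->
  pi e = pi e'.
Proof.
move=> p2 ree ne ne'; apply: contrapT => npi.
have [sg [sg1 hsg]] := defect_sign p1 p2.
pose g0 := pi e; pose x := src g0.
have cve : composable (ginv e') e by rewrite /composable srcV.
(* the basis vectors at [src e] and [e'^-1 e] are sent to functions whose values
   at [e] are the entries at [e] and [e'] *)
pose h1 := x; pose h2 := pi (gmul (ginv e') e).
have ux : units G x by exact: units_src.
have sx : src x = x by have [] := unitsP ux.
have sh2 : src h2 = x by rewrite /h2 pi_mul// src_mul// /composable -pi_src -pi_rng cve.
have h2E : h2 = gmul (ginv (pi e')) (pi e) by rewrite /h2 pi_mul// pi_inv.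
have rpi : rng (pi e) = rng (pi e') by apply/rng_pi_eq.
have h12 : h1 != h2.
  apply/eqP => q; apply: npi.
  have q' : gmul (pi e') h2 = pi e by rewrite h2E gpdVKl.
  have rh2 : rng h2 = src (pi e') by rewrite h2E rng_mul ?rngV// /composable srcV.
  have rh1 : rng h1 = h1 by exact: (unitsP ux).1.
  by rewrite -q' -q -rh1 q rh2 gmulr_src.
pose l := [:: h1; h2].
have ul : uniq l by rewrite /= inE h12.
have lx h : h \in l -> src h = x by rewrite !inE => /orP[]/eqP ->.
pose e1 := gmul (lift g0) (ginv (lift h1)); pose e2 := gmul (lift g0) (ginv (lift h2)).
have pie1 : pi e1 = pi e.
  rewrite /e1 pi_mul ?pi_inv ?pi_lift; last by apply: composable_div; apply/src_pi_eq; rewrite !pi_lift.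
  by rewrite (inv_unit ux) gmulr_src.
have pie2 : pi e2 = pi e'.
  rewrite /e2 pi_mul ?pi_inv ?pi_lift; last by apply: composable_div; apply/src_pi_eq; rewrite !pi_lift sh2.
  have cv : composable (ginv (pi e')) (pi e) by rewrite /composable srcV.
  by rewrite h2E gpd_invM// ginvK gpdVKl.
have n1 := j_neq0_pi (esym pie1) ne; have n2 := j_neq0_pi (esym pie2) ne'.
suff : sg * defect p (jmap u e1) (jmap u e2) <= 0.
  have := lt_leif (hsg (jmap u e1) (jmap u e2)).
  by rewrite (negbTE n1) (negbTE n2) ltNge /= => /negP.
have ru := rep_repr p1 Glc Ghaus u; have [Su _] := repr_cauchy p1 Glc Ghaus u.
pose X w := fvec E l w; have LX w : Lp p x (X w) by exact: (fvec_Lp' E p1 Glc Ghaus w ul lx).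
pose S n w := Lpn p x (lambda x (repr u n) (X w)) `^ p.
pose N w := \sum_(h <- l) nc (w h) `^ p.
have sS w : small (fun n => `|S n w - N w|).
  rewrite /N -(fvec_norm E p1 Glc Ghaus w ul lx); apply: (powR_small p1).
  - by move=> n; exact: Lpn_ge0.
  - exact: Lpn_ge0.
  - exact: asymptotic_isometry.
pose w1 h : R[i] := (h == h1)%:R; pose w2 h : R[i] := (h == h2)%:R.
have h21 : (h2 == h1) = false by rewrite eq_sym (negbTE h12).
have nb0 : nc (0 : R[i]) `^ p = 0 by rewrite Normc.normc0 powR0 ?gt_eqF.
have nb1 : nc (1 : R[i]) `^ p = 1 by rewrite nc1 powR1.
have nbN : nc (-1 : R[i]) `^ p = 1 by rewrite ncN nc1 powR1.
have [w11 w12] : w1 h1 = 1 /\ w1 h2 = 0 by rewrite /w1 eqxx h21.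
have [w21 w22] : w2 h1 = 0 /\ w2 h2 = 1 by rewrite /w2 eqxx (negbTE h12).
have NE w : N w = nc (w h1) `^ p + nc (w h2) `^ p by rewrite /N !big_cons big_nil addr0.
have N1 : N w1 = 1 by rewrite NE w11 w12 nb0 nb1 addr0.
have N2 : N w2 = 1 by rewrite NE w21 w22 nb0 nb1 add0r.
have N3 : N (fun h => w1 h + w2 h) = 2 by rewrite NE w11 w12 w21 w22 add0r addr0 nb1.
have N4 : N (fun h => w1 h - w2 h) = 2 by rewrite NE w11 w12 w21 w22 sub0r subr0 nb1 nbN.
have key n : sg * defect p (repr u n e1) (repr u n e2) <=
    sg * (S n (fun h => w1 h + w2 h)%R + S n (fun h => w1 h - w2 h)%R - 2 * (S n w1 + S n w2)).
  have [K1 hK1] := column_window h1 (Su n); have [K2 hK2] := column_window h2 (Su n).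
  pose K := undup [seq g <- g0 :: K1 ++ K2 | src g == x].
  have uK : uniq K by exact: undup_uniq.
  have Kx g : g \in K -> src g = x by rewrite mem_undup mem_filter => /andP[/eqP].
  pose al g := repr u n (gmul (lift g) (ginv (lift h1))).
  pose be g := repr u n (gmul (lift g) (ginv (lift h2))).
  have SE w : S n w = \sum_(g <- K) nc (al g * w h1 + be g * w h2) `^ p.
    have LU := lambda_Lp p1 Glc Ghaus (Su n) (LX w).
    rewrite /S (Lpn_finite LU uK Kx).
      apply: eq_big_seq => g gK; congr (nc _ `^ _).
      rewrite (lambda_fvec Ghaus w (Su n) ul lx) ?big_cons ?big_nil ?addr0//.
      by apply/src_fibreE; rewrite pi_lift Kx.
    move=> c; have [cx|ncx] := pselect (src_fibre E x c); last by rewrite lambda_off ?eqxx.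
    rewrite (lambda_fvec Ghaus w (Su n) ul lx)// => /sum_neq0[h hl].
    rewrite mulf_eq0 negb_or => /andP[fn _]; move/src_fibreE : (cx) => cx'.
    rewrite mem_undup mem_filter cx' eqxx /= inE mem_cat.
    have cs : src c = src (lift h) by apply/src_pi_eq; rewrite pi_lift (lx _ hl).
    move: hl cs fn; rewrite !inE => /orP[]/eqP -> cs fn.
      by rewrite (hK1 _ cs fn) orbT.
    by rewrite (hK2 _ cs fn) !orbT.
  have -> : S n (fun h => w1 h + w2 h)%R + S n (fun h => w1 h - w2 h)%R - 2 * (S n w1 + S n w2) =
      \sum_(g <- K) defect p (al g) (be g).
    rewrite !SE /defect sumrB -mulr_sumr !big_split /=.
    rewrite w11 w12 w21 w22; congr (_ + _ - 2 * (_ + _)); apply: eq_bigr => g _.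
    - by rewrite add0r addr0 !mulr1.
    - by rewrite sub0r subr0 mulr1 mulrN1.
    - by rewrite mulr1 mulr0 addr0.
    - by rewrite mulr0 mulr1 add0r.
  have g0K : g0 \in K by rewrite mem_undup mem_filter mem_head andbT; apply/eqP.
  rewrite mulr_sumr (bigD1_seq g0)//= lerDl; apply: sumr_ge0 => g _.
  exact: (hsg (al g) (be g)).1.
have sl : small (fun n => sg * defect p (jmap u e1) (jmap u e2) - sg * defect p (repr u n e1) (repr u n e2)).
  apply: small_le (defect_small (rep_eval p1 Glc Ghaus e1 ru) (rep_eval p1 Glc Ghaus e2 ru)) _ => n /=.
  rewrite -mulrBr; move: (defect _ _ _) (defect _ _ _) => y z.
  by case: sg1 => ->; [rewrite mul1r distrC; exact: ler_norm|rewrite mulN1r opprB; exact: ler_norm].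
apply: small_cst_le (small_add sl (small_add (small_add (sS (fun h => w1 h + w2 h)) (sS (fun h => w1 h - w2 h)))
  (small_scale (ler0n R 2) (small_add (sS w1) (sS w2))))) _ => n /=.
rewrite N1 N2 N3 N4; have := key n.
move: (sg * defect p (jmap u e1) (jmap u e2)) (sg * defect p (repr u n e1) (repr u n e2)) => y z.
move: (S n _) (S n _) (S n _) (S n _) => s4 s3 s2 s1 k.
have t (r : R) : - `|r| <= r /\ r <= `|r|.
  by split; [rewrite lerNl -normrN; exact: ler_norm|exact: ler_norm].
have [? ?] := t (s1 - 2); have [? ?] := t (s2 - 2).
have [? ?] := t (s3 - 1); have [? ?] := t (s4 - 1).
by case: sg1 k => ->; rewrite ?mul1r ?mulN1r; lra.
Qed.

(** An invertible isometry close to the unit is diagonal: the row of [e] already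
    contains the nonzero entry at the unit [rng e]. *)
Lemma isometry_diagonal e : p != 2 -> nrm (Fsub u one) < 1 -> jmap u e != 0 -> units G (pi e).
Proof.
move=> p2 h ne.
have re : rng (rng e) = rng e by rewrite rng_rng.
have nr : jmap u (rng e) != 0.
  apply: contraTneq h => u0; rewrite -leNgt.
  have := j_le p1 Glc Ghaus (Fsub u one) (rng e).
  rewrite (jB p1 Glc Ghaus) u0 (iota_j p1 Glc Ghaus one1) unit_coord_unit; last exact: units_rng.
  by rewrite sub0r ncN nc1.
by rewrite -(isometry_row p2 re nr ne); exact: units_pi_rng.
Qed.

End IsometryRows.

(** * The diagonal subalgebra *)

Section Diagonal.
Variables (R : realType) (p : R) (G : topGroupoid) (E : twist R G).
Hypotheses (p1 : 1 <= p) (Glc : locally_compact [set: G]) (Ghaus : hausdorff_space G).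
Hypotheses (Get : etale G) (Gcpt : compact (units G)).
Local Notation A := (Fplambda p E).
Local Notation pi := (@tw_pi _ _ E).
Implicit Types (f : G -> R[i]) (a b d : A) (e c : E) (x : G).

Definition diagonal a := forall e, jmap a e != 0 -> units G (pi e).

Lemma units_pi_srcrng e : units G (pi e) -> src e = rng e.
Proof.
move=> ue; have [z cz ez] := pi_units_act ue.
by have [rs _] := unitsP (units_src e); rewrite [in RHS]ez rng_act// rs.
Qed.

Lemma diagonal_eval d e : diagonal d -> jmap d e = jmap d (rng e) * unit_coord e.
Proof.
move=> dd; have [ue|nue] := pselect (units G (pi e)); last first.
  have -> : unit_coord e = 0 by apply/eqP; apply: contra_notT nue; exact: unit_coord_neq0.
  by rewrite mulr0; apply/eqP; apply: contra_notT nue; exact: dd.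
rewrite -(units_pi_srcrng ue); have [z cz ez] := pi_units_act ue.
rewrite [in LHS]ez (j_equivariant p1 Glc Ghaus)// mulrC; congr (_ * _).
by rewrite [in RHS]ez unit_coord_act//; exact: units_src.
Qed.

Lemma diagonal_bisupported d : diagonal d -> bisupported (jmap d).
Proof.
have h e e' : units G (pi e) -> units G (pi e') ->
    src e = src e' \/ rng e = rng e' -> pi e = pi e'.
  move=> ue ue' se; have [re _] := unitsP ue; have [re' _] := unitsP ue'.
  rewrite -re -re' -!pi_rng; case: se => [|->//].
  by rewrite !units_pi_srcrng// => ->.
by move=> dd; split=> e e' /dd ue /dd ue' s; apply: h => //; [left|right].
Qed.

(** A diagonal factor has a single entry in each row and column, at a unit. *)
Lemma j_diag_l d a e : diagonal d -> jmap (Fmul d a) e = jmap d (rng e) * jmap a e.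
Proof.
move=> dd; rewrite (@j_mul_row _ _ _ _ p1 Glc Ghaus Get d a e (rng e)) ?rng_rng//.
  by rewrite (inv_unit (units_rng e)) gmull_rng.
move=> c ce nc; rewrite -ce pi_rng; have [-> //] := unitsP (dd c nc).
Qed.

Lemma j_diag_r d a e : diagonal d -> jmap (Fmul a d) e = jmap a e * jmap d (src e).
Proof.
have ss : src (src e) = src e by have [] := unitsP (units_src e).
move=> dd; rewrite (@j_mul_col _ _ _ _ p1 Glc Ghaus Get a d e (src e))//.
  by rewrite (inv_unit (units_src e)) gmulr_src.
move=> c ce nc; rewrite -ce pi_src; have [_ -> //] := unitsP (dd c nc).
Qed.

Lemma diag_ex f : continuous f -> exists a, jmap a = diag (E := E) f.
Proof.
move=> cf; have [a ra] := iota_ex p1 Glc Ghaus (diag_Sigma E Get Gcpt cf).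
by exists a; exact: iota_j ra.
Qed.

Lemma one_ex : exists one : A, iota (unit_coord (E := E)) one.
Proof. exact: (iota_ex p1 Glc Ghaus (unit_coord_Sigma E Get Gcpt)). Qed.

Lemma diag_diagonal f a : jmap a = diag f -> diagonal a.
Proof. by move=> ja e; rewrite ja /diag mulf_eq0 negb_or => /andP[_]; exact: unit_coord_neq0. Qed.

Lemma diag_at_unit f (y : E) : units E y -> diag f y = f (pi y).
Proof. by move=> uy; rewrite /diag unit_coord_unit// mulr1; have [-> _] := unitsP uy. Qed.

Lemma diag_mul f g a b : jmap a = diag f -> jmap b = diag g ->
  jmap (Fmul a b) = diag (fun x => f x * g x).
Proof.
move=> ja jb; apply/funext => e; rewrite (j_diag_l _ _ (diag_diagonal ja)) ja jb.
by rewrite (diag_at_unit f (units_rng e)) /diag /= mulrA.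
Qed.

Lemma diagonalD a b : diagonal a -> diagonal b -> diagonal (Fadd a b).
Proof.
move=> da db e; rewrite (jD p1 Glc Ghaus).
have [->|n _] := eqVneq (jmap a e) 0; last exact: da.
by rewrite add0r; exact: db.
Qed.

Lemma diagonalZ k a : diagonal a -> diagonal (Fscale k a).
Proof.
by move=> da e; rewrite (jZ p1 Glc Ghaus) mulf_eq0 negb_or => /andP[_]; exact: da.
Qed.

Lemma diagonalM a b : diagonal a -> diagonal b -> diagonal (Fmul a b).
Proof. by move=> da db e; rewrite j_diag_l// mulf_eq0 negb_or => /andP[_]; exact: db. Qed.

(** A diagonal element as a function on the base, constant along the range map. *)
Definition symbol d x := jmap d (tw_i E (rng x) 1).

Lemma symbol_continuous d : continuous (symbol d).
Proof.
have [k [_ _ ck _]] := tw_i_units E.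
have c1 : {within [set: G], continuous (fun x : G => tw_i E (rng x) 1)}.
  apply: (within_comp (f := @rng G)) ck; last by move=> x _; exact: units_rng.
  by apply: continuous_subspaceT => x; exact: rng_continuous.
move=> x; apply: (@cvg_comp _ _ _ (fun x : G => tw_i E (rng x) 1)).
  exact: (within_open_cvg c1 openT).
exact: j_continuous.
Qed.

Lemma symbol_diag d : diagonal d -> jmap d = diag (symbol d).
Proof.
move=> dd; apply/funext => e; rewrite (diagonal_eval e dd) /diag /symbol.
by rewrite -pi_rng rng_rng tw_i_pi//; exact: units_rng.
Qed.

Lemma one_mul one a : iota (unit_coord (E := E)) one -> Fmul one a = a /\ Fmul a one = a.
Proof.
move=> r1; have j1 := iota_j p1 Glc Ghaus r1.
have d1 : diagonal one by move=> e; rewrite j1; exact: unit_coord_neq0.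
split; apply: (j_inj p1 Glc Ghaus); apply/funext => e.
  by rewrite j_diag_l// j1 unit_coord_unit ?mul1r//; exact: units_rng.
by rewrite j_diag_r// j1 unit_coord_unit ?mulr1//; exact: units_src.
Qed.

Lemma units_compact : compact (units E).
Proof.
have -> : units E = (fun x => tw_i E x 1) @` units G.
  apply/seteqP; split=> [y uy|_ [x ux <-]]; last exact: units_tw_i.
  by exists (pi y); [exact: units_pi_units|exact: tw_i_pi].
by have [k [_ _ ck _]] := tw_i_units E; exact: continuous_compact.
Qed.

(** Bump functions on [G] give diagonal elements that separate units. *)
Lemma unit_separation (x y : E) : units E x -> units E y ->
  (forall d, diagonal d -> jmap d x = jmap d y) -> x = y.
Proof.
move=> ux uy h; rewrite -(tw_i_pi ux) -(tw_i_pi uy); congr (tw_i E _ _).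
apply: contrapT => npi.
have oN : nbhs (pi x) [set t | t <> pi y].
  apply: open_nbhs_nbhs; split=> //.
  rewrite (_ : [set _ | _] = ~` [set pi y]); last by apply/seteqP; split.
  by apply: closed_openC; apply: accessible_closed_set1; exact: hausdorff_accessible.
have [psi [K [cpsi _ px [_ _ Ky pK]]]] := lc_bump R Glc Ghaus oN.
have [d jd] := diag_ex (contC_real cpsi).
have := h _ (diag_diagonal jd); rewrite jd !diag_at_unit// px => /eqP.
suff -> : psi (pi y) = 0 by rewrite -subr_eq0 subr0 oner_eq0.
by apply/eqP; apply: contraT => /pK/Ky.
Qed.

End Diagonal.

(** * Isometric isomorphisms preserve the diagonal *)

(** An isomorphism together with its inverse, so that every statement can be
    used in both directions. *)
Record iso_pair (R : realType) (p : R) (G H : topGroupoid) (E : twist R G) (F : twist R H)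
    (Phi : Fplambda p E -> Fplambda p F) (Psi : Fplambda p F -> Fplambda p E) : Prop := {
  isoK : forall a, Psi (Phi a) = a;
  isoVK : forall b, Phi (Psi b) = b;
  isoD : forall a b, Phi (Fadd a b) = Fadd (Phi a) (Phi b);
  isoZ : forall k a, Phi (Fscale k a) = Fscale k (Phi a);
  isoM : forall a b, Phi (Fmul a b) = Fmul (Phi a) (Phi b);
  isoN : forall a, nrm (Phi a) = nrm a }.

Lemma iso_pair_sym (R : realType) (p : R) (G H : topGroupoid) (E : twist R G) (F : twist R H)
    (Phi : Fplambda p E -> Fplambda p F) (Psi : Fplambda p F -> Fplambda p E) :
  iso_pair Phi Psi -> iso_pair Psi Phi.
Proof.
case=> K VK D Z M N; split=> //.
- by move=> a b; rewrite -{1}(VK a) -{1}(VK b) -D K.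
- by move=> k a; rewrite -{1}(VK a) -Z K.
- by move=> a b; rewrite -{1}(VK a) -{1}(VK b) -M K.
- by move=> b; rewrite -{2}(VK b) N.
Qed.

Section SymbolArithmetic.
Variables (R : realType) (X : topologicalType).
Implicit Types (f : X -> R).

(** [sqrt (1 - t^2) + i t] for [t = f / 4]: a function of modulus one near [1],
    whose imaginary part is proportional to [f]. *)
Definition exp_like f (x : X) : R[i] :=
  (Num.sqrt (1 - (f x / 4) ^+ 2))%:C%C + 'i%C * (f x / 4)%:C%C.

Lemma exp_like_continuous f : continuous f -> continuous (exp_like f).
Proof.
move=> cf; have c4 : continuous (fun x => f x / 4).
  by move=> x; apply: cvgM; [exact: cf|exact: cvg_cst].
have cs : continuous (fun x => Num.sqrt (1 - (f x / 4) ^+ 2)).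
  move=> x.
  apply: (@cvg_comp _ _ _ (fun x => 1 - (f x / 4) ^+ 2)); last exact: sqrt_continuous.
  apply: cvgB; first exact: cvg_cst.
  by apply: (@cvgM _ _ _ _ _ (fun x => f x / 4)); exact: c4.
have h1 := contC_real cs; have h2 := @contC_scale R X 'i%C _ (contC_real c4).
exact: (contC_add h1 h2).
Qed.

Lemma exp_likeE f x : exp_like f x = (Num.sqrt (1 - (f x / 4) ^+ 2) +i* (f x / 4))%C.
Proof. by rewrite /exp_like; simpc. Qed.

Lemma exp_like_sqr f x : `|f x| <= 1 -> 0 <= 1 - (f x / 4) ^+ 2.
Proof. by rewrite ler_norml => /andP[h1 h2]; nra. Qed.

Lemma exp_like_nc f x : `|f x| <= 1 -> nc (exp_like f x) = 1.
Proof.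
by move=> h; rewrite exp_likeE /= sqr_sqrtr ?exp_like_sqr// subrK sqrtr1.
Qed.

Lemma exp_like_mulN f x : `|f x| <= 1 -> exp_like (fun x => - f x) x * exp_like f x = 1.
Proof.
move=> h; rewrite !exp_likeE mulNr sqrrN /=.
have := sqr_sqrtr (exp_like_sqr h); move: (Num.sqrt _) => s; move: (f x / 4) => t st.
apply/eqP; rewrite eq_complex /=; apply/andP; split; apply/eqP; last by ring.
by rewrite mulNr opprK -!expr2 st subrK.
Qed.

Lemma exp_like_near1 f x : `|f x| <= 1 -> nc (exp_like f x - 1) <= 1 / 2.
Proof.
move=> h; apply: le_trans (nc_le_ReIm _) _; rewrite exp_likeE /= oppr0 addr0.
have h4 := exp_like_sqr h.
have h1 : Num.sqrt (1 - (f x / 4) ^+ 2) ^+ 2 = 1 - (f x / 4) ^+ 2 by rewrite sqr_sqrtr.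
have h2 := sqrtr_ge0 (1 - (f x / 4) ^+ 2).
move: h h1 h2 {h4}; move: (Num.sqrt _) => s; move: (f x) => t; rewrite ler_norml => /andP[t1 t2] h1 h2.
have h3 : s <= 1 by nra.
have h4 : 15 / 16 <= s by nra.
have : `|s - 1| <= 1 / 16 by rewrite ler_norml; apply/andP; split; lra.
have : `|t / 4| <= 1 / 4 by rewrite ler_norml; apply/andP; split; lra.
lra.
Qed.

Lemma exp_like_diff f x : (f x)%:C%C = (- (2 * 'i)%C) * (exp_like f x - exp_like (fun x => - f x) x).
Proof.
rewrite !exp_likeE /= [- f x / 4]mulNr sqrrN; move: (Num.sqrt _) => s.
by apply/eqP; rewrite eq_complex /=; apply/andP; split; apply/eqP; field.
Qed.

End SymbolArithmetic.

Section DiagonalTransport.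
Variables (R : realType) (p : R) (G H : topGroupoid) (E : twist R G) (F : twist R H).
Hypotheses (p1 : 1 <= p) (p2 : p != 2).
Hypotheses (Glc : locally_compact [set: G]) (Ghaus : hausdorff_space G).
Hypotheses (Get : etale G) (Gcpt : compact (units G)).
Hypotheses (Hlc : locally_compact [set: H]) (Hhaus : hausdorff_space H).
Hypotheses (Het : etale H) (Hcpt : compact (units H)).
Variables (Phi : Fplambda p E -> Fplambda p F) (Psi : Fplambda p F -> Fplambda p E).
Hypothesis iso : iso_pair Phi Psi.
Local Notation A := (Fplambda p E).
Local Notation B := (Fplambda p F).

Lemma isoB a b : Phi (Fsub a b) = Fsub (Phi a) (Phi b).
Proof. by rewrite /Fsub (isoD iso) (isoZ iso). Qed.

Lemma iso_one (one : A) (one' : B) : iota (unit_coord (E := E)) one ->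
  iota (unit_coord (E := F)) one' -> Phi one = one'.
Proof.
move=> r1 r1'.
have [h1 _] := one_mul p1 Hlc Hhaus Het (Phi one) r1'.
have [_ h2] := one_mul p1 Glc Ghaus Get (Psi one') r1.
by rewrite -h1 -{1}(isoVK iso one') -(isoM iso) h2 (isoVK iso).
Qed.

(** [exp_like f] and its inverse are contractive, hence so are their images, and
    they lie within [1/2] of the unit. *)
Lemma diagonal_exp_like (f : G -> R) a : continuous f -> (forall x, `|f x| <= 1) ->
  jmap a = diag (E := E) (exp_like f) -> diagonal (Phi a).
Proof.
move=> cf f1 ja; pose f' x := - f x.
have cf' : continuous f' by move=> x; apply: cvgN; exact: cf.
have f1' x : `|f' x| <= 1 by rewrite normrN.
have [b jb] := diag_ex E p1 Glc Ghaus Get Gcpt (exp_like_continuous cf').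
have [one r1] : exists one : A, iota (unit_coord (E := E)) one by exact: one_ex.
have [one' r1'] : exists one : B, iota (unit_coord (E := F)) one by exact: one_ex.
have ba : Fmul b a = one.
  apply: (j_inj p1 Glc Ghaus); rewrite (diag_mul p1 Glc Ghaus Get jb ja) (iota_j p1 Glc Ghaus r1).
  by apply/funext => e; rewrite /diag exp_like_mulN// mul1r.
have n1 (g : G -> R) (c : A) : (forall x, `|g x| <= 1) -> jmap c = diag (E := E) (exp_like g) -> nrm c <= 1.
  move=> g1 jc; apply: (bisupported_norm p1 Glc Ghaus) => // [|e].
    exact: (diagonal_bisupported (diag_diagonal jc)).
  rewrite jc /diag ncM exp_like_nc// mul1r.
  have [->|n] := eqVneq (unit_coord e) 0; first by rewrite Normc.normc0.
  by have /circle_nc -> := unit_coord_circle (unit_coord_neq0 n).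
have nd : nrm (Fsub a one) < 1.
  apply: (@le_lt_trans _ _ (1 / 2)); last by lra.
  have jd e : jmap (Fsub a one) e = (exp_like f (tw_pi (rng e)) - 1) * unit_coord e.
    by rewrite (jB p1 Glc Ghaus) ja (iota_j p1 Glc Ghaus r1) /diag mulrBl mul1r.
  apply: (bisupported_norm p1 Glc Ghaus) => [||e]; [|by lra|].
    apply: diagonal_bisupported => e; rewrite jd mulf_eq0 negb_or => /andP[_].
    exact: unit_coord_neq0.
  rewrite jd ncM; have [->|n] := eqVneq (unit_coord e) 0; first by rewrite Normc.normc0 mulr0; lra.
  have /circle_nc -> := unit_coord_circle (unit_coord_neq0 n).
  by rewrite mulr1; exact: exp_like_near1.
have vu : Fmul (Phi b) (Phi a) = one' by rewrite -(isoM iso) ba; exact: iso_one.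
have na : nrm (Phi a) <= 1 by rewrite (isoN iso); exact: n1 ja.
have nb : nrm (Phi b) <= 1 by rewrite (isoN iso); exact: n1 jb.
have nd' : nrm (Fsub (Phi a) one') < 1 by rewrite -(iso_one r1 r1') -isoB (isoN iso).
by move=> e; exact: (isometry_diagonal p1 Hlc Hhaus Het r1' vu na nb p2 nd').
Qed.

Lemma diagonal_real (f : G -> R) a : continuous f -> (forall x, `|f x| <= 1) ->
  jmap a = diag (E := E) (fun x => (f x)%:C%C) -> diagonal (Phi a).
Proof.
move=> cf f1 ja; pose f' x := - f x.
have cf' : continuous f' by move=> x; apply: cvgN; exact: cf.
have f1' x : `|f' x| <= 1 by rewrite normrN.
have [u ju] := diag_ex E p1 Glc Ghaus Get Gcpt (exp_like_continuous cf).
have [v jv] := diag_ex E p1 Glc Ghaus Get Gcpt (exp_like_continuous cf').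
have -> : a = Fscale (- (2 * 'i)%C) (Fsub u v).
  apply: (j_inj p1 Glc Ghaus); apply/funext => e.
  by rewrite (jZ p1 Glc Ghaus) (jB p1 Glc Ghaus) ja ju jv /diag -mulrBl mulrA -exp_like_diff.
rewrite (isoZ iso) isoB; apply: (diagonalZ p1 Hlc Hhaus); apply: (diagonalD p1 Hlc Hhaus).
  exact: diagonal_exp_like ju.
by apply: (diagonalZ p1 Hlc Hhaus); exact: diagonal_exp_like jv.
Qed.

Lemma diagonal_iso d : diagonal d -> diagonal (Phi d).
Proof.
move=> dd; pose N := nrm d + 1.
have N0 : 0 < N by rewrite ltr_wpDl// (nrm_ge0 p1 Glc Ghaus).
have cs := @symbol_continuous _ _ _ _ p1 Glc Ghaus d.
have sN x : nc (symbol d x) <= N.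
  by apply: le_trans (j_le p1 Glc Ghaus d _) _; rewrite lerDl.
pose f1 x := complex.Re (symbol d x) / N; pose f2 x := complex.Im (symbol d x) / N.
have cf1 : continuous f1.
  move=> x; apply: cvgM; last exact: cvg_cst.
  by apply: (@cvg_comp _ _ _ (symbol d)); [exact: cs|exact: Re_continuous].
have cf2 : continuous f2.
  move=> x; apply: cvgM; last exact: cvg_cst.
  by apply: (@cvg_comp _ _ _ (symbol d)); [exact: cs|exact: Im_continuous].
have b1 x : `|f1 x| <= 1.
  rewrite normrM normfV (gtr0_norm N0) ler_pdivrMr// mul1r.
  exact: le_trans (Re_le_nc _) (sN x).
have b2 x : `|f2 x| <= 1.
  rewrite normrM normfV (gtr0_norm N0) ler_pdivrMr// mul1r.
  exact: le_trans (Im_le_nc _) (sN x).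
have [a1 j1] := diag_ex E p1 Glc Ghaus Get Gcpt (contC_real cf1).
have [a2 j2] := diag_ex E p1 Glc Ghaus Get Gcpt (contC_real cf2).
have -> : d = Fscale N%:C%C (Fadd a1 (Fscale 'i%C a2)).
  apply: (j_inj p1 Glc Ghaus); apply/funext => e; rewrite (symbol_diag p1 Glc Ghaus dd).
  rewrite !(jZ p1 Glc Ghaus, jD p1 Glc Ghaus) j1 j2 /diag mulrA -mulrDl mulrA; congr (_ * _).
  rewrite /f1 /f2; case: (symbol d _) => x y /=.
  by apply/eqP; rewrite eq_complex /=; apply/andP; split; apply/eqP; field; exact: lt0r_neq0.
rewrite (isoZ iso) (isoD iso) (isoZ iso); apply: (diagonalZ p1 Hlc Hhaus); apply: (diagonalD p1 Hlc Hhaus) => //.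
  exact: diagonal_real j1.
by apply: (diagonalZ p1 Hlc Hhaus) => //; exact: diagonal_real j2.
Qed.

End DiagonalTransport.

(** * The homeomorphism of unit spaces *)

(** The standing hypotheses on the groupoids. *)
Record nice (G : topGroupoid) : Prop := {
  nice_lc : locally_compact [set: G];
  nice_haus : hausdorff_space G;
  nice_etale : etale G;
  nice_cpt : compact (units G);
  nice_tp : topologically_principal G }.

Section Characters.
Variables (R : realType) (p : R) (G H : topGroupoid) (E : twist R G) (F : twist R H).
Hypotheses (p1 : 1 <= p) (p2 : p != 2) (nG : nice G) (nH : nice H).
Variables (Phi : Fplambda p E -> Fplambda p F) (Psi : Fplambda p F -> Fplambda p E).
Hypothesis iso : iso_pair Phi Psi.
Local Notation A := (Fplambda p E).
Local Notation B := (Fplambda p F).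
Let Glc := nice_lc nG. Let Ghaus := nice_haus nG. Let Get := nice_etale nG. Let Gcpt := nice_cpt nG.
Let Hlc := nice_lc nH. Let Hhaus := nice_haus nH. Let Het := nice_etale nH. Let Hcpt := nice_cpt nH.

Lemma nice_diagonal_iso d : diagonal d -> diagonal (Phi d).
Proof. exact: (diagonal_iso p1 p2 Glc Ghaus Get Gcpt Hlc Hhaus Het Hcpt iso). Qed.

Lemma character_mul y a b : units F y -> diagonal a ->
  jmap (Phi (Fmul a b)) y = jmap (Phi a) y * jmap (Phi b) y.
Proof.
move=> uy da; rewrite (isoM iso) (j_diag_l p1 Hlc Hhaus Het _ _ (nice_diagonal_iso da)).
by have [-> _] := unitsP uy.
Qed.

Lemma character_one y (one : A) : units F y -> iota (unit_coord (E := E)) one ->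
  jmap (Phi one) y = 1.
Proof.
move=> uy r1; have [one' r1'] : exists one : B, iota (unit_coord (E := F)) one by exact: one_ex.
rewrite (iso_one p1 Glc Ghaus Get Hlc Hhaus Het iso r1 r1') (iota_j p1 Hlc Hhaus r1').
exact: unit_coord_unit.
Qed.

Lemma symbol_fin (f : G -> R[i]) (a : A) x : jmap a = diag (E := E) f -> symbol a x = f (rng x).
Proof.
move=> ja; rewrite /symbol ja diag_at_unit; last exact: units_tw_i (units_rng x).
by rewrite tw_pi_i//; exact: units_rng.
Qed.

Lemma symbol_rng (a : A) x : symbol a (rng x) = symbol a x.
Proof. by rewrite /symbol rng_rng. Qed.

(** Finitely many elements of the kernel of a character of the diagonal combine
    into one with a nonnegative symbol, because the diagonal is closed under
    complex conjugation of symbols. *)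
Lemma sum_squares y (dd : E -> A) (s : seq E) : units F y ->
  (forall t, t \in s -> diagonal (dd t) /\ jmap (Phi (dd t)) y = 0) ->
  exists D : A, [/\ diagonal D, jmap (Phi D) y = 0 &
    forall x, symbol D x = (\sum_(t <- s) nc (symbol (dd t) x) ^+ 2)%:C%C].
Proof.
move=> uy; elim: s => [|t s IH] hs.
  have [one r1] : exists one : A, iota (unit_coord (E := E)) one by exact: one_ex.
  have j1 := iota_j p1 Glc Ghaus r1.
  exists (Fscale 0 one); split.
  - by move=> e; rewrite (jZ p1 Glc Ghaus) mul0r eqxx.
  - by rewrite (isoZ iso) (jZ p1 Hlc Hhaus) mul0r.
  - by move=> x; rewrite /symbol (jZ p1 Glc Ghaus) mul0r big_nil.
have [|D [dD hD sD]] := IH; first by move=> t' ts; apply: hs; rewrite inE ts orbT.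
have [dt ht] := hs _ (mem_head _ _).
have cs := @symbol_continuous _ _ _ _ p1 Glc Ghaus (dd t).
have cc : continuous (fun x => (complex.Re (symbol (dd t) x))%:C%C +
    - 'i%C * (complex.Im (symbol (dd t) x))%:C%C).
  have h1 : continuous (fun x => complex.Re (symbol (dd t) x)).
    by move=> x; apply: (@cvg_comp _ _ _ (symbol (dd t))); [exact: cs|exact: Re_continuous].
  have h2 : continuous (fun x => complex.Im (symbol (dd t) x)).
    by move=> x; apply: (@cvg_comp _ _ _ (symbol (dd t))); [exact: cs|exact: Im_continuous].
  exact: (contC_add (contC_real h1) (@contC_scale R G (- 'i%C) _ (contC_real h2))).
have [c jc] := diag_ex E p1 Glc Ghaus Get Gcpt cc.
have dc := diag_diagonal jc.
exists (Fadd (Fmul c (dd t)) D); split.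
- by apply: (diagonalD p1 Glc Ghaus) => //; exact: (diagonalM p1 Glc Ghaus Get).
- by rewrite (isoD iso) (jD p1 Hlc Hhaus) hD (character_mul _ uy dc) ht mulr0 addr0.
- move=> x; have uu : units E (tw_i E (rng x) 1) by exact: units_tw_i (units_rng x).
  rewrite /symbol (jD p1 Glc Ghaus) -/(symbol D x) sD big_cons (j_diag_l p1 Glc Ghaus Get _ _ dc).
  have [-> _] := unitsP uu; rewrite -/(symbol c x) (symbol_fin x jc) -/(symbol (dd t) x) symbol_rng.
  rewrite rmorphD /=; congr (_ + _); rewrite nc_sqr.
  case: (symbol (dd t) x) => u v /=.
  by apply/eqP; rewrite eq_complex /=; apply/andP; split; apply/eqP; ring.
Qed.

(** If no point represents the character [d |-> jmap (Phi d) y], compactness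
    yields a diagonal element in its kernel whose symbol vanishes nowhere, that
    is, an invertible one. *)
Lemma character_point y : units F y -> exists x, units E x /\
  forall d, diagonal d -> jmap (Phi d) y = jmap d x.
Proof.
move=> uy; apply: contrapT => nex.
have [one r1] : exists one : A, iota (unit_coord (E := E)) one by exact: one_ex.
have j1 := iota_j p1 Glc Ghaus r1.
have d1 : diagonal one by move=> e; rewrite j1; exact: unit_coord_neq0.
have ex x : exists d : A, units E x -> [/\ diagonal d, jmap (Phi d) y = 0 & jmap d x != 0].
  have [ux|] := pselect (units E x); last by exists one.
  have [d [dd nd]] : exists d : A, diagonal d /\ jmap (Phi d) y <> jmap d x.
    apply: contrapT => h; apply: nex; exists x; split=> // d dd.
    by apply: contrapT => h'; apply: h; exists d.
  exists (Fsub d (Fscale (jmap (Phi d) y) one)) => _; split.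
  - by apply: (diagonalD p1 Glc Ghaus) => //; do 2! apply: (diagonalZ p1 Glc Ghaus).
  - rewrite (isoB iso) (jB p1 Hlc Hhaus) (isoZ iso) (jZ p1 Hlc Hhaus).
    by rewrite (character_one uy r1) mulr1 subrr.
  - rewrite (jB p1 Glc Ghaus) (jZ p1 Glc Ghaus) j1 unit_coord_unit// mulr1 subr_eq0.
    by apply/eqP => h; apply: nd.
pose dd x := sval (cid (ex x)).
have ddP x : units E x -> _ := svalP (cid (ex x)).
have [||s [sX sc]] := @compact_subcover E (units E) (fun x => [set t | jmap (dd x) t != 0]).
- exact: units_compact.
- move=> x /ddP[_ _ n]; apply: open_nbhs_nbhs; split=> //.
  by apply: open_neq0; exact: j_continuous.
have [|D [dD hD sD]] := @sum_squares y dd s uy.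
  by move=> t /sX/ddP[].
have posD x : 0 < \sum_(t <- s) nc (symbol (dd t) x) ^+ 2.
  have [t ts /= nt] := sc _ (units_tw_i E (units_rng x)).
  rewrite (big_rem t)//=; apply: ltr_pwDl; first by rewrite exprn_gt0// nc_gt0.
  by apply: sumr_ge0 => t' _; rewrite sqr_ge0.
have nD x : nc (symbol D x) != 0.
  by rewrite sD nc_real ger0_norm ?gt_eqF// ltW.
have cV : continuous (fun x => (nc (symbol D x))^-1).
  move=> x; apply: cvgV; first exact: nD.
  apply: (@cvg_comp _ _ _ (symbol D)); last exact: nc_continuous.
  exact: (@symbol_continuous _ _ _ _ p1 Glc Ghaus D).
have [w jw] := diag_ex E p1 Glc Ghaus Get Gcpt (contC_real cV).
have dw := diag_diagonal jw.
have wD : Fmul w D = one.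
  apply: (j_inj p1 Glc Ghaus); rewrite (diag_mul p1 Glc Ghaus Get jw (symbol_diag p1 Glc Ghaus dD)) j1.
  apply/funext => e; rewrite /diag.
  have := nD (tw_pi (rng e)); rewrite sD nc_real ger0_norm; last by rewrite ltW.
  by move=> n; rewrite -rmorphM mulVf// mul1r.
have := character_one uy r1; rewrite -wD (character_mul _ uy dw) hD mulr0 => /eqP.
by rewrite eq_sym oner_eq0.
Qed.

End Characters.

Section UnitMap.
Variables (R : realType) (p : R) (G H : topGroupoid) (E : twist R G) (F : twist R H).
Hypotheses (p1 : 1 <= p) (p2 : p != 2) (nG : nice G) (nH : nice H).
Variables (Phi : Fplambda p E -> Fplambda p F) (Psi : Fplambda p F -> Fplambda p E).
Hypothesis iso : iso_pair Phi Psi.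

(** [y] is the image of [x] under the homeomorphism of unit spaces dual to the
    isomorphism of the diagonals. *)
Definition corresponding (x : E) (y : F) := [/\ units E x, units F y &
  forall d : Fplambda p E, diagonal d -> jmap (Phi d) y = jmap d x].

Lemma corresponding_ex_l y : units F y -> exists x, corresponding x y.
Proof.
move=> uy; have [x [ux h]] := character_point p1 p2 nG nH iso uy.
by exists x; split.
Qed.

Lemma corresponding_inj_l x x' y : corresponding x y -> corresponding x' y -> x = x'.
Proof.
case=> ux uy h [ux' _ h'].
apply: (unit_separation p1 (nice_lc nG) (nice_haus nG) (nice_etale nG) (nice_cpt nG)) => // d dd.
by rewrite -h// -h'.
Qed.

End UnitMap.

Section UnitMapSymmetry.
Variables (R : realType) (p : R) (G H : topGroupoid) (E : twist R G) (F : twist R H).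
Hypotheses (p1 : 1 <= p) (p2 : p != 2) (nG : nice G) (nH : nice H).
Variables (Phi : Fplambda p E -> Fplambda p F) (Psi : Fplambda p F -> Fplambda p E).
Hypothesis iso : iso_pair Phi Psi.

Lemma corresponding_sym x y : corresponding Phi x y <-> corresponding Psi y x.
Proof.
have iso' := iso_pair_sym iso.
split=> -[u1 u2 h]; split=> // d dd.
  by rewrite -h ?(isoVK iso)//; exact: (nice_diagonal_iso p1 p2 nH nG iso').
by rewrite -h ?(isoK iso)//; exact: (nice_diagonal_iso p1 p2 nG nH iso).
Qed.

Lemma corresponding_inj_r x y y' : corresponding Phi x y -> corresponding Phi x y' -> y = y'.
Proof.
move=> /corresponding_sym h /corresponding_sym h'.
exact: (corresponding_inj_l p1 nH h h').
Qed.

End UnitMapSymmetry.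

(** * Matching arrows *)

Section Localisation.
Variables (R : realType) (p : R) (G : topGroupoid) (E : twist R G).
Hypotheses (p1 : 1 <= p) (nG : nice G).
Local Notation A := (Fplambda p E).
Local Notation pi := (@tw_pi _ _ E).
Implicit Types (a b d : A) (e c : E).
Let Glc := nice_lc nG. Let Ghaus := nice_haus nG. Let Get := nice_etale nG. Let Gcpt := nice_cpt nG.

Definition cutoff (psi : G -> R) := continuous psi /\ forall t, 0 <= psi t <= 1.

Lemma cutoff1 : cutoff (fun _ => 1).
Proof. by split=> [t|t]; [exact: cvg_cst|rewrite ler01 lexx]. Qed.

Lemma cutoffM psi psi' : cutoff psi -> cutoff psi' -> cutoff (fun t => psi t * psi' t).
Proof.
move=> [c1 h1] [c2 h2]; split=> [t|t]; first by apply: cvgM; [exact: c1|exact: c2].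
have /andP[? ?] := h1 t; have /andP[? ?] := h2 t.
by rewrite mulr_ge0//= mulr_ile1.
Qed.

Lemma point_separation (x y : G) : x <> y -> exists psi, cutoff psi /\ psi y = 1 /\
  \forall t \near x, psi t = 0.
Proof.
move=> xy.
have oN : nbhs y [set t | t <> x].
  apply: open_nbhs_nbhs; split=> /=; last by move=> h; apply: xy.
  rewrite (_ : [set _ | _] = ~` [set x]); last by apply/seteqP; split.
  by apply: closed_openC; apply: accessible_closed_set1; exact: hausdorff_accessible.
have [psi [K [cpsi h1 py [_ clK Ky pK]]]] := lc_bump R Glc Ghaus oN.
exists psi; split => //; split => //.
have : nbhs x (~` K).
  by apply: open_nbhs_nbhs; split; [exact: closed_openC|move=> /Ky].
by apply: near_sub => t nK; apply/eqP; apply: contra_notT nK; exact: pK.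
Qed.

(** Were no arrow from [x0] to [y0] in the compact set where [|b| >= k], this set
    would be covered by finitely many open sets killed by cut-off functions
    equal to [1] at [y0] and [x0]. *)
Lemma localisation b (y0 x0 : E) k : units E y0 -> units E x0 -> 0 < k ->
  (forall psi chi, cutoff psi -> cutoff chi -> psi (pi y0) = 1 -> chi (pi x0) = 1 ->
    exists e, k <= psi (pi (rng e)) * nc (jmap b e) * chi (pi (src e))) ->
  exists e, [/\ rng e = y0, src e = x0 & k <= nc (jmap b e)].
Proof.
move=> uy ux k0 hyp; apply: contrapT => nex.
pose K := [set e | k <= nc (jmap b e)].
have cK : compact K by exact: j_compact.
have pi_units (u v : E) : units E u -> units E v -> pi u = pi v -> u = v.
  by move=> uu uv h; rewrite -(tw_i_pi uu) -(tw_i_pi uv) h.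
have ex e : exists q : (G -> R) * (G -> R), K e -> [/\ cutoff q.1, cutoff q.2,
    q.1 (pi y0) = 1, q.2 (pi x0) = 1 &
    \forall t \near e, q.1 (pi (rng t)) * q.2 (pi (src t)) = 0].
  have [ke|] := pselect (K e); last by exists (fun _ => 0, fun _ => 0).
  have [re|re] := pselect (rng e = y0); last first.
    have [|psi [c1 [h1 h2]]] := @point_separation (pi (rng e)) (pi y0).
      by move=> /(pi_units _ _ (units_rng e) uy).
    exists (psi, fun _ => 1) => _; split=> //; first exact: cutoff1.
    have : \forall t \near e, psi (pi (rng t)) = 0.
      have cpr : (fun t => pi (rng t)) @ e --> pi (rng e).
        by apply: cvg_comp; [exact: rng_continuous|exact: tw_pi_continuous].
      exact: cpr h2.
    by apply: near_sub => t /= ->; rewrite mul0r.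
  have [se|se] := pselect (src e = x0); first by case: nex; exists e; split.
  have [|psi [c1 [h1 h2]]] := @point_separation (pi (src e)) (pi x0).
    by move=> /(pi_units _ _ (units_src e) ux).
  exists (fun _ => 1, psi) => _; split=> //; first exact: cutoff1.
  have : \forall t \near e, psi (pi (src t)) = 0.
    have cps : (fun t => pi (src t)) @ e --> pi (src e).
      by apply: cvg_comp; [exact: src_continuous|exact: tw_pi_continuous].
    exact: cps h2.
  by apply: near_sub => t /= ->; rewrite mulr0.
pose q e := sval (cid (ex e)); have qP e : K e -> _ := svalP (cid (ex e)).
have [||s [sK sc]] := @compact_subcover E K
  (fun e => [set t | (q e).1 (pi (rng t)) * (q e).2 (pi (src t)) = 0]) => //.
  by move=> e /qP[].
have prod (l : seq E) : {subset l <= s} -> exists psi chi, [/\ cutoff psi, cutoff chi,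
    psi (pi y0) = 1, chi (pi x0) = 1 & forall e t, e \in l ->
    (q e).1 (pi (rng t)) * (q e).2 (pi (src t)) = 0 -> psi (pi (rng t)) * chi (pi (src t)) = 0].
  elim: l => [|e l IH] ls.
    by exists (fun _ => 1), (fun _ => 1); split=> //; exact: cutoff1.
  have [|psi [chi [c1 c2 h1 h2 h3]]] := IH; first by move=> t tl; apply: ls; rewrite inE tl orbT.
  have [c3 c4 h4 h5 _] := qP _ (sK _ (ls _ (mem_head _ _))).
  exists (fun t => (q e).1 t * psi t), (fun t => (q e).2 t * chi t); split.
  - exact: cutoffM. - exact: cutoffM. - by rewrite h4 h1 mulr1. - by rewrite h5 h2 mulr1.
  - move=> e' t; rewrite inE mulrACA => /orP[/eqP ->|e'l] hz; first by rewrite hz mul0r.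
    by rewrite (h3 e' t e'l hz) mulr0.
have [psi [chi [c1 c2 h1 h2 h3]]] := prod s (fun _ h => h).
have [e he] := hyp _ _ c1 c2 h1 h2.
have Ke : K e.
  have /andP[? ?] := c1.2 (pi (rng e)); have /andP[? ?] := c2.2 (pi (src e)).
  apply: le_trans he _; rewrite -[leRHS]mul1r -[leRHS]mulr1.
  apply: ler_pM => //; first by rewrite mulr_ge0 ?nc_ge0.
  by apply: ler_wpM2r => //; exact: nc_ge0.
have [t ts ht] := sc _ Ke.
by move: he; rewrite mulrAC (h3 t e ts ht) mul0r leNgt k0.
Qed.

(** The values above [nrm a / 2] are taken on a compact set, where a strict bound
    at each point would give a uniform one, and hence a smaller norm. *)
Lemma nrm_attained a : bisupported (jmap a) -> 0 < nrm a -> exists e, nrm a <= nc (jmap a e).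
Proof.
move=> ba; set n := nrm a => n0; apply: contrapT => nex.
have lt e : nc (jmap a e) < n by rewrite ltNge; apply/negP => h; apply: nex; exists e.
pose K := [set e | n / 2 <= nc (jmap a e)].
have n2 : 0 < n / 2 by rewrite divr_gt0.
have cK : compact K by exact: j_compact.
have [|s [sK sc]] := @compact_subcover E K
    (fun e => [set t | nc (jmap a t) < (nc (jmap a e) + n) / 2]) cK.
  move=> e _; apply: open_nbhs_nbhs; split=> /=; last by have := lt e; lra.
  by apply: open_nc_lt; exact: j_continuous.
have [M [Mn M2 hM]] : exists M, [/\ M < n, n / 2 <= M &
    forall e, e \in s -> (nc (jmap a e) + n) / 2 <= M].
  elim: s {sK sc} => [|e s [M [Mn M2 hM]]]; first by exists (n / 2); split=> //; lra.
  exists (Num.max ((nc (jmap a e) + n) / 2) M); split.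
  - by rewrite gt_max Mn andbT; have := lt e; lra.
  - by rewrite le_max M2 orbT.
  - by move=> e'; rewrite inE le_max => /orP[/eqP ->|/hM ->]; rewrite ?lexx ?orbT.
have : n <= M.
  apply: (bisupported_norm p1 Glc Ghaus ba) => [|e]; first by lra.
  have [Ke|nK] := pselect (K e).
    by have [t ts /= ht] := sc _ Ke; apply: le_trans (ltW ht) (hM _ ts).
  by apply: le_trans M2; rewrite leNgt; apply/negP => h; apply: nK; exact: ltW.
by rewrite leNgt Mn.
Qed.

Lemma cut_element (psi : G -> R) : continuous psi -> exists d : A, diagonal d /\
  forall y, units E y -> jmap d y = (psi (pi y))%:C%C.
Proof.
move=> cpsi; have [d jd] := diag_ex E p1 Glc Ghaus Get Gcpt (contC_real cpsi).
exists d; split; first exact: diag_diagonal jd.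
by move=> y uy; rewrite jd diag_at_unit.
Qed.

Lemma bisupported_sub (phi phi' : E -> R[i]) : (forall e, phi' e != 0 -> phi e != 0) ->
  bisupported phi -> bisupported phi'.
Proof. by move=> h [h1 h2]; split=> e e' /h n /h n'; [exact: h1|exact: h2]. Qed.

(** If two arrows of the support with the same source always have the same
    range, then arrows close to two distinct ones with equal source give
    isotropy at an open set of units, against topological principality. *)
Lemma parallel_col (phi : E -> R[i]) : continuous phi ->
  (forall e e', phi e != 0 -> phi e' != 0 -> src e = src e' -> rng e = rng e') ->
  forall e e', phi e != 0 -> phi e' != 0 -> src e = src e' -> pi e = pi e'.
Proof.
move=> cphi par e1 e2 n1 n2 s12; apply: contrapT => /eqP npi.
have hO := Ghaus; rewrite open_hausdorff in hO.
have [ [W1 W2] /= + [oW1 oW2 /eqP W12]] := hO _ _ npi.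
rewrite !inE => -[W1e W2e].
pose W O := pi @` ([set e | phi e != 0] `&` pi @^-1` O).
have oW O : open O -> open (W O).
  move=> oO; apply: pi_open; apply: openI; first exact: open_neq0.
  by apply: open_comp => // t _; exact: tw_pi_continuous.
have oV : open ((@src G @` W W1) `&` (@src G @` W W2)).
  by apply: openI; apply: (src_open Get); exact: oW.
have Vs : ((@src G @` W W1) `&` (@src G @` W W2)) (src (pi e1)).
  split; first by exists (pi e1) => //; exists e1.
  by exists (pi e2); [exists e2|apply/src_pi_eq].
have [z [[uz iz] [[g1 [f1 [nf1 Of1] q1] s1] [g2 [f2 [nf2 Of2] q2] s2]]]] :=
  nice_tp nG (units_src (pi e1)) (open_nbhs_nbhs (conj oV Vs)).
have sf : src f1 = src f2 by apply/src_pi_eq; rewrite q1 q2 s1 s2.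
have rg : rng g1 = rng g2 by rewrite -q1 -q2; apply/rng_pi_eq; exact: par.
have cv : composable (ginv g1) g2 by rewrite /composable srcV.
have : gmul (ginv g1) g2 = z.
  have : ([set g : G | src g = z] `&` [set g : G | rng g = z]) (gmul (ginv g1) g2).
    by split; rewrite /= ?src_mul ?rng_mul ?rngV.
  by rewrite iz.
move=> h; have := gpdVKl rg; rewrite h -s1 gmulr_src => g12.
have : (W1 `&` W2) g2 by split; [rewrite -g12 -q1|rewrite -q2].
by rewrite W12.
Qed.

Lemma parallel_bisupported (phi : E -> R[i]) : continuous phi ->
  (forall e e', phi e != 0 -> phi e' != 0 -> src e = src e' <-> rng e = rng e') ->
  bisupported phi.
Proof.
move=> cphi par; have col := parallel_col cphi (fun e e' n n' => (par e e' n n').1).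
by split=> e e' n n' h; apply: col => //; apply/(par _ _ n n').
Qed.

End Localisation.

Section Matching.
Variables (R : realType) (p : R) (G H : topGroupoid) (E : twist R G) (F : twist R H).
Hypotheses (p1 : 1 <= p) (p2 : p != 2) (nG : nice G) (nH : nice H).
Variables (Phi : Fplambda p E -> Fplambda p F) (Psi : Fplambda p F -> Fplambda p E).
Hypothesis iso : iso_pair Phi Psi.
Local Notation A := (Fplambda p E).
Local Notation corr := (corresponding Phi).
Let Glc := nice_lc nG. Let Ghaus := nice_haus nG. Let Get := nice_etale nG.
Let Hlc := nice_lc nH. Let Hhaus := nice_haus nH. Let Het := nice_etale nH.

Definition corr_arrow (e : E) (e' : F) := corr (rng e) (rng e') /\ corr (src e) (src e').

(** Cutting [a] by functions equal to [1] at the corresponding units does not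
    change the value of [Phi a] at [e'], which is bounded by the norm of the cut
    element, hence by one of its values. *)
Lemma transfer (a : A) (e' : F) : bisupported (jmap a) -> jmap (Phi a) e' != 0 ->
  exists e, corr_arrow e e' /\ nc (jmap (Phi a) e') <= nc (jmap a e).
Proof.
move=> ba ne.
have [y0 cy] := corresponding_ex_l p1 p2 nG nH iso (units_rng e').
have [x0 cx] := corresponding_ex_l p1 p2 nG nH iso (units_src e').
have [uy _ hy] := cy; have [ux _ hx] := cx.
have k0 : 0 < nc (jmap (Phi a) e') by rewrite nc_gt0.
suff [e [re se le]] : exists e, [/\ rng e = y0, src e = x0 & nc (jmap (Phi a) e') <= nc (jmap a e)].
  by exists e; split => //; rewrite /corr_arrow re se.
apply: (localisation p1 nG uy ux k0) => psi chi [cp hp] [cc hc] p0 ch0.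
have [d1 [dd1 jd1]] := cut_element E p1 nG cp; have [d2 [dd2 jd2]] := cut_element E p1 nG cc.
pose a' := Fmul (Fmul d1 a) d2.
have ja' e : jmap a' e = (psi (tw_pi (rng e)))%:C%C * jmap a e * (chi (tw_pi (src e)))%:C%C.
  rewrite (j_diag_r p1 Glc Ghaus Get _ _ dd2) (j_diag_l p1 Glc Ghaus Get _ _ dd1).
  by rewrite jd1 ?jd2//; [exact: units_src|exact: units_rng].
have ba' : bisupported (jmap a').
  apply: bisupported_sub ba => e; rewrite ja' !mulf_eq0 !negb_or.
  by move=> /andP[/andP[_ ->] _].
have ja'' : jmap (Phi a') e' = jmap (Phi a) e'.
  have dd1' := nice_diagonal_iso p1 p2 nG nH iso dd1.
  have dd2' := nice_diagonal_iso p1 p2 nG nH iso dd2.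
  rewrite !(isoM iso) (j_diag_r p1 Hlc Hhaus Het _ _ dd2') (j_diag_l p1 Hlc Hhaus Het _ _ dd1').
  by rewrite hy// hx// jd1// jd2// p0 ch0 mul1r mulr1.
have le1 : nc (jmap (Phi a) e') <= nrm a'.
  by rewrite -ja'' -(isoN iso); exact: (j_le p1 Hlc Hhaus).
have [e he] := nrm_attained p1 nG ba' (lt_le_trans k0 le1).
exists e; apply: le_trans le1 _; apply: le_trans he _.
have /andP[h1 _] := hp (tw_pi (rng e)); have /andP[h2 _] := hc (tw_pi (src e)).
by rewrite ja' !ncM !nc_real !ger0_norm.
Qed.

(** Two arrows in the support of [Phi a] come from arrows in the support of [a];
    if they share a source they are therefore parallel, and principality makes
    them equal up to the circle. *)
Lemma bisupported_iso (a : A) : bisupported (jmap a) -> bisupported (jmap (Phi a)).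
Proof.
move=> ba; apply: (parallel_bisupported nH); first exact: j_continuous.
have [cb rb] := ba.
move=> e e' n n'.
have [f [[r1 s1] l1]] := transfer ba n; have [f' [[r2 s2] l2]] := transfer ba n'.
have nf : jmap a f != 0 by rewrite -nc_gt0; apply: lt_le_trans l1; rewrite nc_gt0.
have nf' : jmap a f' != 0 by rewrite -nc_gt0; apply: lt_le_trans l2; rewrite nc_gt0.
split=> h.
  rewrite h in s1; have sf := corresponding_inj_l p1 nG s1 s2.
  have rf := pi_eq_rng (cb _ _ nf nf' sf).
  by rewrite rf in r1; exact: (corresponding_inj_r p1 p2 nG nH iso r1 r2).
rewrite h in r1; have rf := corresponding_inj_l p1 nG r1 r2.
have sf := pi_eq_src (rb _ _ nf nf' rf).
by rewrite sf in s1; exact: (corresponding_inj_r p1 p2 nG nH iso s1 s2).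
Qed.

End Matching.

Section MatchingSymmetry.
Variables (R : realType) (p : R) (G H : topGroupoid) (E : twist R G) (F : twist R H).
Hypotheses (p1 : 1 <= p) (p2 : p != 2) (nG : nice G) (nH : nice H).
Variables (Phi : Fplambda p E -> Fplambda p F) (Psi : Fplambda p F -> Fplambda p E).
Hypothesis iso : iso_pair Phi Psi.
Local Notation A := (Fplambda p E).

Lemma corr_arrow_sym e e' : corr_arrow Phi e e' <-> corr_arrow Psi e' e.
Proof.
by split=> -[h1 h2]; split; [exact/(corresponding_sym p1 p2 nG nH iso)..
  |exact/(corresponding_sym p1 p2 nG nH iso)|exact/(corresponding_sym p1 p2 nG nH iso)].
Qed.

(** Transferring to [F] and back shows that both values have the same modulus;
    the circle action adjusts the phase. *)
Lemma matching (a : A) (e : E) : bisupported (jmap a) -> jmap a e != 0 ->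
  exists e', corr_arrow Phi e e' /\ jmap (Phi a) e' = jmap a e.
Proof.
move=> ba ne; have iso' := iso_pair_sym iso.
have ba' := bisupported_iso p1 p2 nG nH iso ba.
have ne' : jmap (Psi (Phi a)) e != 0 by rewrite (isoK iso).
have [e' [/corr_arrow_sym ce' l1]] := transfer p1 p2 nH nG iso' ba' ne'.
rewrite (isoK iso) in l1.
have n' : jmap (Phi a) e' != 0 by rewrite -nc_gt0; apply: lt_le_trans l1; rewrite nc_gt0.
have [f [cf l2]] := transfer p1 p2 nG nH iso ba n'.
have sf : src f = src e by exact: (corresponding_inj_l p1 nG cf.2 ce'.2).
have nf : jmap a f != 0 by rewrite -nc_gt0; apply: lt_le_trans l2; rewrite nc_gt0.
have [z cz ez] := pi_fibre (ba.1 _ _ nf ne sf).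
have nfe : nc (jmap a e) = nc (jmap a f).
  by rewrite ez (j_equivariant p1 (nice_lc nG) (nice_haus nG))// nc_circleM.
have eqn : nc (jmap (Phi a) e') = nc (jmap a e) by apply/eqP; rewrite eq_le l1 nfe l2.
have [w cw hw] := nc_eqcircle eqn n'.
exists (tw_act w e'); rewrite (j_equivariant p1 (nice_lc nH) (nice_haus nH))//; split => //.
by rewrite /corr_arrow rng_act// src_act.
Qed.

End MatchingSymmetry.

(** * The isomorphism of twists *)

Section Bumps.
Variables (R : realType) (p : R) (G : topGroupoid) (E : twist R G).
Hypotheses (p1 : 1 <= p) (nG : nice G).
Local Notation A := (Fplambda p E).
Local Notation pi := (@tw_pi _ _ E).
Implicit Types (a b : A) (e c : E).
Let Glc := nice_lc nG. Let Ghaus := nice_haus nG. Let Get := nice_etale nG.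

(** Values close to [1] of a bump confine both the base point and the phase of an
    arrow; this separates points and gives continuity below. *)
Lemma bump_ex e0 O : nbhs e0 O -> exists a, [/\ bisupported (jmap a), jmap a e0 = 1 &
  exists2 r, 0 < r & forall e, nc (1 - jmap a e) < r -> O e].
Proof.
move=> hO; have [f [U [K [[Sf bU cK KU fK] [f1 _ fO]]]]] := Sigma_bump Glc Ghaus hO.
have [a ra] := iota_ex p1 Glc Ghaus Sf.
exists a; rewrite (iota_j p1 Glc Ghaus ra); split => //.
by apply: elementary_bisupported; split => //; exists U, K.
Qed.

(** A nonzero product value at [e] factors [e] through arrows of both supports. *)
Lemma bisupportedM a b : bisupported (jmap a) -> bisupported (jmap b) ->
  bisupported (jmap (Fmul a b)).
Proof.
move=> [ca ra] [cb rb].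
have fac e : jmap (Fmul a b) e != 0 -> exists c, [/\ src c = src e,
    jmap a (gmul e (ginv c)) != 0 & jmap b c != 0].
  move=> ne; have [[c [ce nbc]]|nex] := pselect (exists c, src c = src e /\ jmap b c != 0).
    exists c; split => //; move: ne.
    rewrite (j_mul_col p1 Glc Ghaus Get _ ce).
      by rewrite mulf_eq0 negb_or => /andP[].
    by move=> d de nd; apply: cb => //; rewrite de.
  have b0 d : src d = src e -> jmap b d = 0.
    by move=> de; apply/eqP; apply: contra_notT nex => nd; exists d.
  move: ne; rewrite (@j_mul_col _ _ _ _ p1 Glc Ghaus Get a b e e)//.
    by rewrite b0// mulr0 eqxx.
  by move=> d de; rewrite b0// eqxx.
have pdiv c e : src c = src e -> pi e = gmul (pi (gmul e (ginv c))) (pi c).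
  move=> ce; rewrite -pi_mul; first by rewrite gpd_divK.
  by rewrite /composable src_div.
split=> e e' /fac[c [ce nac nbc]] /fac[c' [ce' nac' nbc']] h.
  have pc : pi c = pi c' by apply: cb => //; rewrite ce ce'.
  rewrite (pdiv _ _ ce) (pdiv _ _ ce') pc; congr (gmul _ _); apply: ca => //.
  by rewrite !src_div//; exact: pi_eq_rng.
have pa : pi (gmul e (ginv c)) = pi (gmul e' (ginv c')).
  by apply: ra => //; rewrite !rng_div.
rewrite (pdiv _ _ ce) (pdiv _ _ ce') pa; congr (gmul _ _); apply: rb => //.
by have := pi_eq_src pa; rewrite !src_div.
Qed.

Lemma j_combination k l a b t :
  jmap (Fsub (Fscale k a) (Fscale l b)) t = k * jmap a t - l * jmap b t.
Proof.
apply: etrans (jB p1 Glc Ghaus (Fscale k a) (Fscale l b) t) _.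
exact: (f_equal2 (fun x y => x - y) (jZ p1 Glc Ghaus k a t) (jZ p1 Glc Ghaus l b t)).
Qed.

Lemma j_neq0_fibre a e c : pi e = pi c -> nc (jmap a e) = nc (jmap a c).
Proof.
by move=> /pi_fibre[z cz ->]; rewrite (j_equivariant p1 Glc Ghaus)// nc_circleM.
Qed.

End Bumps.

Section Matched.
Variables (R : realType) (p : R) (G H : topGroupoid) (E : twist R G) (F : twist R H).
Hypotheses (p1 : 1 <= p) (p2 : p != 2) (nG : nice G) (nH : nice H).
Variables (Phi : Fplambda p E -> Fplambda p F) (Psi : Fplambda p F -> Fplambda p E).
Hypothesis iso : iso_pair Phi Psi.
Local Notation A := (Fplambda p E).
Let Glc := nice_lc nG. Let Ghaus := nice_haus nG. Let Get := nice_etale nG.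
Let Hlc := nice_lc nH. Let Hhaus := nice_haus nH. Let Het := nice_etale nH.

Lemma iso_combination k l (a b : A) t :
  jmap (Phi (Fsub (Fscale k a) (Fscale l b))) t = k * jmap (Phi a) t - l * jmap (Phi b) t.
Proof.
rewrite (_ : Phi _ = Fsub (Fscale k (Phi a)) (Fscale l (Phi b))).
  exact: (j_combination p1 nH).
exact: (etrans (isoB iso _ _) (f_equal2 (@Fsub _ _ _ _) (isoZ iso k a) (isoZ iso l b))).
Qed.

(** The combination of [a] and [b] that vanishes at [e] has small norm after
    being cut down near the source of [e], while the cut does not change the value
    of its image at [e']. *)
Lemma matching_nonzero (a b : A) e e' : bisupported (jmap a) -> bisupported (jmap b) ->
  jmap a e != 0 -> jmap b e != 0 -> corr_arrow Phi e e' ->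
  jmap (Phi a) e' = jmap a e -> jmap (Phi b) e' = jmap b e.
Proof.
move=> ba bb na nb [_ cs] ha.
pose c : A := Fsub (Fscale (jmap b e) a) (Fscale (jmap a e) b).
have jc t : jmap c t = jmap b e * jmap a t - jmap a e * jmap b t.
  exact: (j_combination p1 nG).
suff jc0 : jmap (Phi c) e' = 0.
  move: jc0; rewrite /c iso_combination.
  rewrite ha [jmap b e * _]mulrC.
  by move/eqP; rewrite -mulrBr mulf_eq0 (negbTE na) subr_eq0 => /eqP.
clearbody c; apply: nc_small_eq0 => eps eps0; have e2 : 0 < eps / 2 by rewrite divr_gt0.
pose U := [set t | jmap a t != 0] `&` [set t | jmap b t != 0] `&` [set t | nc (jmap c t) < eps / 2].
have oU : open U.
  by apply: openI; [apply: openI; apply: open_neq0|apply: open_nc_lt]; exact: j_continuous.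
have Ue : U e by split; [split|]; rewrite //= jc mulrC subrr Normc.normc0.
have oV : open (@src G @` (@tw_pi _ _ E @` U)) by apply: (src_open Get); exact: pi_open.
have Ve : (@src G @` (@tw_pi _ _ E @` U)) (tw_pi (src e)).
  by exists (tw_pi e); [exists e|rewrite pi_src].
have [psi [K [cpsi hpsi p0 [_ _ KV pK]]]] := lc_bump R Glc Ghaus (open_nbhs_nbhs (conj oV Ve)).
have [d [dd jd]] := cut_element E p1 nG cpsi.
have jcd t : jmap (Fmul c d) t = jmap c t * (psi (tw_pi (src t)))%:C%C.
  by rewrite (j_diag_r p1 Glc Ghaus Get _ _ dd) jd//; exact: units_src.
have near_U t : jmap (Fmul c d) t != 0 -> exists2 f, U f & tw_pi t = tw_pi f.
  rewrite jcd mulf_eq0 negb_or => /andP[nct].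
  have [->|n _] := eqVneq (psi (tw_pi (src t))) 0; first by rewrite eqxx.
  have [_ [f Uf <-] sf] := KV _ (pK _ n); exists f => //.
  have sft : src f = src t by apply/src_pi_eq; rewrite sf pi_src.
  have [[/= nfa nfb] _] := Uf.
  have [at0|nat] := eqVneq (jmap a t) 0; last by apply: ba.1.
  apply: bb.1 => //; apply: contraNneq nct => bt0.
  by rewrite jc at0 bt0 !mulr0 subrr.
have bcd : bisupported (jmap (Fmul c d)).
  apply: bisupported_sub ba => t /near_U[f [[/= nf _] _] tf].
  by rewrite -nc_gt0 (j_neq0_fibre p1 nG a tf) nc_gt0.
have ncd : nrm (Fmul c d) <= eps / 2.
  apply: (bisupported_norm p1 Glc Ghaus bcd) => [|t]; first exact: ltW.
  have [->|/near_U[f [_ /= fe] tf]] := eqVneq (jmap (Fmul c d) t) 0.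
    by rewrite Normc.normc0 ltW.
  rewrite jcd ncM (j_neq0_fibre p1 nG c tf) nc_real.
  have /andP[h0 h1] := hpsi (tw_pi (src t)); rewrite ger0_norm//.
  have := nc_ge0 (jmap c f); move: (nc (jmap c f)) (psi _) h0 h1 fe => x y y0 y1 hx x0.
  by nra.
have jPd : jmap (Phi (Fmul c d)) e' = jmap (Phi c) e'.
  rewrite (isoM iso c d) (j_diag_r p1 Hlc Hhaus Het (Phi c) e' (nice_diagonal_iso p1 p2 nG nH iso dd)).
  have [us _ hs] := cs; rewrite hs// jd// p0.
  by rewrite mulr1.
rewrite -jPd; apply: le_lt_trans (j_le p1 Hlc Hhaus _ _) _.
by rewrite (isoN iso); apply: le_lt_trans ncd _; lra.
Qed.

(** The graph of the isomorphism of twists under construction. *)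
Definition matched (e : E) (e' : F) := corr_arrow Phi e e' /\
  forall a, bisupported (jmap a) -> jmap (Phi a) e' = jmap a e.

End Matched.

Section MatchedFacts.
Variables (R : realType) (p : R) (G H : topGroupoid) (E : twist R G) (F : twist R H).
Hypotheses (p1 : 1 <= p) (p2 : p != 2) (nG : nice G) (nH : nice H).
Variables (Phi : Fplambda p E -> Fplambda p F) (Psi : Fplambda p F -> Fplambda p E).
Hypothesis iso : iso_pair Phi Psi.
Let iso' := iso_pair_sym iso.
Let Glc := nice_lc nG. Let Ghaus := nice_haus nG. Let Get := nice_etale nG.
Let Hlc := nice_lc nH. Let Hhaus := nice_haus nH. Let Het := nice_etale nH.

(** The arrow matching one bump at [e] matches every bisupported element that is
    nonzero at [e]; one that vanishes at [e] cannot become nonzero at [e'], as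
    the inverse isomorphism would then carry that value back to [e]. *)
Lemma matched_ex e : exists e', matched Phi e e'.
Proof.
have [a [ba a1 _]] := bump_ex p1 nG (@filterT _ (nbhs e) _).
have na : jmap a e != 0 by rewrite a1 oner_eq0.
have [e' [ce ha]] := matching p1 p2 nG nH iso ba na.
exists e'; split => // b bb.
have [b0|nb] := eqVneq (jmap b e) 0; last exact: (matching_nonzero p1 p2 nG nH iso ba bb).
rewrite b0; apply/eqP; apply: contraT => nb'.
have na' : jmap (Phi a) e' != 0 by rewrite ha.
have ba' := bisupported_iso p1 p2 nG nH iso ba.
have bb' := bisupported_iso p1 p2 nG nH iso bb.
have ce' := (corr_arrow_sym p1 p2 nG nH iso e e').1 ce.
have := matching_nonzero p1 p2 nH nG iso' ba' bb' na' nb' ce'.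
by rewrite !(isoK iso) ha => /(_ erefl) h; rewrite -h b0 eqxx in nb'.
Qed.

Lemma matched_sym e e' : matched Phi e e' <-> matched Psi e' e.
Proof.
split=> -[/(corr_arrow_sym p1 p2 nG nH iso) c h]; split => // a ba.
  by rewrite -h ?(isoVK iso)//; exact: (bisupported_iso p1 p2 nH nG iso').
by rewrite -h ?(isoK iso)//; exact: (bisupported_iso p1 p2 nG nH iso).
Qed.

Lemma matched_inj_r e e1 e2 : matched Phi e e1 -> matched Phi e e2 -> e1 = e2.
Proof.
move=> [_ h1] [_ h2]; apply: contrapT => n12.
have oN : nbhs e1 [set t | t <> e2].
  apply: open_nbhs_nbhs; split=> //.
  rewrite (_ : [set _ | _] = ~` [set e2]); last by apply/seteqP; split.
  apply: closed_openC; apply: accessible_closed_set1; apply: hausdorff_accessible.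
  exact: tw_hausdorff.
have [b [bb b1 [r r0 hr]]] := bump_ex p1 nH oN.
have bb' := bisupported_iso p1 p2 nH nG iso' bb.
have := h1 _ bb'; have := h2 _ bb'; rewrite (isoVK iso) b1 => q1 q2.
by apply: (hr e2); rewrite // q1 -q2 subrr Normc.normc0.
Qed.

Lemma matched_act e e' z : circle z -> matched Phi e e' -> matched Phi (tw_act z e) (tw_act z e').
Proof.
move=> cz [ce h]; split; first by rewrite /corr_arrow !rng_act// !src_act.
move=> a ba; rewrite (j_equivariant p1 Hlc Hhaus)// (j_equivariant p1 Glc Ghaus)//.
by rewrite h.
Qed.

(** Bumps at [e] and [f] have a product with value [1] at [e f], and the image of
    this product takes the value [1] both at [e' f'] and at the arrow matched
    with [e f]; being bisupported, it tells these two arrows apart. *)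
Lemma matched_mul e f e' f' : matched Phi e e' -> matched Phi f f' -> composable e f ->
  composable e' f' /\ matched Phi (gmul e f) (gmul e' f').
Proof.
move=> me mf cef; have [[re se] he] := me; have [[rf sf] hf] := mf.
have cef' : composable e' f'.
  rewrite cef in se; exact: (corresponding_inj_r p1 p2 nG nH iso se rf).
split => //; have [c mc] := matched_ex (gmul e f); have [[rc sc] hc] := mc.
suff <- : c = gmul e' f' by [].
have [a [ba a1 _]] := bump_ex p1 nG (@filterT _ (nbhs e) _).
have [b [bb b1 _]] := bump_ex p1 nG (@filterT _ (nbhs f) _).
have bM := bisupportedM p1 nG ba bb.
have ba' := bisupported_iso p1 p2 nG nH iso ba.
have bb' := bisupported_iso p1 p2 nG nH iso bb.
have bM' := bisupported_iso p1 p2 nG nH iso bM.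
have j1 : jmap (Fmul a b) (gmul e f) = 1.
  rewrite (@j_mul_col _ _ _ _ p1 Glc Ghaus Get a b _ f) ?src_mul//.
    by rewrite gpdKr// a1 b1 mulr1.
  by move=> d df nd; apply: bb.1; rewrite // b1 oner_eq0.
have j2 : jmap (Phi (Fmul a b)) (gmul e' f') = 1.
  have fb : jmap (Phi b) f' = 1 by rewrite hf.
  rewrite (isoM iso) (@j_mul_col _ _ _ _ p1 Hlc Hhaus Het _ _ _ f') ?src_mul//.
    by rewrite gpdKr// fb he// a1 mulr1.
  by move=> d df nd; apply: bb'.1; rewrite // fb oner_eq0.
have j3 : jmap (Phi (Fmul a b)) c = 1 by rewrite hc.
have sce : src c = src (gmul e' f').
  rewrite src_mul//; rewrite src_mul// in sc.
  exact: (corresponding_inj_r p1 p2 nG nH iso sc sf).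
have pce : tw_pi c = tw_pi (gmul e' f') by apply: bM'.1; rewrite ?j2 ?j3 ?oner_eq0.
have [z cz zE] := pi_fibre pce.
move: j2; rewrite zE (j_equivariant p1 Hlc Hhaus)// j3 mulr1 => z1.
by rewrite z1 act1.
Qed.

(** A bump at [phi e] pulls back to a continuous function, whose values near [1]
    confine [phi t]. *)
Lemma matched_continuous (phi : E -> F) : (forall e, matched Phi e (phi e)) -> continuous phi.
Proof.
move=> hphi e O /= hO.
have [b [bb b1 [r r0 hr]]] := bump_ex p1 nH hO.
have bb' := bisupported_iso p1 p2 nH nG iso' bb.
have jb t : jmap b (phi t) = jmap (Psi b) t.
  by have [_ /(_ _ bb')] := hphi t; rewrite (isoVK iso).
have ct := (continuousC_near (jmap (Psi b))).1 (j_continuous p1 Glc Ghaus (a := Psi b)) e r r0.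
rewrite /= nbhs_simpl; apply: near_sub ct => t /= ht; apply: hr.
by rewrite -b1 !jb.
Qed.

End MatchedFacts.

Section TwistIsomorphism.
Variables (R : realType) (p : R) (G H : topGroupoid) (E : twist R G) (F : twist R H).
Hypotheses (p1 : 1 <= p) (p2 : p != 2) (nG : nice G) (nH : nice H).
Variables (Phi : Fplambda p E -> Fplambda p F) (Psi : Fplambda p F -> Fplambda p E).
Hypothesis iso : iso_pair Phi Psi.

Lemma equivariant_iso_ex : exists phi : groupoid_iso E F,
  forall z e, circle z -> phi (tw_act z e) = tw_act z (phi e).
Proof.
have iso' := iso_pair_sym iso.
have exf := matched_ex p1 p2 nG nH iso; have exg := matched_ex p1 p2 nH nG iso'.
pose f e := sval (cid (exf e)); have fP e : matched Phi e (f e) := svalP (cid (exf e)).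
pose g e' := sval (cid (exg e')); have gP e' : matched Psi e' (g e') := svalP (cid (exg e')).
have fK : cancel f g.
  move=> e; apply: (matched_inj_r p1 p2 nH nG iso' (gP (f e))).
  exact/(matched_sym p1 p2 nG nH iso).
have gK : cancel g f.
  move=> e; apply: (matched_inj_r p1 p2 nG nH iso (fP (g e))).
  exact/(matched_sym p1 p2 nG nH iso).
have cf := matched_continuous p1 p2 nG nH iso fP.
have cg := matched_continuous p1 p2 nH nG iso' gP.
have hf : groupoid_hom f.
  move=> a b cab; have [c m] := matched_mul p1 p2 nG nH iso (fP a) (fP b) cab.
  by split => //; exact: (matched_inj_r p1 p2 nG nH iso (fP _) m).
exists (GroupoidIso fK gK cf cg hf) => z e cz /=.
exact: (matched_inj_r p1 p2 nG nH iso (fP _) (matched_act p1 nG nH cz (fP e))).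
Qed.

End TwistIsomorphism.

(** * Proper isomorphism of twists *)

Section IsoOperations.

Lemma iso_id_hom (G : topGroupoid) : groupoid_hom (@id G).
Proof. by []. Qed.

Definition iso_refl (G : topGroupoid) : groupoid_iso G G :=
  @GroupoidIso G G id id (fun _ => erefl) (fun _ => erefl)
    (fun _ => cvg_id) (fun _ => cvg_id) (@iso_id_hom G).

Definition iso_sym (G H : topGroupoid) (f : groupoid_iso G H) : groupoid_iso H G :=
  @GroupoidIso H G (iso_inv f) f (iso_invK f) (iso_funK f)
    (@iso_inv_continuous _ _ f) (@iso_fun_continuous _ _ f) (@iso_inv_hom _ _ f).

Lemma iso_trans (G H K : topGroupoid) (f : groupoid_iso G H) (g : groupoid_iso H K) :
  exists h : groupoid_iso G K, forall x, h x = g (f x).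
Proof.
have hf : groupoid_hom (fun x => g (f x)).
  move=> a b cab; have [c1 e1] := iso_fun_hom f cab; have [c2 e2] := iso_fun_hom g c1.
  by split => //; rewrite e1.
have hK : cancel (fun x => g (f x)) (fun y => iso_inv f (iso_inv g y)).
  by move=> x; rewrite iso_funK iso_funK.
have hVK : cancel (fun y => iso_inv f (iso_inv g y)) (fun x => g (f x)).
  by move=> x; rewrite iso_invK iso_invK.
have cf : continuous (fun x => g (f x)).
  by move=> x; apply: (@cvg_comp _ _ _ f g); [exact: iso_fun_continuous|exact: iso_fun_continuous].
have cg : continuous (fun y => iso_inv f (iso_inv g y)).
  by move=> x; apply: (@cvg_comp _ _ _ (iso_inv g) (iso_inv f));
    [exact: iso_inv_continuous|exact: iso_inv_continuous].
by exists (GroupoidIso hK hVK cf cg hf).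
Qed.

Variables (R : realType) (G : topGroupoid).
Implicit Types E : twist R G.

Lemma properly_isomorphic_refl E : properly_isomorphic E E.
Proof. by exists (iso_refl E). Qed.

Lemma properly_isomorphic_sym E E' : properly_isomorphic E E' -> properly_isomorphic E' E.
Proof.
move=> [f [h1 h2]]; exists (iso_sym f); split=> [x z ux cz|e] /=.
  by rewrite -h1// iso_funK.
by rewrite -{2}(iso_invK f e) h2.
Qed.

Lemma properly_isomorphic_trans E E' E'' :
  properly_isomorphic E E' -> properly_isomorphic E' E'' -> properly_isomorphic E E''.
Proof.
move=> [f [h1 h2]] [g [k1 k2]]; have [h hE] := iso_trans f g.
exists h; split=> [x z ux cz|e]; first by rewrite hE h1// k1.
by rewrite hE k2 h2.
Qed.

Lemma twist_class_eq E E' : twist_class E = twist_class E' <-> properly_isomorphic E E'.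
Proof.
split=> [h|h].
  have : twist_class E' E' by exact: properly_isomorphic_refl.
  by rewrite -h.
apply/funext => E''; apply/propext; split.
  by apply: properly_isomorphic_trans; exact: properly_isomorphic_sym.
exact: properly_isomorphic_trans.
Qed.

End IsoOperations.

Section TwistUnits.
Variables (R : realType) (G : topGroupoid) (E : twist R G).

Lemma tw_i_act x z : units G x -> circle z -> tw_i E x z = tw_act z (tw_i E x 1).
Proof.
move=> ux cz; have r1 : rng (tw_i E x 1) = tw_i E x 1 by have [] := unitsP (units_tw_i E ux).
rewrite /tw_act r1 tw_pi_i//.
by have [_] := tw_i_hom E ux cz (circle1 R); rewrite mulr1.
Qed.

Lemma composable_pi (a b : E) : composable (tw_pi a) (tw_pi b) -> composable a b.
Proof.
move=> c; have : src a = src (ginv b) by apply/src_pi_eq; rewrite pi_inv srcV.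
by rewrite srcV.
Qed.

End TwistUnits.

Section BaseIsomorphism.
Variables (R : realType) (G H : topGroupoid) (E : twist R G) (F : twist R H).

(** An equivariant isomorphism of the total groupoids descends to the quotients
    by the circle action; the descended map is continuous because the projection
    is open. *)
Lemma base_isomorphism (phi : groupoid_iso E F) :
  (forall z e, circle z -> phi (tw_act z e) = tw_act z (phi e)) ->
  exists theta : groupoid_iso G H, properly_isomorphic E (pullback_twist theta F).
Proof.
move=> eq; have eq' z e : circle z -> iso_inv phi (tw_act z e) = tw_act z (iso_inv phi e).
  by move=> cz; rewrite -{1}(iso_invK phi e) -eq// iso_funK.
pose th (g : G) := tw_pi (phi (tw_lift E g)).
pose th' (h : H) := tw_pi (iso_inv phi (tw_lift F h)).
have thE e : tw_pi (phi e) = th (tw_pi e).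
  by have [z cz ez] := lift_fibre e; rewrite {1}ez eq// pi_act.
have th'E e : tw_pi (iso_inv phi e) = th' (tw_pi e).
  by have [z cz ez] := lift_fibre e; rewrite {1}ez eq'// pi_act.
have thK : cancel th th' by move=> g; rewrite /th -th'E iso_funK pi_lift.
have th'K : cancel th' th by move=> h; rewrite /th' -thE iso_invK pi_lift.
have cth : continuous th.
  apply/continuousP => W oW.
  have -> : th @^-1` W = @tw_pi _ _ E @` ((fun e => tw_pi (phi e)) @^-1` W).
    apply/seteqP; split=> [g Wg|_ [e We <-]]; last by rewrite /= -thE.
    by exists (tw_lift E g); [|exact: pi_lift].
  apply: pi_open; apply: open_comp => // e _.
  by apply: (@cvg_comp _ _ _ phi); [exact: iso_fun_continuous|exact: tw_pi_continuous].
have cth' : continuous th'.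
  apply/continuousP => W oW.
  have -> : th' @^-1` W = @tw_pi _ _ F @` ((fun e => tw_pi (iso_inv phi e)) @^-1` W).
    apply/seteqP; split=> [g Wg|_ [e We <-]]; last by rewrite /= -th'E.
    by exists (tw_lift F g); [|exact: pi_lift].
  apply: pi_open; apply: open_comp => // e _.
  by apply: (@cvg_comp _ _ _ (iso_inv phi)); [exact: iso_inv_continuous|exact: tw_pi_continuous].
have hth : groupoid_hom th.
  move=> a b cab.
  have c : composable (tw_lift E a) (tw_lift E b) by apply: composable_pi; rewrite !pi_lift.
  have [c1 e1] := iso_fun_hom phi c.
  have [c2 e2] := @tw_pi_hom _ _ F _ _ c1; split => //.
  by rewrite -{1}(pi_lift E a) -{1}(pi_lift E b) -pi_mul// -thE e1 e2.
pose theta := GroupoidIso thK th'K cth cth' hth.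
exists theta, (phi : groupoid_iso E (pullback_twist theta F)); split=> [x z ux cz|e] /=.
  rewrite /pullback_i /= tw_i_act// eq// [RHS]tw_i_act//; last exact: (hom_units hth ux).
  congr (tw_act z _); rewrite -[LHS]tw_i_pi; last first.
    by apply: (hom_units (@iso_fun_hom _ _ phi)); exact: units_tw_i.
  by rewrite thE tw_pi_i.
by rewrite /pullback_pi /= thE thK.
Qed.

End BaseIsomorphism.

(** * Isomorphic twists have isomorphic algebras *)

(** An equivariant isomorphism of twists over an isomorphism of groupoids,
    together with the inverses. *)
Record twist_pair (R : realType) (G H : topGroupoid) (E : twist R G) (F : twist R H)
    (f : E -> F) (g : F -> E) (t : G -> H) (s : H -> G) : Prop := {
  tpK : cancel f g;
  tpVK : cancel g f;
  tp_cont : continuous f;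
  tpV_cont : continuous g;
  tp_hom : groupoid_hom f;
  tpV_hom : groupoid_hom g;
  tp_pi : forall e, tw_pi (f e) = t (tw_pi e);
  tpV_pi : forall e, tw_pi (g e) = s (tw_pi e);
  tp_act : forall z e, circle z -> f (tw_act z e) = tw_act z (f e);
  tpV_act : forall z e, circle z -> g (tw_act z e) = tw_act z (g e);
  tp_baseK : cancel t s;
  tp_baseVK : cancel s t;
  tp_base_hom : groupoid_hom t;
  tpV_base_hom : groupoid_hom s }.

Lemma twist_pair_sym (R : realType) (G H : topGroupoid) (E : twist R G) (F : twist R H)
    (f : E -> F) (g : F -> E) (t : G -> H) (s : H -> G) :
  twist_pair f g t s -> twist_pair g f s t.
Proof. by case=> *; split. Qed.

Section Transport.
Variables (R : realType) (p : R) (G H : topGroupoid) (E : twist R G) (F : twist R H).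
Hypotheses (p1 : 1 <= p).
Hypotheses (Glc : locally_compact [set: G]) (Ghaus : hausdorff_space G).
Hypotheses (Hlc : locally_compact [set: H]) (Hhaus : hausdorff_space H).
Variables (f : E -> F) (g : F -> E) (t : G -> H) (s : H -> G).
Hypothesis tp : twist_pair f g t s.
Implicit Types (phi xi : E -> R[i]) (x : G).

Definition transport phi : F -> R[i] := fun e => phi (g e).

Lemma transport_equivariant phi : equivariant phi -> equivariant (transport phi).
Proof. by move=> ephi z e cz; rewrite /transport (tpV_act tp)// ephi. Qed.

Lemma transport_Sigma phi : Sigma_c phi -> Sigma_c (transport phi).
Proof.
move=> /Sigma_cP[cphi ephi [K cK phiK]]; apply/Sigma_cP; split.
- move=> e; apply: (@cvg_comp _ _ _ g phi); [exact: (tpV_cont tp)|exact: cphi].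
- exact: transport_equivariant.
- exists (f @` K); last by move=> e /phiK Ke; exists (g e) => //; exact: (tpVK tp).
  by apply: continuous_compact => //; apply: continuous_subspaceT => e; exact: (tp_cont tp).
Qed.

Lemma transport_fibre x (e : F) : src_fibre F (t x) e <-> src_fibre E x (g e).
Proof.
split=> /src_fibreE h; apply/src_fibreE.
  by rewrite (tpV_pi tp) -(hom_src (tpV_base_hom tp)) h (tp_baseK tp).
by rewrite -h (tpV_pi tp) (hom_src (tp_base_hom tp)) (tp_baseVK tp).
Qed.

Lemma transport_Lp x xi : Lp p x xi ->
  Lp p (t x) (transport xi) /\ Lpn p (t x) (transport xi) <= Lpn p x xi.
Proof.
move=> Lx; have [xoff exi _] := (LpP p1 Glc Ghaus x xi).1 Lx.
have b : pbounded p (t x) (transport xi) (Lpn p x xi `^ p).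
  move=> l ul lx.
  have -> : \sum_(h <- l) nc (transport xi (tw_lift F h)) `^ p =
      \sum_(k <- map s l) nc (xi (tw_lift E k)) `^ p.
    rewrite big_map; apply: eq_bigr => h _; congr (_ `^ _).
    by rewrite /transport -(lift_nc (g (tw_lift F h)) exi) (tpV_pi tp) pi_lift.
  apply: (Lpn_sum p1 Ghaus Lx).
    by rewrite map_inj_uniq//; exact: can_inj (tp_baseVK tp).
  by move=> _ /mapP[h /lx hx ->]; rewrite -(hom_src (tpV_base_hom tp)) hx (tp_baseK tp).
have L : Lp p (t x) (transport xi).
  apply/(LpP p1 Hlc Hhaus); split; [|exact: transport_equivariant|by exists (Lpn p x xi `^ p)].
  by move=> e ne; apply: xoff => h; apply: ne; apply/transport_fibre; exact: h.
by split => //; apply/(Lpn_leP p1 Hhaus L) => //; exact: Lpn_ge0.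
Qed.

(** Both sides are finite sums over source fibres, matched term by term by [t]. *)
Lemma transport_lambda x phi xi : Sigma_c phi -> equivariant xi ->
  lambda (t x) (transport phi) (transport xi) = transport (lambda x phi xi).
Proof.
move=> Sphi exi; apply/funext => e; have [_ _ ephi] := Sphi.
have [ex|nex] := pselect (src_fibre F (t x) e); last first.
  by rewrite lambda_off// /transport lambda_off// => /transport_fibre.
have gx : src_fibre E x (g e) by exact/transport_fibre.
have [K [uK Kx hK]] := rowset Glc Ghaus (g e) Sphi.
have Kx' k : k \in K -> src k = x by move=> /Kx ->; exact/src_fibreE.
have gdiv (c d : F) : src c = src d -> g (gmul c (ginv d)) = gmul (g c) (ginv (g d)).
  by move=> cd; rewrite (tpV_hom tp (composable_div cd)).2 (homV (tpV_hom tp)).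
rewrite [RHS]/transport (lambda_row Ghaus Sphi exi gx uK Kx' hK).
rewrite (@lambda_row _ _ _ Hhaus (t x) _ _ e (map t K) (transport_Sigma Sphi)
  (transport_equivariant exi) ex).
- rewrite big_map; apply: eq_big_seq => k kK.
  have sl : src (tw_lift F (t k)) = src e.
    by apply/src_pi_eq; rewrite pi_lift -(hom_src (tp_base_hom tp)) Kx'//; apply/esym/src_fibreE.
  have pk : tw_pi (g (tw_lift F (t k))) = k by rewrite (tpV_pi tp) pi_lift (tp_baseK tp).
  have [z cz ez] := lift_fibre (g (tw_lift F (t k))).
  have sk : src (tw_lift E k) = src (g e) by apply/src_pi_eq; rewrite pi_lift Kx.
  rewrite /transport gdiv// ez pk.
  exact: (lambda_term_act ephi exi sk cz).
- by rewrite map_inj_uniq//; exact: can_inj (tp_baseK tp).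
- by move=> _ /mapP[k kK ->]; rewrite -(hom_src (tp_base_hom tp)) Kx'.
- move=> c ce cK; rewrite /transport gdiv//; apply: hK.
    by rewrite -!(hom_src (tpV_hom tp)) ce.
  apply: contra cK => h; apply/mapP; exists (tw_pi (g c)) => //.
  by rewrite (tpV_pi tp) (tp_baseVK tp).
Qed.

Lemma transport_conv phi (psi : E -> R[i]) : Sigma_c phi -> Sigma_c psi ->
  conv (transport phi) (transport psi) = transport (conv phi psi).
Proof.
move=> Sphi [_ _ epsi]; apply/funext => e.
rewrite conv_lambda [RHS]/transport conv_lambda.
have -> : tw_pi (src e) = t (tw_pi (src (g e))).
  by rewrite -(hom_src (tpV_hom tp)) (tpV_pi tp) (tp_baseVK tp).
by rewrite transport_lambda.
Qed.

End Transport.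

Section TransportNorm.
Variables (R : realType) (p : R) (G H : topGroupoid) (E : twist R G) (F : twist R H).
Hypotheses (p1 : 1 <= p).
Hypotheses (Glc : locally_compact [set: G]) (Ghaus : hausdorff_space G).
Hypotheses (Hlc : locally_compact [set: H]) (Hhaus : hausdorff_space H).
Variables (f : E -> F) (g : F -> E) (t : G -> H) (s : H -> G).
Hypothesis tp : twist_pair f g t s.

Lemma transport_rn_le (phi : E -> R[i]) : Sigma_c phi -> rn p (transport g phi) <= rn p phi.
Proof.
move=> Sphi; have tp' := twist_pair_sym tp.
apply: (rn_le p1 Hlc Hhaus (transport_Sigma tp Sphi) (rn_ge0 p1 Glc Ghaus Sphi)) => y eta uy Ly.
have [Ls ns] := transport_Lp p1 Hlc Hhaus Glc Ghaus tp' Ly.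
have us : units G (s y) by exact: (hom_units (tpV_base_hom tp)).
have [_ _ ephi] := Sphi.
have eE : eta = transport g (transport f eta).
  by apply/funext => e; rewrite /transport (tpVK tp).
have es := transport_equivariant tp' (Lp_equivariant Ly).
have Ll := lambda_Lp p1 Glc Ghaus Sphi Ls.
have [_ nl] := transport_Lp p1 Glc Ghaus Hlc Hhaus tp Ll.
have lE : lambda y (transport g phi) eta = transport g (lambda (s y) phi (transport f eta)).
  rewrite [in LHS]eE -{1}(tp_baseVK tp y).
  exact: (transport_lambda Glc Ghaus Hhaus tp (s y) Sphi es).
rewrite lE; rewrite (tp_baseVK tp) in nl.
apply: le_trans nl _; apply: le_trans (rn_bound p1 Glc Ghaus Sphi us Ls) _.
by apply: ler_wpM2l => //; exact: (rn_ge0 p1 Glc Ghaus Sphi).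
Qed.

End TransportNorm.

Section TransportCompletion.
Variables (R : realType) (p : R) (G H : topGroupoid) (E : twist R G) (F : twist R H).
Hypotheses (p1 : 1 <= p).
Hypotheses (Glc : locally_compact [set: G]) (Ghaus : hausdorff_space G) (Get : etale G).
Hypotheses (Hlc : locally_compact [set: H]) (Hhaus : hausdorff_space H) (Het : etale H).
Variables (f : E -> F) (g : F -> E) (t : G -> H) (s : H -> G).
Hypothesis tp : twist_pair f g t s.
Local Notation T := (transport g).

Lemma transport_rn (phi : E -> R[i]) : Sigma_c phi -> rn p (T phi) = rn p phi.
Proof.
move=> Sphi; apply/eqP; rewrite eq_le (transport_rn_le p1 Glc Ghaus Hlc Hhaus tp Sphi) /=.
have := transport_rn_le p1 Hlc Hhaus Glc Ghaus (twist_pair_sym tp) (transport_Sigma tp Sphi).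
suff -> : transport f (T phi) = phi by [].
by apply/funext => e; rewrite /transport (tpK tp).
Qed.

Lemma transport_cauchy (u : nat -> E -> R[i]) : cauchyS p u -> cauchyS p (fun n => T (u n)).
Proof.
move=> [Su cu]; split=> [n|e e0]; first exact: (transport_Sigma tp).
have [n0 h] := cu _ e0; exists n0 => m n hm hn.
have -> : T (u m) - T (u n) = T (u m - u n) by [].
by rewrite transport_rn; [exact: h|exact: Sigma_cB].
Qed.

Lemma transport_ex (a : Fplambda p E) : exists b : Fplambda p F,
  forall u, rep u a -> rep (fun n => T (u n)) b.
Proof.
have ra := rep_repr p1 Glc Ghaus a.
have [b rb] := rep_ex p1 Hlc Hhaus (transport_cauchy (repr_cauchy p1 Glc Ghaus a)).
exists b => u ru; have cu := rep_cauchy p1 Glc Ghaus ru.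
apply: (rep_change p1 Hlc Hhaus rb (transport_cauchy cu)).
apply: small_le (rep_small p1 Glc Ghaus ra ru) _ => n.
have -> : T (repr a n) - T (u n) = T (repr a n - u n) by [].
rewrite transport_rn//; apply: Sigma_cB; last exact: (rep_Sigma p1 Glc Ghaus n ru).
by have [] := repr_cauchy p1 Glc Ghaus a.
Qed.

Definition extension (a : Fplambda p E) : Fplambda p F := sval (cid (transport_ex a)).

Lemma extensionP a u : rep u a -> rep (fun n => T (u n)) (extension a).
Proof. exact: (svalP (cid (transport_ex a))). Qed.

End TransportCompletion.

Section TransportIsomorphism.
Variables (R : realType) (p : R) (G H : topGroupoid) (E : twist R G) (F : twist R H).
Hypotheses (p1 : 1 <= p).
Hypotheses (Glc : locally_compact [set: G]) (Ghaus : hausdorff_space G) (Get : etale G).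
Hypotheses (Hlc : locally_compact [set: H]) (Hhaus : hausdorff_space H) (Het : etale H).

Lemma transport_isometric (f : E -> F) (g : F -> E) (t : G -> H) (s : H -> G) :
  twist_pair f g t s -> exists Phi : Fplambda p E -> Fplambda p F, isometric_isomorphism Phi.
Proof.
move=> tp; have tp' := twist_pair_sym tp.
pose Phi := extension p1 Glc Ghaus Hlc Hhaus tp.
pose Psi := extension p1 Hlc Hhaus Glc Ghaus tp'.
have P1 a u : rep u a -> rep (fun n => transport g (u n)) (Phi a).
  exact: extensionP.
have P2 b v : rep v b -> rep (fun n => transport f (v n)) (Psi b).
  exact: extensionP.
have rE a := rep_repr p1 Glc Ghaus (a : Fplambda p E).
have rF b := rep_repr p1 Hlc Hhaus (b : Fplambda p F).
exists Phi; split.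
  exists Psi => [a|b].
    apply: (rep_inj p1 Glc Ghaus (P2 _ _ (P1 _ _ (rE a)))).
    apply: (eq_rect _ (fun u => rep u a) (rE a)); apply/funext => n; apply/funext => e.
    by rewrite /transport (tpK tp).
  apply: (rep_inj p1 Hlc Hhaus (P1 _ _ (P2 _ _ (rF b)))).
  apply: (eq_rect _ (fun u => rep u b) (rF b)); apply/funext => n; apply/funext => e.
  by rewrite /transport (tpVK tp).
split=> [a b|k a|a b|a].
- apply: (rep_inj p1 Hlc Hhaus (P1 _ _ (rep_D p1 Glc Ghaus (rE a) (rE b)))).
  exact: (rep_D p1 Hlc Hhaus (P1 _ _ (rE a)) (P1 _ _ (rE b))).
- apply: (rep_inj p1 Hlc Hhaus (P1 _ _ (rep_Z p1 Glc Ghaus k (rE a)))).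
  exact: (rep_Z p1 Hlc Hhaus k (P1 _ _ (rE a))).
- have [Sa _] := repr_cauchy p1 Glc Ghaus a; have [Sb _] := repr_cauchy p1 Glc Ghaus b.
  apply: (rep_inj p1 Hlc Hhaus (P1 _ _ (rep_M p1 Glc Ghaus Get (rE a) (rE b)))).
  have h := rep_M p1 Hlc Hhaus Het (P1 _ _ (rE a)) (P1 _ _ (rE b)).
  apply: (eq_rect _ (fun u => rep u _) h); apply/funext => n.
  exact: (transport_conv Glc Ghaus Hhaus tp (Sa n) (Sb n)).
- rewrite (nrmE p1 Hlc Hhaus) (nrmE p1 Glc Ghaus); congr (_%:E).
  have [Sa _] := repr_cauchy p1 Glc Ghaus a.
  apply: small_limR (rep_norm p1 Hlc Hhaus (P1 _ _ (rE a))) _.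
  apply: small_le (rep_norm p1 Glc Ghaus (rE a)) _ => n.
  by rewrite (transport_rn p1 Glc Ghaus Hlc Hhaus tp (Sa n)).
Qed.

(** A proper isomorphism is equivariant because it respects the maps [i]. *)
Lemma twist_pair_of_iso (theta : groupoid_iso G H) :
  properly_isomorphic E (pullback_twist theta F) ->
  exists (f : E -> F) (g : F -> E), twist_pair f g theta (iso_inv theta).
Proof.
move=> [phi [phi_i phi_pi]].
have hphi := @iso_fun_hom _ _ phi.
have fpi e : tw_pi (phi e : F) = theta (tw_pi e).
  by rewrite -phi_pi /= /pullback_pi iso_invK.
have fact z e : circle z -> (phi (tw_act z e) : F) = tw_act z (phi e : F).
  move=> cz; rewrite /tw_act (hphi _ _ (composable_act e cz)).2.
  rewrite phi_i//; last exact: units_pi_rng.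
  by rewrite /= /pullback_i -fpi; congr (gmul (tw_i F (tw_pi _) z) _); rewrite (hom_rng hphi).
exists phi, (iso_inv phi); split.
- exact: iso_funK.
- exact: iso_invK.
- exact: iso_fun_continuous.
- exact: iso_inv_continuous.
- exact: hphi.
- exact: (@iso_inv_hom _ _ phi).
- exact: fpi.
- by move=> e; rewrite -{2}(iso_invK phi e) fpi iso_funK.
- exact: fact.
- by move=> z e cz; rewrite -{1}(iso_invK phi e) -fact// iso_funK.
- exact: iso_funK.
- exact: iso_invK.
- exact: (@iso_fun_hom _ _ theta).
- exact: (@iso_inv_hom _ _ theta).
Qed.

End TransportIsomorphism.

(** * Conclusion *)

Lemma iso_pair_of_isometric (R : realType) (p : R) (G H : topGroupoid) (E : twist R G)
    (F : twist R H) (Phi : Fplambda p E -> Fplambda p F) :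
  isometric_isomorphism Phi -> exists Psi, iso_pair Phi Psi.
Proof.
move=> [[Psi PhiK PsiK] [hD hZ hM hN]]; exists Psi; split => // a.
by rewrite !nrm_fine hN.
Qed.

Theorem corollary7p20 (R : realType) (p : R) (hp1 : 1 <= p) (hp2 : p != 2)
  (G H : topGroupoid)
  (Gtp : topologically_principal G) (Htp : topologically_principal H)
  (Glc : locally_compact [set: G]) (Hlc : locally_compact [set: H])
  (Ghaus : hausdorff_space G) (Hhaus : hausdorff_space H)
  (Get : etale G) (Het : etale H)
  (Gcpt : compact (units G)) (Hcpt : compact (units H))
  (E : twist R G) (F : twist R H) :
  (exists Phi : Fplambda p E -> Fplambda p F, isometric_isomorphism Phi) <->
  (exists theta : groupoid_iso G H,
     twist_class E = twist_class (pullback_twist theta F)).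
Proof.
split=> [[Phi /iso_pair_of_isometric[Psi iso]]|[theta /twist_class_eq h]].
  have nG : nice G by split.
  have nH : nice H by split.
  have [phi eq] := equivariant_iso_ex hp1 hp2 nG nH iso.
  have [theta h] := base_isomorphism eq.
  by exists theta; exact/twist_class_eq.
have [f [g tp]] := twist_pair_of_iso h.
exact: (transport_isometric hp1 Glc Ghaus Get Hlc Hhaus Het tp).
Qed.
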